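(* Let $n\in\mathbb{N}$, $p\in(1,\infty)$, and let $X$ be an $\mathcal{S}'(\mathbb{R}^n)$-valued random variable defined on a probability space $(\Omega,\mathcal{F},\mathbb{P})$. Suppose that there exists a sequence $(\alpha_j)_{j\in\mathbb{N}}\subset(0,1)$ such that $\alpha_j\downarrow0$, $X\in W^{-\alpha_j,p}(\mathbb{R}^n)$ almost surely for every $j\in\mathbb{N}$, and $$\sup_{j\in\mathbb{N}}\mathbb{E}\left[\alpha_j\|X\|_{W^{-\alpha_j,p}}^p\right]<\infty .$$ Assume moreover that, for every $t>0$, the convolution $X\ast\Phi_t$ admits a strongly measurable $L^p(\mathbb{R}^n)$-valued version. Then there exists an $L^p(\mathbb{R}^n)$-valued random variable $Y$ such that $X=Y$ in $\mathcal{S}'(\mathbb{R}^n)$ almost surely. Moreover, $$\mathbb{E}\|Y\|_{L^p}^p\le\frac{p}{2}\liminf_{j\to\infty}\mathbb{E}\left[\alpha_j\|X\|_{W^{-\alpha_j,p}}^p\right].$$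
   Context: $\mathbb{N}$ is the set of positive integers; $\|\cdot\|$ is the Euclidean norm on $\mathbb{R}^n$; $L^p(\mathbb{R}^n)$ is the Lebesgue space with respect to Lebesgue measure, with norm $\|\cdot\|_{L^p}$; $\mathcal{S}'(\mathbb{R}^n)$ is the space of tempered distributions; $\mathbb{E}$ is expectation with respect to $\mathbb{P}$. For $\alpha\in(0,1)$ and $q\in(1,\infty)$, $W^{\alpha,q}(\mathbb{R}^n)$ is the fractional Sobolev space of all $g\in L^q(\mathbb{R}^n)$ with $\int_{\mathbb{R}^n}\int_{\mathbb{R}^n}\frac{|g(x)-g(y)|^q}{\|x-y\|^{n+\alpha q}}\,dx\,dy<\infty$. For $p\in(1,\infty)$ and $\alpha\in(0,1)$, the negative Sobolev space $W^{-\alpha,p}(\mathbb{R}^n)$ is the dual space of $W^{\alpha,q}(\mathbb{R}^n)$, where $\frac1p+\frac1q=1$; since Schwartz functions are dense in $W^{\alpha,q}(\mathbb{R}^n)$, its elements are regarded as tempered distributions. For $t>0$ the heat kernel is $\Phi_t(x)=(4\pi t)^{-n/2}\exp\left(-\frac{\|x\|^2}{4t}\right)$, $x\in\mathbb{R}^n$. For $\alpha\in(0,1)$, the space $W^{-\alpha,p}(\mathbb{R}^n)$ is equipped with the (equivalent) norm $$\|f\|_{W^{-\alpha,p}}=\left(\int_0^1\left(t^{\alpha/2}\|f\ast\Phi_t\|_{L^p}\right)^p\frac{dt}{t}\right)^{1/p},$$ where $\ast$ denotes convolution (of a tempered distribution with a Schwartz function). Convention: $\|f\|_{W^{-\alpha,p}}=+\infty$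 if $f\notin W^{-\alpha,p}(\mathbb{R}^n)$. *)

(* Defs.v *)
From HB Require Import structures.
From mathcomp Require Import all_boot all_order all_algebra.
From mathcomp Require Import all_classical all_reals all_analysis.
From mathcomp Require Import ring lra.

(* All functions and distributions are real-valued, and a point of R^n is a row
   vector. The norm `|x| of the library on row vectors is the maximum norm; the
   Euclidean norm is enorm below. *)

Set Implicit Arguments.
Unset Strict Implicit.
Unset Printing Implicit Defensive.
Import Order.TTheory GRing.Theory Num.Theory.
Import numFieldNormedType.Exports.
Local Open Scope classical_set_scope.
Local Open Scope ring_scope.

Definition rV_display (n : nat) : measure_display.
Proof. exact: default_measure_display. Qed.

(* The sigma-algebra generated by the coordinates, that is, the Borel
   sigma-algebra of R^n. *)
Section measurable_rV.
Context {R : realType} (n : nat).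

Let coord (i : 'I_n) (x : 'rV[R]_n) : measurableTypeR R := x ord0 i.

Let rV_set0 : g_sigma_preimage coord set0.
Proof. exact: sigma_algebra0. Qed.

Let rV_setC A : g_sigma_preimage coord A -> g_sigma_preimage coord (~` A).
Proof. exact: sigma_algebraC. Qed.

Let rV_bigcup (F : (set 'rV[R]_n)^nat) : (forall i, g_sigma_preimage coord (F i)) ->
  g_sigma_preimage coord (\bigcup_i (F i)).
Proof. exact: sigma_algebra_bigcup. Qed.

HB.instance Definition _ := @isMeasurable.Build (rV_display n)
  'rV[R]_n (g_sigma_preimage coord) rV_set0 rV_setC rV_bigcup.

End measurable_rV.

Section measurable_rV_lemmas.
Context {R : realType}.

Lemma measurable_rV_coord n (i : 'I_n) :
  measurable_fun [set: 'rV[R]_n] (fun x : 'rV[R]_n => x ord0 i).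
Proof.
move=> _ Y mY; rewrite setTI; apply: sub_sigma_algebra.
rewrite -bigcup_seq/=; exists i => /=; first by rewrite mem_index_enum.
by exists Y => //; rewrite setTI.
Qed.

Lemma measurable_rVP n d (T : measurableType d) (f : T -> 'rV[R]_n) :
  (forall i, measurable_fun setT (fun x => f x ord0 i)) -> measurable_fun setT f.
Proof.
move=> mf; apply: (@measurability _ _ _ _ _ _
  (\big[setU/set0]_(i < n) preimage_set_system setT
     (fun x : 'rV[R]_n => x ord0 i : measurableTypeR R) measurable)) => //.
move=> _ [B + <-]; rewrite -bigcup_seq/= => -[i _ [A mA <-]].
rewrite setTI; have := mf i measurableT A mA; rewrite setTI => h.
by rewrite setTI.
Qed.

Definition rV_cons n (z : R * 'rV[R]_n) : 'rV[R]_n.+1 :=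
  row_mx (z.1%:M : 'rV[R]_1) z.2.

Definition rV_uncons n (x : 'rV[R]_n.+1) : R * 'rV[R]_n :=
  (x ord0 ord0, \row_i x ord0 (lift ord0 i)).

Lemma rV_cons0 n (z : R * 'rV[R]_n) : rV_cons z ord0 ord0 = z.1.
Proof.
rewrite /rV_cons.
have -> : ord0 = lshift n (ord0 : 'I_1) by apply/val_inj.
by rewrite (row_mxEl (z.1%:M : 'rV[R]_1)) mxE eqxx.
Qed.

Lemma rV_consS n (z : R * 'rV[R]_n) (i : 'I_n) :
  rV_cons z ord0 (lift ord0 i) = z.2 ord0 i.
Proof.
rewrite /rV_cons.
have -> : lift ord0 i = rshift 1 i by apply/val_inj.
by rewrite (row_mxEr (z.1%:M : 'rV[R]_1)).
Qed.

Lemma rV_consK n : cancel (@rV_cons n) (@rV_uncons n).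
Proof.
move=> [a x]; rewrite /rV_uncons rV_cons0/=; congr pair.
by apply/rowP => i; rewrite mxE rV_consS.
Qed.

Lemma rV_unconsK n : cancel (@rV_uncons n) (@rV_cons n).
Proof.
move=> x; apply/rowP => i.
case: (unliftP ord0 i) => [j ->|->]; first by rewrite rV_consS mxE.
by rewrite rV_cons0.
Qed.

Lemma measurable_rV_cons n : measurable_fun setT (@rV_cons n).
Proof.
apply: measurable_rVP => i; case: (unliftP ord0 i) => [j ->|->].
- under eq_fun do rewrite rV_consS.
  by apply: (measurableT_comp (measurable_rV_coord j)); exact: measurable_snd.
- by under eq_fun do rewrite rV_cons0; exact: measurable_fst.
Qed.

Lemma measurable_rV_uncons n : measurable_fun setT (@rV_uncons n).
Proof.
apply/measurable_fun_pairP; split; first exact: measurable_rV_coord.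
apply: measurable_rVP => i /=.
under eq_fun do rewrite mxE.
exact: measurable_rV_coord.
Qed.

End measurable_rV_lemmas.

Section lebesgue_rV_succ.
Context {R : realType} (n : nat) (mu : {sigma_finite_measure set 'rV[R]_n -> \bar R}).
Local Open Scope ereal_scope.

Definition lebesgue_rV_succ : set 'rV[R]_n.+1 -> \bar R :=
  pushforward ((@lebesgue_measure R) \x mu) (@rV_cons R n).

Let mcons A : measurable A -> measurable (@rV_cons R n @^-1` A).
Proof. by move=> mA; rewrite -[X in measurable X]setTI; exact: measurable_rV_cons. Qed.

Let succ0 : lebesgue_rV_succ set0 = 0.
Proof. by rewrite /lebesgue_rV_succ /pushforward preimage_set0 measure0. Qed.

Let succ_ge0 A : 0 <= lebesgue_rV_succ A.
Proof. by rewrite /lebesgue_rV_succ /pushforward; exact: measure_ge0. Qed.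

Let succ_sigma_additive : semi_sigma_additive lebesgue_rV_succ.
Proof.
move=> F mF tF mUF; rewrite /lebesgue_rV_succ /pushforward preimage_bigcup.
apply: measure_semi_sigma_additive.
- by move=> k; exact: mcons.
- apply/trivIsetP => /= i j _ _ ij; rewrite -preimage_setI.
  by move/trivIsetP : tF => /(_ _ _ _ _ ij) ->//; rewrite preimage_set0.
- by rewrite -preimage_bigcup; exact: mcons.
Qed.

HB.instance Definition _ := isMeasure.Build _ _ _ lebesgue_rV_succ
  succ0 succ_ge0 succ_sigma_additive.

Let succ_sigma_finite : sigma_finite setT lebesgue_rV_succ.
Proof.
have /sigma_finiteP[G [TG ndG Goo]] := sigma_finiteT mu.
have /sigma_finiteP[F [TF ndF Foo]] := sigma_finiteT (@lebesgue_measure R).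
exists (fun k => @rV_uncons R n @^-1` (F k `*` G k)).
  apply/esym; rewrite -subTset => x _.
  have [i _ Fi] : (\bigcup_i F i) (rV_uncons x).1 by rewrite -TF.
  have [j _ Gj] : (\bigcup_i G i) (rV_uncons x).2 by rewrite -TG.
  exists (maxn i j) => //; split.
    by move: Fi; exact/subsetPset/ndF/leq_maxl.
  by move: Gj; exact/subsetPset/ndG/leq_maxr.
move=> k; have [mFk Fk] := Foo k; have [mGk Gk] := Goo k.
have mFG : measurable (F k `*` G k) by exact: measurableX.
split.
  by rewrite -[X in measurable X]setTI; exact: measurable_rV_uncons.
rewrite /lebesgue_rV_succ /pushforward -comp_preimage.
rewrite (_ : _ \o _ = id) ?preimage_id; last first.
  by apply/funext => z /=; rewrite rV_consK.
rewrite [X in X < _](product_measure1E lebesgue_measure mu mFk mGk).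
by rewrite lte_mul_pinfty// ge0_fin_numE.
Qed.

HB.instance Definition _ := @Measure_isSigmaFinite.Build _ _ _
  lebesgue_rV_succ succ_sigma_finite.

End lebesgue_rV_succ.

(* Lebesgue measure on R^n as an iterated product; lebesgue_rV_box gives its value
   on boxes. *)
Fixpoint lebesgue_rV {R : realType} (n : nat) :
    {sigma_finite_measure set 'rV[R]_n -> \bar R} :=
  match n return {sigma_finite_measure set 'rV[R]_n -> \bar R} with
  | 0 => @dirac _ 'rV[R]_0 0 R
  | m.+1 => lebesgue_rV_succ (@lebesgue_rV R m)
  end.

Lemma lebesgue_rV_box {R : realType} n (A : 'I_n -> set R) :
  (forall i, measurable (A i)) ->
  (lebesgue_rV n [set x | forall i, A i (x ord0 i)] =
   \prod_(i < n) (@lebesgue_measure R) (A i))%E.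
Proof.
elim: n A => [|n IH] A mA.
  by rewrite big_ord0/= diracE mem_set// => -[].
rewrite big_ord_recl -IH//.
pose B := [set x : 'rV[R]_n | forall i, A (lift ord0 i) (x ord0 i)].
have mB : measurable B.
  rewrite (_ : B = \bigcap_(i in [set: 'I_n])
     ((fun x : 'rV[R]_n => x ord0 i) @^-1` A (lift ord0 i))); last first.
    by apply/seteqP; split => x /= h i; [move=> _; exact: h|exact: h].
  apply: fin_bigcap_measurable => // i _.
  by rewrite -[X in measurable X]setTI; exact: measurable_rV_coord.
rewrite -(product_measure1E lebesgue_measure (lebesgue_rV n) (mA ord0) mB).
rewrite /= /lebesgue_rV_succ /pushforward.
congr product_measure1; apply/seteqP; split => -[a x] /=.
  move=> h; split => [|i]; first by have := h ord0; rewrite rV_cons0.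
  by have := h (lift ord0 i); rewrite rV_consS.
move=> [h1 h2] i; case: (unliftP ord0 i) => [j ->|->]; last by rewrite rV_cons0.
by rewrite rV_consS; exact: h2.
Qed.

Section smooth_functions.
Context {R : realType} {n : nat}.
Implicit Types (f g : 'rV[R]_n -> R) (s : seq 'I_n) (x y : 'rV[R]_n).

Definition enorm x : R := Num.sqrt (\sum_(i < n) x ord0 i ^+ 2).

Definition partial (i : 'I_n) f : 'rV[R]_n -> R :=
  fun x => 'D_(delta_mx ord0 i) f x.

Definition partials s f : 'rV[R]_n -> R := foldr partial f s.

(* All iterated partial derivatives exist and are differentiable everywhere, which
   is the same as being infinitely differentiable. *)
Definition smooth f : Prop := forall s x, differentiable (partials s f) x.

Definition rapidly_decreasing f : Prop :=
  forall (k : nat) s, exists C : R,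
    forall x, (1 + enorm x ^+ 2) ^+ k * `|partials s f x| <= C.

Lemma enorm2 x : enorm x ^+ 2 = \sum_(i < n) x ord0 i ^+ 2.
Proof. by rewrite sqr_sqrtr// sumr_ge0// => i _; exact: sqr_ge0. Qed.

Lemma partialE i f x : differentiable f x ->
  partial i f x = 'd f x (delta_mx ord0 i).
Proof. by move=> df; rewrite /partial deriveE. Qed.

Lemma partials_cons i s f : partials (i :: s) f = partial i (partials s f).
Proof. by []. Qed.

Lemma partials_lin a f g s : smooth f -> smooth g ->
  partials s (a *: f + g) = a *: partials s f + partials s g.
Proof.
move=> sf sg; elim: s => //= i s ->; apply/funext => x.
rewrite /partial deriveD//; last 2 first.
- by apply: diff_derivable; apply: differentiableZ; exact: sf.
- by apply: diff_derivable; exact: sg.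
by rewrite deriveZ//; apply: diff_derivable; exact: sf.
Qed.

Lemma smooth_lin a f g : smooth f -> smooth g -> smooth (a *: f + g).
Proof.
move=> sf sg s x; rewrite partials_lin//.
by apply: differentiableD; [apply: differentiableZ; exact: sf|exact: sg].
Qed.

Lemma partials0 s : partials s (0 : 'rV[R]_n -> R) = 0.
Proof.
elim: s => //= i s ->; apply/funext => x.
exact: (derive_cst (0 : R)).
Qed.

Lemma partials_reflect x f s : smooth f ->
  partials s (fun y => f (x - y)) = (fun y => (-1) ^+ size s * partials s f (x - y)).
Proof.
move=> sf; elim: s => [|i s IH]; first by apply/funext => y; rewrite mul1r.
rewrite partials_cons IH; apply/funext => y.
have dxy : is_diff y (fun y => x - y) (fun z => 0 - z).
  exact: (@is_diffB _ _ _ (cst x) id (cst 0) id).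
have dF : differentiable (partials s f) (x - y) by exact: sf.
have dG : differentiable (partials s f \o (fun y => x - y)) y.
  by apply: differentiable_comp => //; exact: ex_diff.
rewrite partialE; last exact: (@differentiableZ _ _ _ _ ((-1) ^+ size s) _ dG).
rewrite (@diffZ _ _ _ _ ((-1) ^+ size s) _ dG).
rewrite diff_comp//=.
rewrite diff_val sub0r linearN/= -partialE//.
by rewrite exprS scalerN mulN1r mulNr.
Qed.

End smooth_functions.

Section rapid_decay.
Context {R : realType} {n : nat}.
Implicit Types (f g : 'rV[R]_n -> R) (s : seq 'I_n) (x y : 'rV[R]_n).

Lemma enorm_subl x y :
  1 + enorm y ^+ 2 <= 2 * (1 + enorm x ^+ 2) * (1 + enorm (x - y) ^+ 2).
Proof.
have : enorm y ^+ 2 <= 2 * (enorm x ^+ 2 + enorm (x - y) ^+ 2).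
  rewrite !enorm2 -big_split/= mulr_sumr ler_sum// => i _; rewrite !mxE.
  set a := x _ _; set b := y _ _; have := sqr_ge0 (a + (a - b)).
  by nra.
have := sqr_ge0 (enorm x); have := sqr_ge0 (enorm (x - y)).
set a := enorm x ^+ 2; set b := enorm (x - y) ^+ 2 => b0 a0.
by nra.
Qed.

Lemma rapidly_decreasing_lin a f g : smooth f -> smooth g ->
  rapidly_decreasing f -> rapidly_decreasing g ->
  rapidly_decreasing (a *: f + g).
Proof.
move=> sf sg df dg k s; have [C hC] := df k s; have [D hD] := dg k s.
exists (`|a| * C + D) => x; rewrite partials_lin//.
have h : `|(a *: partials s f + partials s g) x| <=
   `|a| * `|partials s f x| + `|partials s g x|.
  by rewrite (le_trans (ler_normD _ _))// normrM.
have w0 : 0 <= (1 + enorm x ^+ 2) ^+ k by rewrite exprn_ge0// addr_ge0// sqr_ge0.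
rewrite (le_trans (ler_wpM2l w0 h))// mulrDr lerD//.
by rewrite mulrCA ler_wpM2l.
Qed.

Lemma rapidly_decreasing_reflect x f : smooth f -> rapidly_decreasing f ->
  rapidly_decreasing (fun y => f (x - y)).
Proof.
move=> sf df k s; have [C hC] := df k s.
exists ((2 * (1 + enorm x ^+ 2)) ^+ k * C) => y.
rewrite partials_reflect// normrM normrX normrN1 expr1n mul1r.
have w0 : 0 <= 2 * (1 + enorm x ^+ 2) by rewrite mulr_ge0// addr_ge0// sqr_ge0.
apply: (@le_trans _ _ ((2 * (1 + enorm x ^+ 2)) ^+ k *
   ((1 + enorm (x - y) ^+ 2) ^+ k * `|partials s f (x - y)|))).
  rewrite mulrA ler_wpM2r// -exprMn lerXn2r// ?nnegrE.
  - by rewrite addr_ge0// sqr_ge0.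
  - by rewrite mulr_ge0// addr_ge0// sqr_ge0.
  - exact: enorm_subl.
by rewrite ler_wpM2l// exprn_ge0.
Qed.

Lemma smooth_reflect x f : smooth f -> smooth (fun y => f (x - y)).
Proof.
move=> sf s y; rewrite partials_reflect//.
apply: (@differentiableZ _ _ _ _ ((-1) ^+ size s)).
apply: (@differentiable_comp _ _ _ _ (fun y => x - y) (partials s f)) => //.
Qed.

End rapid_decay.

Section gaussian.
Context {R : realType} {n : nat}.
Implicit Types (f g : 'rV[R]_n -> R) (s : seq 'I_n) (x y : 'rV[R]_n).

Inductive polynomial_fun : ('rV[R]_n -> R) -> Prop :=
| polynomial_cst c : polynomial_fun (cst c)
| polynomial_coord i : polynomial_fun (fun x => x ord0 i)
| polynomial_add f g :
    polynomial_fun f -> polynomial_fun g -> polynomial_fun (f + g)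
| polynomial_mul f g :
    polynomial_fun f -> polynomial_fun g -> polynomial_fun (f * g).

Lemma polynomial_differentiable f x : polynomial_fun f -> differentiable f x.
Proof.
elim=> [c|i|{}f g _ df _ dg|{}f g _ df _ dg].
- exact: differentiable_cst.
- exact: differentiable_coord.
- exact: differentiableD.
- exact: differentiableM.
Qed.

Lemma polynomial_partial i f : polynomial_fun f -> polynomial_fun (partial i f).
Proof.
elim=> [c|j|{}f g pf df pg dg|{}f g pf df pg dg].
- rewrite (_ : partial i _ = cst 0); first exact: polynomial_cst.
  by apply/funext => x; exact: derive_cst.
- rewrite (_ : partial i _ = cst ((delta_mx ord0 i : 'rV[R]_n) ord0 j)).
    exact: polynomial_cst.
  apply/funext => x; rewrite partialE; last exact: differentiable_coord.
  have hl : linear (fun N : 'rV[R]_n => N ord0 j : R^o).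
    by move=> k u v; rewrite !mxE.
  pose hM := GRing.isLinear.Build _ _ _ _ _ hl.
  pose h : {linear 'rV[R]_n -> R^o} := HB.pack (fun N : 'rV[R]_n => N ord0 j : R^o) hM.
  rewrite (_ : (fun _ => _) = h) // (diff_lin (f := h))//.
  exact: coord_continuous.
- rewrite (_ : partial i _ = partial i f + partial i g).
    exact: polynomial_add.
  by apply/funext => x; rewrite /partial deriveD//;
    apply: diff_derivable; exact: polynomial_differentiable.
- rewrite (_ : partial i _ = f * partial i g + g * partial i f).
    by apply: polynomial_add; exact: polynomial_mul.
  by apply/funext => x; rewrite /partial deriveM//;
    apply: diff_derivable; exact: polynomial_differentiable.
Qed.

Lemma polynomial_growth f : polynomial_fun f ->
  exists (C : R) m, 0 <= C /\ forall x, `|f x| <= C * (1 + enorm x ^+ 2) ^+ m.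
Proof.
elim=> [c|i|{}f g _ [C [m [C0 hC]]] _ [D [k [D0 hD]]]|
        {}f g _ [C [m [C0 hC]]] _ [D [k [D0 hD]]]].
- by exists `|c|, 0%N; split => // x; rewrite expr0 mulr1.
- exists 1, 1%N; split => // x; rewrite mul1r expr1 enorm2.
  apply: (@le_trans _ _ (1 + x ord0 i ^+ 2)).
    by rewrite -real_normK ?num_real//; set a := `|_|; nra.
  rewrite lerD2l (bigD1 i)//= lerDl sumr_ge0// => j _; exact: sqr_ge0.
- exists (C + D), (m + k)%N; split => [|x]; first exact: addr_ge0.
  have w1 : 1 <= 1 + enorm x ^+ 2 by rewrite lerDl sqr_ge0.
  rewrite (le_trans (ler_normD _ _))// mulrDl lerD//.
    by rewrite (le_trans (hC x))// ler_wpM2l// ler_weXn2l// leq_addr.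
  by rewrite (le_trans (hD x))// ler_wpM2l// ler_weXn2l// leq_addl.
- exists (C * D), (m + k)%N; split => [|x]; first exact: mulr_ge0.
  by rewrite normrM exprD mulrACA ler_pM.
Qed.

Definition gaussian (a : R) : 'rV[R]_n -> R := fun x => expR (- (a * enorm x ^+ 2)).

Let qf (a : R) : 'rV[R]_n -> R := fun x => - (a * enorm x ^+ 2).

Let qf_poly a : polynomial_fun (qf a).
Proof.
rewrite (_ : qf a = cst (- a) * (\sum_(i < n) (fun x => x ord0 i) * (fun x => x ord0 i))).
  apply: polynomial_mul; first exact: polynomial_cst.
  elim/big_rec : _ => [|i f _ pf]; first exact: polynomial_cst.
  by apply: polynomial_add => //; apply: polynomial_mul; exact: polynomial_coord.
apply/funext => x; rewrite /qf enorm2 -mulNr [RHS]/GRing.mul/=; congr (_ * _).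
by rewrite fct_sumE; apply: eq_bigr => i _; rewrite expr2.
Qed.

Lemma gaussian_differentiable a x : differentiable (gaussian a) x.
Proof.
apply: (@differentiable_comp _ _ _ _ (qf a) expR).
  exact/polynomial_differentiable/qf_poly.
by apply/derivable1_diffP; exact: derivable_expR.
Qed.

Lemma gaussian_partial a i : partial i (gaussian a) = partial i (qf a) * gaussian a.
Proof.
apply/funext => x; rewrite partialE; last exact: gaussian_differentiable.
have dq : differentiable (qf a) x by exact/polynomial_differentiable/qf_poly.
have de : differentiable (@expR R) (qf a x).
  by apply/derivable1_diffP; exact: derivable_expR.
rewrite (diff_comp dq de)/= diff1E// derive1E derive_val.
by rewrite -partialE.
Qed.

Lemma gaussian_partials a f s : polynomial_fun f ->
  exists2 g, polynomial_fun g & partials s (f * gaussian a) = g * gaussian a.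
Proof.
move=> pf; elim: s => [|i s [g pg IH]]; first by exists f.
exists (partial i g + g * partial i (qf a)).
  apply: polynomial_add; first exact: polynomial_partial.
  by apply: polynomial_mul => //; exact/polynomial_partial/qf_poly.
rewrite partials_cons IH; apply/funext => x.
rewrite /partial deriveM//; last 2 first.
- exact/diff_derivable/polynomial_differentiable.
- exact/diff_derivable/gaussian_differentiable.
rewrite -/(partial i (gaussian a) x) gaussian_partial.
transitivity (g x * (partial i (qf a) x * gaussian a x) +
  gaussian a x * partial i g x) => //.
transitivity ((partial i g x + g x * partial i (qf a) x) * gaussian a x) => //.
by ring.
Qed.

Lemma gaussian_decay a m : 0 < a ->
  exists C, forall x, (1 + enorm x ^+ 2) ^+ m * gaussian a x <= C.
Proof.
move=> a0; exists ((1 + a^-1) ^+ m * (m`!%:R * expR 1)) => x.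
rewrite /gaussian; set u := enorm x ^+ 2.
have u0 : 0 <= u by rewrite sqr_ge0.
have au0 : 0 <= 1 + a * u by rewrite addr_ge0// mulr_ge0// ltW.
have h1 : 1 + u <= (1 + a^-1) * (1 + a * u).
  rewrite mulrDl mul1r mulrDr mulr1 mulKf ?gt_eqF//.
  have := mulr_ge0 (ltW a0) u0; have : 0 <= a^-1 by rewrite invr_ge0 ltW.
  by lra.
have h2 : (1 + a * u) ^+ m <= m`!%:R * expR (1 + a * u).
  case: m => [|m].
    by rewrite expr0 fact0 mul1r (le_trans _ (expR_ge1Dx _))// lerDl.
  rewrite -ler_pdivrMl ?ltr0n ?fact_gt0// mulrC.
  by rewrite (le_trans _ (expR_ge1Dxn m au0))// lerDr.
have h3 : (1 + u) ^+ m <= (1 + a^-1) ^+ m * (m`!%:R * expR (1 + a * u)).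
  apply: (@le_trans _ _ (((1 + a^-1) * (1 + a * u)) ^+ m)).
    by rewrite lerXn2r// ?nnegrE ?addr_ge0// mulr_ge0// addr_ge0// invr_ge0 ltW.
  rewrite exprMn ler_wpM2l// exprn_ge0// addr_ge0// invr_ge0 ltW//.
rewrite (le_trans (ler_wpM2r (expR_ge0 _) h3))//.
by rewrite -!mulrA -expRD -addrA subrr addr0.
Qed.

Lemma gaussian_smooth a c : smooth (fun x => c * gaussian a x).
Proof.
move=> s x; have [g pg hg] := gaussian_partials a s (polynomial_cst c).
rewrite (_ : (fun _ => _) = cst c * gaussian a)// hg.
apply: differentiableM; first exact: polynomial_differentiable.
exact: gaussian_differentiable.
Qed.

Lemma gaussian_rapidly_decreasing a c : 0 < a ->
  rapidly_decreasing (fun x => c * gaussian a x).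
Proof.
move=> a0 k s; have [g pg hg] := gaussian_partials a s (polynomial_cst c).
have [C [m [C0 hC]]] := polynomial_growth pg.
have [D hD] := gaussian_decay (k + m) a0.
exists (C * D) => x.
rewrite (_ : (fun _ => _) = cst c * gaussian a)// hg.
have w0 : 0 <= (1 + enorm x ^+ 2) ^+ k by rewrite exprn_ge0// addr_ge0// sqr_ge0.
have g0 : 0 <= gaussian a x by exact: expR_ge0.
apply: (le_trans _ (ler_wpM2l C0 (hD x))).
rewrite [X in `|X|]/GRing.mul/= normrM (ger0_norm g0) exprD.
rewrite (_ : C * _ = (1 + enorm x ^+ 2) ^+ k * (C * (1 + enorm x ^+ 2) ^+ m) * gaussian a x).
  by rewrite [leLHS]mulrA ler_wpM2r// ler_wpM2l.
by ring.
Qed.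

End gaussian.

Section schwartz.
Context (R : realType) (n : nat).

Definition schwartz_pred : {pred 'rV[R]_n -> R} :=
  mem [set f | smooth f /\ rapidly_decreasing f].

Lemma schwartz_submod_closed : submod_closed schwartz_pred.
Proof.
split=> [|a f g]; rewrite !inE/=.
  by split=> [s x|k s]; [|exists 0 => x]; rewrite partials0// normr0 mulr0.
move=> [sf df] [sg dg]; split; first exact: smooth_lin.
exact: rapidly_decreasing_lin.
Qed.

HB.instance Definition _ :=
  GRing.isSubmodClosed.Build _ _ schwartz_pred schwartz_submod_closed.

Record schwartz := Schwartz {
  schwartz_fun :> 'rV[R]_n -> R;
  schwartz_funP : schwartz_fun \in schwartz_pred }.

HB.instance Definition _ := [isSub for schwartz_fun].
HB.instance Definition _ := [Choice of schwartz by <:].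
HB.instance Definition _ := [SubChoice_isSubLmodule of schwartz by <:].

(* The Schwartz topology: the coarsest one for which every weighted derivative
   (1 + |x|^2)^k D^s phi depends continuously on phi for uniform convergence on
   R^n. *)
Definition schwartz_weighted (phi : schwartz) :
    {ptws (nat * seq 'I_n)%type -> {uniform 'rV[R]_n -> R}} :=
  fun ks x => (1 + enorm x ^+ 2) ^+ ks.1 * partials ks.2 phi x.

HB.instance Definition _ :=
  Uniform.copy schwartz (initial_topology schwartz_weighted).

Lemma schwartz_weighted_continuous : continuous schwartz_weighted.
Proof. exact: initial_continuous. Qed.

Lemma reflect_in_schwartz (x : 'rV[R]_n) (phi : schwartz) :
  (fun y => phi (x - y)) \in schwartz_pred.
Proof.
have := schwartz_funP phi; rewrite !inE/= => -[sphi dphi].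
by split; [exact: smooth_reflect|exact: rapidly_decreasing_reflect].
Qed.

Definition schwartz_reflect (x : 'rV[R]_n) (phi : schwartz) : schwartz :=
  Schwartz (reflect_in_schwartz x phi).

Definition heat_kernel (t : R) (x : 'rV[R]_n) : R :=
  (4 * pi * t) `^ (- n%:R / 2) * expR (- (enorm x ^+ 2 / (4 * t))).

Lemma heat_kernel_in_schwartz t : 0 < t -> heat_kernel t \in schwartz_pred.
Proof.
move=> t0; rewrite (_ : heat_kernel t = fun x =>
    (4 * pi * t) `^ (- n%:R / 2) * gaussian (4 * t)^-1 x); last first.
  by apply/funext => x; rewrite /heat_kernel /gaussian (mulrC (_ ^-1)).
rewrite inE/=; split; first exact: gaussian_smooth.
by apply: gaussian_rapidly_decreasing; rewrite invr_gt0 mulr_gt0.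
Qed.

(* For t <= 0 the kernel is not a Schwartz function and heat t is 0; heatE covers
   the relevant case. *)
Definition heat (t : R) : schwartz := insubd 0 (heat_kernel t).

Lemma heatE t : 0 < t -> heat t = heat_kernel t :> ('rV[R]_n -> R).
Proof. by move=> t0; rewrite /heat insubdK//; exact: heat_kernel_in_schwartz. Qed.

End schwartz.

Section tempered.
Context (R : realType) (n : nat).

Record tempered := Tempered {
  tempered_fun :> {scalar schwartz R n};
  tempered_continuous : continuous (tempered_fun : schwartz R n -> R) }.

HB.instance Definition _ := gen_eqMixin tempered.
HB.instance Definition _ := gen_choiceMixin tempered.

Definition tempered0 : tempered.
Proof.
exists (\0 : {scalar schwartz R n}); exact: cst_continuous.
Defined.

HB.instance Definition _ := isPointed.Build tempered tempered0.

(* Tempered distributions carry the cylindrical sigma-algebra, so X is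
   measurable iff each pairing with a Schwartz function is a real random variable.
   It coincides with the Borel sigma-algebras of the weak-* and of the strong
   topology. *)
Definition tempered_eval (phi : schwartz R n) (T : tempered) : R := T phi.

Definition tempered_cylinders : set (set tempered) :=
  \bigcup_phi preimage_set_system setT (tempered_eval phi) measurable.

HB.instance Definition _ := @isMeasurable.Build (sigma_display tempered_cylinders)
  tempered <<s tempered_cylinders >>
  (@sigma_algebra0 _ setT tempered_cylinders)
  (@sigma_algebraC _ tempered_cylinders)
  (@sigma_algebra_bigcup _ setT tempered_cylinders).

Definition convolution (T : tempered) (phi : schwartz R n) (x : 'rV[R]_n) : R :=
  T (schwartz_reflect x phi).

End tempered.

Section sobolev.
Context (R : realType) (n : nat).
Local Notation mu := (@lebesgue_rV R n).
Local Open Scope ereal_scope.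

(* The diagonal x = y is a null set; there the integrand is 0. *)
Definition gagliardo (alpha q : R) (g : 'rV[R]_n -> R) : \bar R :=
  \int[mu]_y \int[mu]_x
    (`|g x - g y| `^ q / enorm (x - y) `^ (n%:R + alpha * q))%:E.

Definition sobolev (alpha q : R) : set ('rV[R]_n -> R) :=
  [set g | g \in Lfun mu q%:E /\ gagliardo alpha q g < +oo].

Definition sobolev_norm (alpha q : R) (g : 'rV[R]_n -> R) : \bar R :=
  ('N[mu]_q%:E [EFin \o g] `^ q + gagliardo alpha q g) `^ q^-1.

(* A continuous linear functional on the fractional Sobolev space, given on
   representatives: by linearity and the bound, l takes the same value on functions
   that agree almost everywhere. Values of l outside the space are irrelevant. *)
Definition sobolev_dual (alpha q : R) (l : ('rV[R]_n -> R) -> R) : Prop :=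
  (forall (a : R) g h, sobolev alpha q g -> sobolev alpha q h ->
    l (a *: g + h)%R = (a * l g + l h)%R) /\
  (exists C : R, forall g, sobolev alpha q g ->
    `|l g|%:E <= C%:E * sobolev_norm alpha q g).

(* The tempered distributions that come from the dual of the Sobolev space with
   the conjugate exponent q = (1 - 1/p)^-1. *)
Definition neg_sobolev (alpha p : R) : set (tempered R n) :=
  [set T : tempered R n | exists2 l, sobolev_dual alpha (1 - p^-1)^-1 l &
     forall phi : schwartz R n, T phi = l phi].

Definition neg_sobolev_norm (alpha p : R) (T : tempered R n) : \bar R :=
  if `[< neg_sobolev alpha p T >] then
    (\int[@lebesgue_measure R]_(t in `]0%R, 1%R[)
      (((t `^ (alpha / 2))%:E *
        'N[mu]_p%:E [EFin \o convolution T (heat n t)]) `^ p * t^-1%:E))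
    `^ p^-1
  else +oo.

End sobolev.

Section Lp_random_variables.
Context (R : realType) (n : nat) (p : R) (p1 : 1 < p).
Local Notation mu := (@lebesgue_rV R n).

Lemma ltW_EFin : (1 <= p%:E)%E.
Proof. by rewrite lee_fin ltW. Qed.

(* Elements of Lp are classes modulo almost everywhere equality; they coerce to
   functions through a representative. *)
Definition Lp := LspaceType mu ltW_EFin.

Definition Lp_norm (f : Lp) : \bar R := 'N[mu]_p%:E [EFin \o f]%E.

Definition Lp_dist (f g : Lp) : \bar R := 'N[mu]_p%:E [(fun x => (f x - g x)%:E)]%E.

Definition Lp_open (U : set Lp) : Prop :=
  forall f, U f -> exists2 e : R, 0 < e & [set g | (Lp_dist f g < e%:E)%E] `<=` U.

Definition Lp_to_distribution (f : Lp) (phi : schwartz R n) : R :=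
  \int[mu]_x (f x * phi x).

Context (d : measure_display) (Omega : measurableType d).

(* Measurability for the Borel sigma-algebra of the norm topology. *)
Definition Lp_random_variable (Y : Omega -> Lp) : Prop :=
  forall B, <<s Lp_open >> B -> measurable (Y @^-1` B).

Definition Lp_simple (Z : Omega -> Lp) : Prop :=
  finite_set (range Z) /\ forall f, measurable (Z @^-1` [set f]).

Definition Lp_strongly_measurable (Z : Omega -> Lp) : Prop :=
  exists Zk : nat -> Omega -> Lp, (forall k, Lp_simple (Zk k)) /\
    forall w, Lp_dist (Zk k w) (Z w) @[k --> \oo] --> 0%E.

End Lp_random_variables.

(* Main.v *)
Require Import Defs.
From HB Require Import structures.
From mathcomp Require Import all_boot all_order all_algebra.
From mathcomp Require Import all_classical all_reals all_analysis.
From mathcomp Require Import measurable_realfun.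
From mathcomp Require Import ring lra.
Set Implicit Arguments.
Unset Strict Implicit.
Unset Printing Implicit Defensive.
Import Order.TTheory GRing.Theory Num.Theory.
Import numFieldNormedType.Exports.
Local Open Scope classical_set_scope.
Local Open Scope ring_scope.

(* Write u_t for X * Phi_t and N(t) for its p-th power L^p norm. If X represents a
functional l on W^(alpha,q), then u_t(x) is l applied to a translate of Phi_t;
passing l under integrals gives u_(s+t) = u_s * Phi_t and u_t -> X in S', so N is
nonincreasing. Hence alpha ||X||^p is at least
alpha N(delta) int_0^delta t^(alpha p / 2 - 1) dt = (2 / p) delta^(alpha p / 2) N(delta),
and letting j -> oo and then delta -> 0 (monotone convergence) bounds E sup N by
(p / 2) liminf. When sup N is finite, u_t is Cauchy in L^p as t -> 0: further
smoothing shows that the norm of (u_s + u_t) / 2 is also close to the supremum, so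
uniform convexity applies. The limit Y represents X, and it is measurable as an L^p
limit of the strongly measurable versions of u_(1/k). *)

(** * Integration on R^n *)

(** The functional [l] is only given on representatives of Sobolev functions, so no vector-valued
    integral is at hand to commute with it. It is exchanged with Riemann sums over finitely many
    cells, and their error is measured by the q-th power of the Sobolev norm ([energy]). The error
    vanishes because translations of a Schwartz function are continuous in this norm. This is where
    [alpha < 1] enters: an exponent strictly between [alpha] and 1 leaves both a positive power of
    the translation and an integrable Gagliardo kernel.

    The lower bound for the average of two flows has its own obstacle: [u r] and [u (r + t)] are
    uniformly close for small [t], which says nothing about p-th powers integrated over a space of
    infinite measure. Subtracting a small level from [|u r|] repairs this.

    Measurability in [w] of the negative Sobolev norm of [X w] is never established. Only
    monotonicity of the integral of nonnegative functions is applied to it, and every measurable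
    object is built from the strongly measurable versions. *)

Section integral_rV.
Context {R : realType}.
Local Open Scope ereal_scope.
Local Notation leb := (@lebesgue_measure R).

Lemma ge0_integral_rV0 (f : 'rV[R]_0 -> \bar R) :
  measurable_fun [set: 'rV[R]_0] f ->
  (forall x, 0 <= f x) -> \int[lebesgue_rV 0]_x f x = f 0%R.
Proof.
by move=> mf f0; rewrite integral_dirac// diracT mul1e.
Qed.

(** The measure in dimension [n.+1] is the image of a product measure under [rV_cons], so Tonelli
    peels off the first coordinate. The inductions on the dimension below rest on this. *)
Lemma ge0_integral_rV_succ n (f : 'rV[R]_n.+1 -> \bar R) :
  measurable_fun setT f -> (forall x, 0 <= f x) ->
  \int[lebesgue_rV n.+1]_x f x =
  \int[leb]_a \int[lebesgue_rV n]_x f (rV_cons (a, x)).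
Proof.
move=> mf f0.
have mc : measurable_fun setT (f \o @rV_cons R n).
  by apply: measurableT_comp => //; exact: measurable_rV_cons.
transitivity (\int[leb \x lebesgue_rV n]_z (f \o @rV_cons R n) z); last first.
  by rewrite fubini_tonelli1//; move=> x; exact: f0.
transitivity (\int[pushforward (leb \x lebesgue_rV n) (@rV_cons R n)]_x f x).
  by [].
rewrite ge0_integral_pushforward//.
exact: measurable_rV_cons.
Qed.

Lemma measurable_rV_cons_fun n (f : 'rV[R]_n.+1 -> \bar R) :
  measurable_fun setT f -> forall a,
  measurable_fun setT (fun x : 'rV[R]_n => f (rV_cons (a, x))).
Proof.
move=> mf a.
apply: (measurableT_comp mf).
apply: (measurableT_comp (@measurable_rV_cons R n)); exact: measurable_pair1.
Qed.

Lemma measurable_integral_rV_cons n (f : 'rV[R]_n.+1 -> \bar R) :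
  measurable_fun setT f -> (forall x, 0 <= f x) ->
  measurable_fun setT (fun a => \int[lebesgue_rV n]_x f (rV_cons (a, x))).
Proof.
move=> mf f0.
apply: (measurable_fun_fubini_tonelli_F (f \o @rV_cons R n)); last by move=> x; exact: f0.
by apply: measurableT_comp => //; exact: measurable_rV_cons.
Qed.

Lemma lebesgue_measure_shift (a : R) (A : set R) : measurable A ->
  pushforward leb ((fun x => x + a)%R : _ -> measurableTypeR R) A = leb A.
Proof.
move=> mA; apply/esym/lebesgue_measure_unique => //=.
  exact: measurable_funD.
move=> ? _ [[b c]] _ <-.
rewrite /pushforward.
rewrite (_ : _ @^-1` _ = `](b - a)%R, (c - a)%R]%classic); last first.
  by apply/seteqP; split => x /=; rewrite !in_itv/= ltrBlDr lerBrDr.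
rewrite /= !lebesgue_measure_itv/= !lte_fin ltrD2r.
by case: ifP => // _; rewrite -!EFinB; congr EFin; lra.
Qed.

Lemma ge0_integral_lebesgue_shift (a : R) (f : R -> \bar R) :
  measurable_fun setT f -> (forall x, 0 <= f x) ->
  \int[leb]_x f (x + a)%R = \int[leb]_x f x.
Proof.
move=> mf f0.
have ma : measurable_fun [set: measurableTypeR R] ((fun x => x + a)%R : _ -> measurableTypeR R).
  by apply: measurable_funD.
rewrite -(@ge0_integral_pushforward _ _ _ _ R _ ma leb setT)//.
by apply: eq_measure_integral => A mA _; exact: lebesgue_measure_shift.
Qed.

Lemma ge0_integral_lebesgueN (f : R -> \bar R) :
  measurable_fun setT f -> (forall x, 0 <= f x) ->
  \int[leb]_x f (- x)%R = \int[leb]_x f x.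
Proof.
move=> mf f0.
have ma : measurable_fun [set: measurableTypeR R] (-%R : _ -> measurableTypeR R).
  by [].
rewrite -(@ge0_integral_pushforward _ _ _ _ R _ ma leb setT)//.
by apply: eq_measure_integral => A mA _; exact: lebesgue_measureN.
Qed.

Lemma measurable_addrV n (a : 'rV[R]_n) : measurable_fun setT (fun x : 'rV[R]_n => x + a)%R.
Proof.
apply: measurable_rVP => i; under eq_fun do rewrite mxE.
by apply: measurable_funD => //; exact: measurable_rV_coord.
Qed.

Lemma measurable_opprV n : measurable_fun setT (fun x : 'rV[R]_n => - x)%R.
Proof.
apply: measurable_rVP => i; under eq_fun do rewrite mxE.
by apply: measurableT_comp => //; exact: measurable_rV_coord.
Qed.

Lemma rV_consD n (a b : R) (x y : 'rV[R]_n) :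
  (rV_cons (a, x) + rV_cons (b, y) = rV_cons (a + b, x + y))%R.
Proof.
apply/rowP => i; rewrite mxE; case: (unliftP ord0 i) => [j ->|->].
  by rewrite !rV_consS/= mxE.
by rewrite !rV_cons0.
Qed.

Lemma rV_consN n (a : R) (x : 'rV[R]_n) : (- rV_cons (a, x) = rV_cons (- a, - x))%R.
Proof.
apply/rowP => i; rewrite mxE; case: (unliftP ord0 i) => [j ->|->].
  by rewrite !rV_consS/= mxE.
by rewrite !rV_cons0.
Qed.

Lemma ge0_integral_shift n (a : 'rV[R]_n) (f : 'rV[R]_n -> \bar R) :
  measurable_fun setT f -> (forall x, 0 <= f x) ->
  \int[lebesgue_rV n]_x f (x + a)%R = \int[lebesgue_rV n]_x f x.
Proof.
elim: n a f => [|n IH] a f mf f0.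
  by congr integral; apply/funext => x; congr f; apply/rowP => -[].
have mfa : measurable_fun setT (fun x : 'rV[R]_n.+1 => f (x + a)%R).
  by apply: measurableT_comp => //; exact: measurable_addrV.
rewrite (ge0_integral_rV_succ mfa (fun x => f0 _)) (ge0_integral_rV_succ mf f0).
rewrite -(@ge0_integral_lebesgue_shift (a ord0 ord0)
   (fun b => \int[lebesgue_rV n]_x f (rV_cons (b, x)))); last 2 first.
- exact: measurable_integral_rV_cons.
- by move=> b; exact: integral_ge0.
apply: eq_integral => b _.
rewrite -(IH (rV_uncons a).2 (fun x => f (rV_cons ((b + a ord0 ord0)%R, x))))//; last exact: (measurable_rV_cons_fun mf).
by apply: eq_integral => x _; rewrite -{1}(rV_unconsK a) rV_consD.
Qed.

Lemma ge0_integralN n (f : 'rV[R]_n -> \bar R) :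
  measurable_fun setT f -> (forall x, 0 <= f x) ->
  \int[lebesgue_rV n]_x f (- x)%R = \int[lebesgue_rV n]_x f x.
Proof.
elim: n f => [|n IH] f mf f0.
  by congr integral; apply/funext => x; congr f; apply/rowP => -[].
have mfa : measurable_fun setT (fun x : 'rV[R]_n.+1 => f (- x)%R).
  by apply: measurableT_comp => //; exact: measurable_opprV.
rewrite (ge0_integral_rV_succ mfa (fun x => f0 _)) (ge0_integral_rV_succ mf f0).
rewrite -(@ge0_integral_lebesgueN
   (fun b => \int[lebesgue_rV n]_x f (rV_cons (b, x)))); last 2 first.
- exact: measurable_integral_rV_cons.
- by move=> b; exact: integral_ge0.
apply: eq_integral => b _.
rewrite -(IH (fun x => f (rV_cons ((- b)%R, x))))//; last exact: (measurable_rV_cons_fun mf).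
by apply: eq_integral => x _; rewrite rV_consN.
Qed.

Lemma ge0_integral_reflect n (a : 'rV[R]_n) (f : 'rV[R]_n -> \bar R) :
  measurable_fun setT f -> (forall x, 0 <= f x) ->
  \int[lebesgue_rV n]_x f (a - x)%R = \int[lebesgue_rV n]_x f x.
Proof.
move=> mf f0; rewrite -[RHS](ge0_integral_shift a)//.
rewrite -[RHS]ge0_integralN//.
- by apply: eq_integral => x _; rewrite addrC.
- by apply: (measurableT_comp mf); exact: measurable_addrV.
Qed.

Lemma measurable_prod_rV n (f : 'I_n -> R -> R) :
  (forall i, measurable_fun setT (f i)) ->
  measurable_fun setT (fun x : 'rV[R]_n => \prod_(i < n) f i (x ord0 i))%R.
Proof.
move=> mf; apply: measurable_prod => i _ .
by apply: (measurableT_comp (mf i)); exact: measurable_rV_coord.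
Qed.

(** Reduces integrals over R^n to the line: the heat kernel is a product of one-dimensional kernels,
    and the majorants of [weight] and [cut_kernel] are products as well. *)
Lemma ge0_integral_prod_rV n (f : 'I_n -> R -> R) :
  (forall i, measurable_fun setT (f i)) -> (forall i x, (0 <= f i x)%R) ->
  \int[lebesgue_rV n]_x (\prod_(i < n) f i (x ord0 i))%:E =
  \prod_(i < n) \int[leb]_x (f i x)%:E.
Proof.
elim: n f => [|n IH] f mf f0.
  rewrite ge0_integral_rV0 ?big_ord0//.
  - by apply/measurable_EFinP; apply: measurable_prod_rV.
  - by move=> x; rewrite big_ord0.
rewrite ge0_integral_rV_succ; last 2 first.
- by apply/measurable_EFinP; exact: measurable_prod_rV.
- by move=> x; rewrite lee_fin prodr_ge0.
rewrite big_ord_recl -IH//.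
rewrite -ge0_integralZr//; last 3 first.
- by apply/measurable_EFinP; exact: mf.
- by move=> x _; rewrite lee_fin.
- by apply: integral_ge0 => x _; rewrite lee_fin prodr_ge0.
apply: eq_integral => a _; rewrite -ge0_integralZl//; last 3 first.
- by apply/measurable_EFinP; exact: (measurable_prod_rV (fun i => mf (lift ord0 i))).
- by move=> x _; rewrite lee_fin prodr_ge0.
- by rewrite lee_fin.
apply: eq_integral => x _; rewrite big_ord_recl rV_cons0 EFinM; congr (_ * _%:E).
by apply: eq_bigr => i _; rewrite rV_consS.
Qed.

End integral_rV.

(** * The Euclidean norm and Riemann meshes *)

Section euclidean_norm.
Context {R : realType} {n : nat}.
Implicit Types x y : 'rV[R]_n.

Lemma enorm_ge0 x : 0 <= enorm x.
Proof. exact: sqrtr_ge0. Qed.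

Lemma enorm_coord x i : `|x ord0 i| <= enorm x.
Proof.
rewrite -(@ler_pXn2r _ 2)// ?nnegrE ?normr_ge0 ?enorm_ge0//.
rewrite enorm2 real_normK ?num_real// (bigD1 i)//= lerDl.
by rewrite sumr_ge0// => j _; exact: sqr_ge0.
Qed.

Lemma enorm_le_sum x : enorm x <= \sum_(i < n) `|x ord0 i|.
Proof.
have s0 : 0 <= \sum_(i < n) `|x ord0 i| by exact: sumr_ge0.
rewrite -(@ler_pXn2r _ 2)// ?nnegrE ?enorm_ge0// enorm2.
have : forall r : seq 'I_n, \sum_(i <- r) x ord0 i ^+ 2 <= (\sum_(i <- r) `|x ord0 i|) ^+ 2.
  elim => [|i r IH]; first by rewrite !big_nil expr0n.
  rewrite !big_cons.
  have r0 : 0 <= \sum_(j <- r) `|x ord0 j| by exact: sumr_ge0.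
  have := normr_ge0 (x ord0 i); rewrite -(real_normK (num_real (x ord0 i))).
  by move: IH r0; set a := `|x ord0 i|; set b := \sum_(j <- r) _; set c := \sum_(j <- r) _; nra.
exact.
Qed.

Lemma enormZ (a : R) x : enorm (a *: x) = `|a| * enorm x.
Proof.
rewrite /enorm -[in RHS]sqrtr_sqr -sqrtrM ?sqr_ge0//; congr Num.sqrt.
by rewrite mulr_sumr; apply: eq_bigr => i _; rewrite mxE exprMn.
Qed.

Lemma enormN x : enorm (- x) = enorm x.
Proof. by rewrite -scaleN1r enormZ normrN1 mul1r. Qed.

Lemma measurable_enorm : measurable_fun setT (@enorm R n).
Proof.
apply: (measurableT_comp (f := @Num.sqrt R)).
  by apply: continuous_measurable_fun; exact: sqrt_continuous.
apply: measurable_sum => i; apply: measurable_funX; exact: measurable_rV_coord.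
Qed.

End euclidean_norm.

(** * Finite cell decompositions of R^n *)

Section mesh.
Context {R : realType} {n : nat}.

(** With K = k + 1, the cube [-K, K)^n is cut into cells of side 1/K, and [node] is the lower corner
    of a cell. The finitely many cells cover all of R^n: a coordinate below -K is truncated to index
    0, and an index out of range is sent to 0 by [inord]. This is harmless, since a fixed point lies
    in the cube for all large k. *)
Definition cell (k : nat) (x : 'rV[R]_n) : {ffun 'I_n -> 'I_(2 * k.+1 ^ 2).+1} :=
  [ffun i => inord (Num.truncn ((x ord0 i + k.+1%:R) * k.+1%:R))].

Definition node (k : nat) (c : {ffun 'I_n -> 'I_(2 * k.+1 ^ 2).+1}) : 'rV[R]_n :=
  \row_i ((c i)%:R / k.+1%:R - k.+1%:R).

Definition mesh (k : nat) (x : 'rV[R]_n) : 'rV[R]_n := node (cell k x).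

Lemma measurable_truncn_preimage (D : set nat) :
  measurable [set r : R | D (Num.truncn r)].
Proof.
(* The level set of index m is {r < m + 1} minus {r < m}. For m = 0 nothing is removed, because
   [Num.truncn] sends negative numbers to 0. *)
rewrite (_ : [set _ | _] = \bigcup_(m in D)
   ([set r : R | r < m.+1%:R] `\` (if m is m'.+1 then [set r : R | r < m'.+1%:R] else set0))).
  apply: bigcup_measurable => m _.
  have mlt (a : R) : measurable [set r : R | r < a].
    by rewrite (_ : [set _ | _] = `]-oo, a[%classic)//; apply/seteqP; split => x /=; rewrite in_itv.
  by apply: measurableD => //; case: m => [|m].
apply/seteqP; split => [r /= Dr|r /= [m Dm []]].
  exists (Num.truncn r) => //=; split; first exact: truncnS_gt.
  case E : (Num.truncn r) => [|m]//=.
  by apply/negP; rewrite -truncn_le_nat E ltnn.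
rewrite /= -truncn_le_nat => h1 h2.
suff -> : Num.truncn r = m by [].
case: m Dm h1 h2 => [|m] _ h1 h2; first by move: h1; rewrite leqn0 => /eqP.
apply/eqP; rewrite eqn_leq h1/= ltnNge; apply/negP => h3; apply: h2.
by rewrite /= -truncn_le_nat.
Qed.

Lemma measurable_cell k c : measurable [set x | cell k x = c].
Proof.
rewrite (_ : [set _ | _] = \bigcap_(i in [set: 'I_n])
  ((fun x : 'rV[R]_n => (x ord0 i + k.+1%:R) * k.+1%:R) @^-1`
    [set r | inord (Num.truncn r) = c i])).
  apply: fin_bigcap_measurable => // i _.
  rewrite -[X in measurable X]setTI.
  have mf : measurable_fun setT (fun x : 'rV[R]_n => (x ord0 i + k.+1%:R) * k.+1%:R).
    apply: measurable_funM => //; apply: measurable_funD => //.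
    exact: measurable_rV_coord.
  apply: mf => //.
  exact: (measurable_truncn_preimage [set m | inord m = c i]).
apply/seteqP; split => [x /= <- i _ /=|x /= h]; first by rewrite ffunE.
by apply/ffunP => i; rewrite ffunE; exact: h.
Qed.

Lemma mesh_near (x : 'rV[R]_n) k : enorm x < k.+1%:R ->
  enorm (x - mesh k x) <= n%:R / k.+1%:R.
Proof.
move=> xk; rewrite (le_trans (enorm_le_sum _))//.
have K0 : 0 < k.+1%:R :> R by rewrite ltr0n.
rewrite (_ : n%:R / _ = \sum_(i < n) k.+1%:R^-1); last first.
  by rewrite sumr_const card_ord mulr_natl.
apply: ler_sum => i _; rewrite !mxE ffunE.
have : `|x ord0 i| < k.+1%:R by rewrite (le_lt_trans (enorm_coord _ _)).
rewrite ltr_norml => /andP[h1 h2].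
set r := (x ord0 i + k.+1%:R) * k.+1%:R.
have r0 : 0 <= r by rewrite mulr_ge0// -lerBlDr sub0r ltW.
have rK : r < (2 * k.+1 ^ 2)%:R.
  rewrite natrM natrX expr2 mulrA ltr_pM2r// mulr_natl mulr2n ltrD2r//.
rewrite inordK; last by rewrite ltnS -ltnS ltnW// ltnS truncn_lt_nat.
have /andP[t1 t2] := truncn_itv r0.
have -> : x ord0 i = r / k.+1%:R - k.+1%:R by rewrite /r mulfK ?gt_eqF// addrK.
rewrite opprB addrA subrK -mulrBl normrM (ger0_norm (_ : 0 <= k.+1%:R^-1)) ?invr_ge0 ?ler0n//.
rewrite ler_piMl ?invr_ge0 ?ler0n//.
rewrite ger0_norm ?subr_ge0//.
by rewrite lerBlDr addrC natr1 ltW.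
Qed.

Lemma cvg_mesh_enorm (x : 'rV[R]_n) : enorm (x - mesh k x) @[k --> \oo] --> (0 : R).
Proof.
apply: (@squeeze_cvgr _ _ _ _ (cst 0) (fun k => n%:R * k.+1%:R^-1 : R)).
- near=> k; rewrite enorm_ge0/=; apply: mesh_near.
  near: k; exists (Num.truncn (enorm x)) => // k /= hk.
  by rewrite (lt_le_trans (truncnS_gt _))// ler_nat ltnS.
- exact: cvg_cst.
- rewrite -(mulr0 n%:R); apply: cvgM; first exact: cvg_cst.
  exact: cvg_harmonic.
Unshelve. all: by end_near. Qed.

Lemma cvg_mesh (x : 'rV[R]_n) : mesh k x @[k --> \oo] --> x.
Proof.
apply/cvgrPdist_lt => e e0.
have /cvgrPdist_lt/(_ _ e0) := cvg_mesh_enorm x.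
apply: filterS => k; rewrite sub0r normrN (ger0_norm (enorm_ge0 _)) => h.
have -> : `|x - mesh k x| = mx_norm (x - mesh k x) by [].
have [->|/mx_norm_neq0[i]] := eqVneq (mx_norm (x - mesh k x)) 0; first by [].
move=> ->; rewrite (le_lt_trans _ h)//.
by rewrite (ord1 i.1) enorm_coord.
Qed.

Lemma measurable_cell_comp d (T : measurableType d) k (g : {ffun 'I_n -> 'I_(2 * k.+1 ^ 2).+1} -> T) :
  measurable_fun setT (fun x : 'rV[R]_n => g (cell k x)).
Proof.
move=> _ B mB; rewrite setTI.
rewrite (_ : _ @^-1` _ = \bigcup_(c in [set c | B (g c)]) [set x | cell k x = c]).
  apply: fin_bigcup_measurable => [|c _]; first exact: finite_finset.
  exact: measurable_cell.
apply/seteqP; split => [x /= Bx|x [c /= Bc xc]]; first by exists (cell k x).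
by rewrite /= xc.
Qed.

Lemma measurable_mesh_comp d (T : measurableType d) k (g : 'rV[R]_n -> T) :
  measurable_fun setT (g \o mesh k).
Proof. exact: (measurable_cell_comp (g \o @node k)). Qed.

(** [g \o mesh k] takes finitely many values on measurable cells. This gives measurability from
    pointwise limits, without comparing the coordinate sigma-algebra with the topology of R^n. *)
Lemma measurable_mesh_lim (g : 'rV[R]_n -> R) :
  (forall x, g (mesh k x) @[k --> \oo] --> g x) -> measurable_fun setT g.
Proof.
move=> h; apply: (measurable_fun_cvg (h := fun k => g \o mesh k)) => [k|x _].
  exact: measurable_mesh_comp.
exact: h.
Qed.

Lemma continuous_measurable_rV (g : 'rV[R]_n -> R) :
  continuous g -> measurable_fun setT g.
Proof.
move=> cg; apply: measurable_mesh_lim => x.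
apply: (@continuous_cvg _ _ _ _ _ (mesh ^~ x) g x); [exact: cg|exact: cvg_mesh].
Qed.

End mesh.

(** * Power integrals and the heat kernel *)

Section power_integrals.
Context {R : realType}.
Local Notation leb := (@lebesgue_measure R).

Lemma powR_continuous_pos (a : R) (x : R) : 0 < x -> {for x, continuous (@powR R ^~ a)}.
Proof.
move=> x0; apply: differentiable_continuous; apply/derivable1_diffP.
by apply: derivable_powR; rewrite in_itv/= x0.
Qed.

Lemma integral_powR_itv (a c b : R) : 0 < a -> a < c -> b != 0 ->
  (\int[leb]_(t in `[a, c]) (t `^ (b - 1))%:E = ((c `^ b - a `^ b) / b)%:E)%E.
Proof.
move=> a0 ac b0.
have pos x : a <= x -> 0 < x by exact: lt_le_trans.
rewrite (@continuous_FTC2 _ _ (fun t => b^-1 * t `^ b))//.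
- by rewrite -EFinB -mulrBr mulrC.
- apply: continuous_in_subspaceT => x; rewrite inE/= in_itv/= => /andP[ax _].
  by apply: powR_continuous_pos; exact: pos.
- have cF x : a <= x -> {for x, continuous (fun t => b^-1 * t `^ b)}.
    move=> ax; apply: cvgM; first exact: cvg_cst.
    by apply: powR_continuous_pos; exact: pos.
  split.
  + move=> x; rewrite in_itv/= => /andP[ax _].
    apply: derivableM; first exact: derivable_cst.
    by apply: derivable_powR; rewrite in_itv/= (pos _ (ltW ax)).
  + by apply: cvg_at_right_filter; exact: cF.
  + by apply: cvg_at_left_filter; apply: cF; exact: ltW.
- move=> x; rewrite in_itv/= => /andP[ax _].
  have x0 := pos _ (ltW ax).
  rewrite derive1E deriveM//; last first.
    by apply: derivable_powR; rewrite in_itv/= x0.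
  rewrite derive_cst scaler0 addr0 -derive1E powR_derive1 ?in_itv/= ?x0//.
  by rewrite scalerA mulVf// scale1r.
Qed.

Lemma integral_powR_ge (c b : R) : 0 < c -> 0 < b ->
  ((c `^ b / b)%:E <= \int[leb]_(t in `]0%R, c[) (t `^ (b - 1))%:E)%E.
Proof.
move=> c0 b0.
have mP D : measurable_fun D (fun t : R => (t `^ (b - 1))%:E).
  by apply/measurable_EFinP; apply: measurable_funTS; exact: measurable_powR.
apply/lee_addgt0Pr => e e0.
(* Chosen so that r^b / b <= e, which is the part of the integral lost on ]0, r]. *)
pose r := Num.min (c / 2) ((e * b) `^ b^-1).
have eb0 : 0 < e * b by rewrite mulr_gt0.
have r0 : 0 < r by rewrite lt_min divr_gt0//= powR_gt0.
have rc : r < c by rewrite gt_min; apply/orP; left; lra.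
apply: (@le_trans _ _ (\int[leb]_(t in `[r, c]) (t `^ (b - 1))%:E + e%:E)%E).
  rewrite integral_powR_itv ?gt_eqF// -EFinD lee_fin mulrBl -addrA lerDl.
  rewrite addrC subr_ge0 ler_pdivrMr//.
  apply: (@le_trans _ _ (((e * b) `^ b^-1) `^ b)).
    by apply: ge0_ler_powR; rewrite ?nnegrE ?(ltW b0) ?(ltW r0) ?powR_ge0// ge_min lexx orbT.
  by rewrite -powRrM mulVf ?gt_eqF// powRr1// ltW.
rewrite leeD2r// -(integral_itv_bndo_bndc (a := BLeft r) (r := c))//.
apply: ge0_subset_integral => //.
- exact: mP.
- by move=> x _; rewrite lee_fin powR_ge0.
- by move=> x /=; rewrite !in_itv/= => /andP[h ->]; rewrite (lt_le_trans r0 h).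
Qed.

Lemma integral_powR_itv0_lty (b : R) : 0 < b ->
  (\int[leb]_(t in `[0%R, 1%R]) (t `^ (b - 1))%:E < +oo)%E.
Proof.
move=> b0.
have mP D : measurable_fun D (fun t : R => (t `^ (b - 1))%:E).
  by apply/measurable_EFinP; apply: measurable_funTS; exact: measurable_powR.
rewrite -integral_itv_obnd_cbnd//.
pose F (k : nat) := `[(k.+2%:R^-1 : R), 1]%classic.
have -> : `]0%R, 1%R]%classic = \bigcup_k F k.
  apply/seteqP; split => [x /=|x [k _]].
    rewrite in_itv/= => /andP[x0 x1]; exists (Num.truncn x^-1) => //=.
    rewrite /F/= in_itv/= x1 andbT -[leRHS]invrK lef_pV2 ?posrE ?invr_gt0//.
    by rewrite ltW// (lt_trans (truncnS_gt _))// ltr_nat.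
  rewrite /F/= !in_itv/= => /andP[x0 ->]; rewrite andbT.
  by rewrite (lt_le_trans _ x0)// invr_gt0.
have ndF : nondecreasing_seq F.
  move=> i j ij; apply/subsetPset => x; rewrite /F/= !in_itv/= => /andP[h ->]; rewrite andbT.
  by rewrite (le_trans _ h)// lef_pV2 ?posrE// ler_nat.
have cv : ((\int[leb]_(t in F k) (t `^ (b - 1))%:E)%E @[k --> \oo] -->
    (\int[leb]_(t in \bigcup_k F k) (t `^ (b - 1))%:E)%E)%classic.
  apply: ge0_nondecreasing_set_cvg_integral => //.
  - by move=> i; exact: measurable_itv.
  - by move=> i; exact: mP.
  - by move=> i x _; rewrite lee_fin powR_ge0.
rewrite -(cvg_lim _ cv)//.
apply: (@le_lt_trans _ _ (b^-1)%:E); last exact: ltry.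
apply: lime_le; first exact: (cvgP _ cv).
apply: nearW => k; rewrite integral_powR_itv ?gt_eqF ?invf_lt1 ?ltr1n//.
by rewrite lee_fin ler_pdivrMr// mulVf ?gt_eqF// powR1 gerBl powR_ge0.
Qed.

Lemma integral_powR_itvy_lty (b : R) : 0 < b ->
  (\int[leb]_(t in `[1%R, +oo[) (t `^ (-1 - b))%:E < +oo)%E.
Proof.
move=> b0.
have mP D : measurable_fun D (fun t : R => (t `^ (-1 - b))%:E).
  by apply/measurable_EFinP; apply: measurable_funTS; exact: measurable_powR.
pose F (k : nat) := `[1 : R, k.+2%:R]%classic.
have -> : `[1%R, +oo[%classic = \bigcup_k F k.
  apply/seteqP; split => [x /=|x [k _]].
    rewrite in_itv/= andbT => x1; exists (Num.truncn x) => //=.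
    by rewrite /F/= in_itv/= x1/= ltW// (lt_trans (truncnS_gt _))// ltr_nat.
  by rewrite /F/= !in_itv/= => /andP[-> _].
have ndF : nondecreasing_seq F.
  move=> i j ij; apply/subsetPset => x; rewrite /F/= !in_itv/= => /andP[-> h]/=.
  by rewrite (le_trans h)// ler_nat.
have cv : ((\int[leb]_(t in F k) (t `^ (-1 - b))%:E)%E @[k --> \oo] -->
    (\int[leb]_(t in \bigcup_k F k) (t `^ (-1 - b))%:E)%E)%classic.
  apply: ge0_nondecreasing_set_cvg_integral => //.
  - by move=> i; exact: measurable_itv.
  - by move=> i; exact: mP.
  - by move=> i x _; rewrite lee_fin powR_ge0.
rewrite -(cvg_lim _ cv)//.
apply: (@le_lt_trans _ _ (b^-1)%:E); last exact: ltry.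
apply: lime_le; first exact: (cvgP _ cv).
apply: nearW => k; rewrite (_ : -1 - b = - b - 1); last by rewrite addrC.
rewrite integral_powR_itv ?oppr_eq0 ?gt_eqF ?ltr1n//.
rewrite lee_fin invrN mulrN -mulNr opprB ler_pdivrMr// mulVf ?gt_eqF// powR1.
by rewrite gerBl powR_ge0.
Qed.

(** A one-variable majorant with separate exponents at 0 and at infinity, integrable as soon as [g]
    and [b] are positive. Products over the coordinates dominate radial functions on R^n, which
    avoids polar coordinates. *)
Definition broken_power (g b r : R) : R :=
  if `|r| <= 1 then `|r| `^ (g - 1) else `|r| `^ (-1 - b).

Lemma broken_power_ge0 g b r : 0 <= broken_power g b r.
Proof. by rewrite /broken_power; case: ifP => _; exact: powR_ge0. Qed.

Lemma measurable_broken_power g b : measurable_fun setT (broken_power g b).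
Proof.
apply: measurable_fun_ifT.
- by apply: measurable_fun_ler => //; exact: measurableT_comp.
- by apply: (measurableT_comp (measurable_powR _)); exact: normr_measurable.
- by apply: (measurableT_comp (measurable_powR _)); exact: normr_measurable.
Qed.

Lemma integral_broken_power_lty g b : 0 < g -> 0 < b ->
  (\int[leb]_r (broken_power g b r)%:E < +oo)%E.
Proof.
move=> g0 b0.
pose h1 := (fun r : R => (r `^ (g - 1))%:E) \_ `[0, 1].
pose h2 := (fun r : R => (r `^ (-1 - b))%:E) \_ `[1, +oo[.
have mP a D : measurable_fun D (fun t : R => (t `^ a)%:E).
  by apply/measurable_EFinP; apply: measurable_funTS; exact: measurable_powR.
have m1 : measurable_fun setT h1.
  by apply/(measurable_restrictT _ _).1 => //; exact: mP.
have m2 : measurable_fun setT h2.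
  by apply/(measurable_restrictT _ _).1 => //; exact: mP.
have h10 r : (0 <= h1 r)%E by apply: erestrict_ge0 => x _; exact: powR_ge0.
have h20 r : (0 <= h2 r)%E by apply: erestrict_ge0 => x _; exact: powR_ge0.
pose h r := (h1 r + h2 r)%E.
have mh : measurable_fun setT h by exact: emeasurable_funD.
have h0 r : (0 <= h r)%E by rewrite adde_ge0.
have hlt : (\int[leb]_r h r < +oo)%E.
  rewrite ge0_integralD// lte_add_pinfty//.
    by rewrite -integral_mkcond integral_powR_itv0_lty.
  by rewrite -integral_mkcond integral_powR_itvy_lty.
(* [h] only dominates on the half-line r >= 0; its reflection takes care of the other one. *)
apply: (@le_lt_trans _ _ (\int[leb]_r (h r + h (- r)%R))%E); last first.
  rewrite ge0_integralD//; last by apply: (measurableT_comp mh).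
  by rewrite ge0_integral_lebesgueN// lte_add_pinfty.
apply: ge0_le_integral => //.
- by move=> x _; rewrite lee_fin broken_power_ge0.
- by apply/measurable_EFinP; exact: measurable_broken_power.
- by apply: emeasurable_funD => //; apply: (measurableT_comp mh).
move=> r _.
suff key s : 0 <= s -> ((broken_power g b s)%:E <= h s)%E.
  have [r0|r0] := leP 0 r; first by rewrite (le_trans (key _ r0))// leeDl.
  have -> : broken_power g b r = broken_power g b (- r) by rewrite /broken_power normrN.
  by rewrite (le_trans (key _ _))// ?leeDr// oppr_ge0 ltW.
move=> s0; rewrite /broken_power (ger0_norm s0) /h /h1 /h2 /patch.
case: ifPn => s1; last rewrite -ltNge in s1.
  by rewrite mem_set/= ?in_itv/= ?s0// leeDl//; case: ifPn => // _; exact: powR_ge0.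
rewrite [X in (_ <= _ + X)%E]ifT; last by rewrite mem_set//= in_itv/= andbT ltW.
by rewrite leeDr//; case: ifPn => // _; exact: powR_ge0.
Qed.

End power_integrals.

(** * The heat kernel: mass, convolution and tails *)

Section heat.
Context {R : realType}.
Local Notation leb := (@lebesgue_measure R).
Local Open Scope ereal_scope.

Definition heat1 (t r : R) : R := (4 * pi * t) `^ (- 2^-1) * expR (- (r ^+ 2 / (4 * t))).

Lemma heat1_ge0 t r : (0 <= heat1 t r)%R.
Proof. by rewrite mulr_ge0 ?powR_ge0// expR_ge0. Qed.

Lemma heat1_normal t m r : (0 < t)%R ->
  heat1 t (r - m) = normal_pdf m (Num.sqrt (2 * t)) r.
Proof.
move=> t0; have t20 : (0 < 2 * t)%R by rewrite mulr_gt0.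
rewrite normal_pdfE ?gt_eqF ?sqrtr_gt0// /normal_peak /normal_fun.
rewrite sqr_sqrtr ?(ltW t20)// /heat1 powRN powR12_sqrt; last first.
  by rewrite !mulr_ge0 ?pi_ge0// ltW.
congr ((Num.sqrt _)^-1 * expR _)%R; first by rewrite -mulr_natr; ring.
by rewrite -mulr_natr mulNr; congr (- (_ / _))%R; ring.
Qed.

Lemma measurable_heat1 t m : measurable_fun setT (fun r : R => heat1 t (r - m)).
Proof.
apply: measurable_funM => //; apply: measurableT_comp => //.
apply: measurableT_comp => //; apply: measurable_funM => //.
by apply: measurable_funX; exact: measurable_funB.
Qed.

Lemma integral_heat1 t m : (0 < t)%R -> \int[leb]_r (heat1 t (r - m))%:E = 1.
Proof.
move=> t0; rewrite -(integral_normal_pdf m (Num.sqrt (2 * t))).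
by apply: eq_integral => r _; rewrite heat1_normal.
Qed.

(** Completing the square in [z]: the second factor on the right is a Gaussian in [z] of mean t y /
    (s + t), whose integral is 1. The semigroup law of the kernel follows coordinate by
    coordinate. *)
Lemma heat1_conv s t y z : (0 < s)%R -> (0 < t)%R ->
  (heat1 s (y - z) * heat1 t z = heat1 (s + t) y *
   heat1 (s * t / (s + t)) (z - t * y / (s + t)))%R.
Proof.
move=> s0 t0; have st0 : (0 < s + t)%R by exact: addr_gt0.
have pi0 := @pi_gt0 R.
rewrite /heat1 mulrACA [RHS]mulrACA -!powRM; last 4 first.
- by rewrite !mulr_ge0// ltW.
- by rewrite !mulr_ge0// ?invr_ge0 ltW.
- by rewrite !mulr_ge0// ltW.
- by rewrite !mulr_ge0// ltW.
rewrite -!expRD; congr (_ `^ _ * expR _)%R.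
- by field; rewrite gt_eqF.
- by field; rewrite !gt_eqF.
Qed.

Context {n : nat}.
Local Notation mu := (@lebesgue_rV R n).
Implicit Types x y z : 'rV[R]_n.

Lemma heat_kernel_ge0 t x : (0 <= heat_kernel t x)%R.
Proof. by rewrite mulr_ge0 ?powR_ge0// expR_ge0. Qed.

Lemma heat_kernel_prod t x : (0 < t)%R ->
  heat_kernel t x = (\prod_(i < n) heat1 t (x ord0 i))%R.
Proof.
move=> t0; rewrite big_split/= prodr_const card_ord -expR_sum /heat_kernel.
rewrite -(powR_mulrn n (powR_ge0 (4 * pi * t) (- 2^-1))) -powRrM; congr (_ `^ _ * expR _)%R.
  by rewrite mulNr mulNr mulrC.
by rewrite enorm2 mulr_suml sumrN.
Qed.

Lemma heat_kernelN t x : heat_kernel t (- x)%R = heat_kernel t x.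
Proof. by rewrite /heat_kernel enormN. Qed.

Lemma measurable_heat_kernel t : measurable_fun setT (@heat_kernel R n t).
Proof.
apply: measurable_funM => //; apply: measurableT_comp => //.
apply: measurableT_comp => //; apply: measurable_funM => //.
by apply: measurable_funX; exact: measurable_enorm.
Qed.

Lemma heat_kernel_conv s t y : (0 < s)%R -> (0 < t)%R ->
  \int[mu]_z (heat_kernel s (y - z) * heat_kernel t z)%:E = (heat_kernel (s + t) y)%:E.
Proof.
move=> s0 t0; have st0 : (0 < s + t)%R by exact: addr_gt0.
have u0 : (0 < s * t / (s + t))%R by rewrite divr_gt0// mulr_gt0.
transitivity (\int[mu]_z (\prod_(i < n) (heat1 (s + t) (y ord0 i) *
   heat1 (s * t / (s + t)) (z ord0 i - t * y ord0 i / (s + t))))%:E).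
  apply: eq_integral => z _; congr EFin; rewrite !heat_kernel_prod// -big_split/=.
  by apply: eq_bigr => i _; rewrite !mxE heat1_conv.
rewrite (ge0_integral_prod_rV (f := fun i r => heat1 (s + t) (y ord0 i) *
   heat1 (s * t / (s + t)) (r - t * y ord0 i / (s + t)))%R); last 2 first.
- by move=> i; apply: measurable_funM => //; exact: measurable_heat1.
- by move=> i r; rewrite mulr_ge0 ?heat1_ge0.
rewrite heat_kernel_prod// -prodEFin; apply: eq_bigr => i _.
under eq_integral do rewrite EFinM.
rewrite ge0_integralZl_EFin ?heat1_ge0//.
- by rewrite integral_heat1// mule1.
- by move=> x _; rewrite lee_fin heat1_ge0.
- by apply/measurable_EFinP; exact: measurable_heat1.
Qed.

Lemma integral_heat_kernel t : (0 < t)%R -> \int[mu]_x (heat_kernel t x)%:E = 1.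
Proof.
move=> t0; under eq_integral do rewrite heat_kernel_prod//.
rewrite (ge0_integral_prod_rV (f := fun i r => heat1 t r)).
- by rewrite big1// => i _; rewrite -(integral_heat1 0 t0); apply: eq_integral => x _; rewrite subr0.
- move=> i; have := measurable_heat1 t 0; congr measurable_fun.
  by apply/funext => x; rewrite subr0.
- by move=> i r; rewrite heat1_ge0.
Qed.

(** The exponential is the square of F = exp(-|x|^2 / (8 t)). One factor F belongs to the kernel at
    time 2 t; the other is at most 8 t / |x|^2, since e^s >= s. The power of 2 corrects the
    normalization. *)
Lemma heat_kernel_tail t (delta : R) x : (0 < t)%R -> (0 < delta)%R -> (delta <= enorm x)%R ->
  (heat_kernel t x <= 2 `^ (n%:R / 2) * (8 * t / delta ^+ 2) * heat_kernel (2 * t) x)%R.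
Proof.
move=> t0 d0 dx.
have d20 : (0 < delta ^+ 2)%R by rewrite exprn_gt0.
rewrite /heat_kernel.
have -> : (4 * pi * (2 * t) = 2 * (4 * pi * t) :> R)%R by ring.
rewrite (@powRM _ 2)//; last by rewrite !mulr_ge0 ?pi_ge0// ltW.
rewrite mulNr !powRN.
set A := (2 `^ _)%R; set B := ((4 * pi * t) `^ _)%R.
have A0 : (0 < A)%R by rewrite powR_gt0.
have B0 : (0 <= B)%R by rewrite powR_ge0.
set E := expR _; set c := (8 * t / delta ^+ 2)%R; set F := expR _.
have c0 : (0 < c)%R by rewrite divr_gt0// mulr_gt0.
have -> : (A * c * (A^-1 / B * F) = B^-1 * (c * F))%R.
  by field; rewrite !gt_eqF// ?powR_gt0 ?mulr_gt0 ?pi_gt0.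
rewrite ler_wpM2l// ?invr_ge0//.
have -> : E = (F * F)%R.
  rewrite /E /F -expRD; congr expR; field; rewrite gt_eqF//.
rewrite ler_wpM2r ?expR_ge0//.
rewrite /F expRN invf_ple ?posrE ?expR_gt0//.
apply: (@le_trans _ _ (1 + enorm x ^+ 2 / (4 * (2 * t)))%R); last exact: expR_ge1Dx.
apply: (@le_trans _ _ (enorm x ^+ 2 / (4 * (2 * t)))%R); last by rewrite lerDr.
rewrite /c invf_div (_ : 4 * (2 * t) = 8 * t)%R; last by ring.
rewrite ler_wpM2r ?invr_ge0 ?mulr_ge0 ?(ltW t0)//.
by rewrite ler_pXn2r// nnegrE ltW// (lt_le_trans d0).
Qed.

(** Within distance delta, the bound eps / 2 is averaged by a probability density. Outside,
    [heat_kernel_tail] trades the kernel at time t for O(t) times the kernel at time 2 t, whose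
    integral is 1. The values of [e] are extended reals because [e] will also be a Sobolev
    energy. *)
Lemma heat_approx_identity (e : 'rV[R]_n -> \bar R) (B : R) :
  measurable_fun setT e -> (forall z, 0 <= e z <= B%:E) ->
  (forall eps : R, (0 < eps)%R -> exists2 delta : R, (0 < delta)%R &
     forall z, (enorm z < delta)%R -> e z <= eps%:E) ->
  forall eps : R, (0 < eps)%R -> exists2 t0 : R, (0 < t0)%R &
    forall t, (0 < t < t0)%R -> \int[mu]_z (e z * (heat_kernel t z)%:E) <= eps%:E.
Proof.
move=> me e0B e_small eps eps0.
have B0 : (0 <= B)%R by have /andP[a b] := e0B 0%R; rewrite -lee_fin (le_trans a b).
have eps20 : (0 < eps / 2)%R by rewrite divr_gt0.
have [delta d0 hd] := e_small _ eps20.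
pose c t := (2 `^ (n%:R / 2) * (8 * t / delta ^+ 2))%R.
pose C := (B * (2 `^ (n%:R / 2) * (8 / delta ^+ 2)))%R.
have d20 : (0 < delta ^+ 2)%R by rewrite exprn_gt0.
have C0 : (0 <= C)%R by rewrite !mulr_ge0 ?powR_ge0 ?invr_ge0// ltW.
exists (eps / 2 / (1 + C))%R.
  by rewrite divr_gt0// ltr_pwDl.
move=> t /andP[t0 tlt].
have c0 : (0 <= c t)%R by rewrite !mulr_ge0 ?powR_ge0 ?invr_ge0 ?(ltW t0)// ltW.
have t20 : (0 < 2 * t)%R by rewrite mulr_gt0.
have mh s : measurable_fun setT (fun x : 'rV[R]_n => (heat_kernel s x)%:E).
  by apply/measurable_EFinP; exact: measurable_heat_kernel.
have h0 s (x : 'rV[R]_n) : 0 <= (heat_kernel s x)%:E by rewrite lee_fin heat_kernel_ge0.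
apply: (@le_trans _ _ (\int[mu]_z ((eps / 2)%:E * (heat_kernel t z)%:E +
   (B * c t)%:E * (heat_kernel (2 * t) z)%:E))).
  apply: ge0_le_integral => //.
  - by move=> x _; rewrite mule_ge0//; have /andP[] := e0B x.
  - exact: emeasurable_funM.
  - by apply: emeasurable_funD; apply: emeasurable_funM.
  move=> x _; have [xd|xd] := ltP (enorm x) delta.
    rewrite (le_trans (lee_wpmul2r (h0 t x) (hd _ xd)))// leeDl//.
    by rewrite mule_ge0// lee_fin mulr_ge0.
  have /andP[_ eB] := e0B x.
  rewrite (le_trans (lee_wpmul2r (h0 t x) eB))//.
  apply: (@le_trans _ _ ((B * c t)%:E * (heat_kernel (2 * t) x)%:E)); last first.
    by rewrite leeDr// mule_ge0// lee_fin ltW.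
  rewrite -!EFinM lee_fin -mulrA ler_wpM2l//.
  exact: heat_kernel_tail.
rewrite ge0_integralD//; last 4 first.
- by move=> x _; rewrite mule_ge0// lee_fin ltW.
- exact: emeasurable_funM.
- by move=> x _; rewrite mule_ge0// lee_fin mulr_ge0.
- exact: emeasurable_funM.
rewrite !ge0_integralZl_EFin ?(ltW eps20) ?(mulr_ge0 B0 c0)//.
rewrite !integral_heat_kernel// !mule1 -EFinD lee_fin.
have -> : (B * c t = C * t)%R by rewrite /c /C; ring.
move: tlt; rewrite ltr_pdivlMr; last by rewrite ltr_pwDl.
by move=> tlt; nra.
Qed.

End heat.

(** * Convexity inequalities *)

Section power_inequalities.
Context {R : realType}.
Implicit Types a b c p q x : R.

(* Tangent line of [s |-> e^(q s)]: divide by [e^s] and use [e^s >= 1 + s] twice. *)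
Lemma bernoulli_powR q x : 1 < q -> 0 <= x -> 1 + q * (x - 1) <= x `^ q.
Proof.
move=> q1; rewrite le_eqVlt => /orP[/eqP<-|x0].
  by rewrite powR0 ?gt_eqF// ?(lt_trans _ q1)//; lra.
have q0 : 0 < q by exact: lt_trans q1.
rewrite /powR gt_eqF//; set s := ln x.
have -> : x = expR s by rewrite lnK.
have h1 := expR_ge1Dx ((q - 1) * s).
have h2 := expR_ge1Dx (- s).
have e0 := expR_gt0 s.
have -> : expR (q * s) = expR s * expR ((q - 1) * s) by rewrite -expRD; congr expR; ring.
have E : expR s * expR (- s) = 1 by rewrite -expRD subrr expR0.
move: h1 h2 e0 E; set y := expR s; set A := expR _; set B := expR _ => h1 h2 e0 E.
have : 0 <= y * (A - (1 + (q - 1) * s)) by rewrite mulr_ge0 ?subr_ge0// ltW.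
have : 0 <= (q - 1) * (y * (B - (1 - s))) by rewrite !mulr_ge0 ?subr_ge0// ltW.
by nra.
Qed.

(** Same argument as for the weak inequality; strictness comes from e^(-s) > 1 - s for s nonzero. *)
Lemma bernoulli_powR_lt q x : 1 < q -> 0 <= x -> x != 1 -> 1 + q * (x - 1) < x `^ q.
Proof.
move=> q1; rewrite le_eqVlt => /orP[/eqP<-|x0] x1.
  by rewrite powR0 ?gt_eqF// ?(lt_trans _ q1)//; lra.
have q0 : 0 < q by exact: lt_trans q1.
rewrite /powR gt_eqF//; set s := ln x.
have s0 : s != 0 by rewrite ln_eq0.
have -> : x = expR s by rewrite lnK.
have h1 := expR_ge1Dx ((q - 1) * s).
have h2 : 1 + (- s) < expR (- s) by apply: expR_gt1Dx; rewrite oppr_eq0.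
have e0 := expR_gt0 s.
have -> : expR (q * s) = expR s * expR ((q - 1) * s) by rewrite -expRD; congr expR; ring.
have E : expR s * expR (- s) = 1 by rewrite -expRD subrr expR0.
move: h1 h2 e0 E; set y := expR s; set A := expR _; set B := expR _ => h1 h2 e0 E.
have : 0 <= y * (A - (1 + (q - 1) * s)) by rewrite mulr_ge0 ?subr_ge0// ltW.
have : 0 < (q - 1) * (y * (B - (1 - s))) by rewrite !mulr_gt0 ?subr_gt0.
by nra.
Qed.

(** Bernoulli at a / c multiplied by c^q: the graph of s^q lies above its tangent at [c]. The free
    parameter [c] is optimized in [jensen_powR]. *)
Lemma powR_tangent q a c : 1 < q -> 0 <= a -> 0 < c ->
  q * c `^ (q - 1) * a <= a `^ q + (q - 1) * c `^ q.
Proof.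
move=> q1 a0 c0; have q0 : 0 < q by exact: lt_trans q1.
have ac0 : 0 <= a / c by rewrite divr_ge0// ltW.
have := bernoulli_powR q1 ac0.
have E : a `^ q = (a / c) `^ q * c `^ q by rewrite -powRM// ?(ltW c0)// divfK ?gt_eqF.
have -> : c `^ (q - 1) = c `^ q / c by rewrite powRB ?powRr1// ?(ltW c0)// gt_eqF// implybT.
have cq : 0 < c `^ q by rewrite powR_gt0.
rewrite -(ler_pM2r cq) -E => h.
rewrite (_ : q * _ * a = q * (a / c) * c `^ q); last by field; rewrite gt_eqF.
by nra.
Qed.

Lemma powR_add_le q a b : 0 <= q -> `|a + b| `^ q <= 2 `^ q * (`|a| `^ q + `|b| `^ q).
Proof.
move=> q0.
have key x y : `|x| <= `|y| -> `|x + y| `^ q <= 2 `^ q * `|y| `^ q.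
  move=> xy; rewrite -powRM// ge0_ler_powR// ?nnegrE// ?mulr_ge0//.
  by rewrite (le_trans (ler_normD _ _))// mulr_natl mulr2n lerD2r.
have [ab|/ltW ba] := leP `|a| `|b|.
  by rewrite (le_trans (key _ _ ab))// ler_wpM2l ?powR_ge0// lerDr powR_ge0.
by rewrite addrC (le_trans (key _ _ ba))// ler_wpM2l ?powR_ge0// lerDl powR_ge0.
Qed.

(** With u = (1 + b) / 2, apply Bernoulli strictly at 1 / u and weakly at |b| / u. The linear terms
    add up to p ((1 + |b|) / u - 2), which is nonnegative because 1 + |b| >= 2 u. *)
Lemma powR_strict_convex_mid p b : 1 < p -> -1 <= b < 1 ->
  ((1 + b) / 2) `^ p < (1 + `|b| `^ p) / 2.
Proof.
move=> p1 /andP[b1 b2].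
have p0 : 0 < p by exact: lt_trans p1.
set u := (1 + b) / 2.
have : 0 <= u by rewrite divr_ge0//; lra.
rewrite le_eqVlt => /orP[/eqP<-|u0].
  by rewrite powR0 ?gt_eqF// divr_gt0// ltr_pwDl// powR_ge0.
have h1 : 1 + p * (u^-1 - 1) < u^-1 `^ p.
  apply: bernoulli_powR_lt => //; first by rewrite invr_ge0 ltW.
  by rewrite invr_eq1 lt_eqF// /u; lra.
have h2 : 1 + p * (`|b| / u - 1) <= (`|b| / u) `^ p.
  by apply: bernoulli_powR => //; rewrite divr_ge0// ltW.
have up : 0 < u `^ p by rewrite powR_gt0.
have E1 : u^-1 `^ p * u `^ p = 1.
  by rewrite -powRM ?invr_ge0 ?ltW// mulVf ?gt_eqF// powR1.
have E2 : (`|b| / u) `^ p * u `^ p = `|b| `^ p.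
  by rewrite -(powRM _ (divr_ge0 (normr_ge0 b) (ltW u0)) (ltW u0)) divfK ?gt_eqF.
have h3 : 0 <= p * ((1 + `|b|) / u - 2).
  apply: mulr_ge0; first exact: ltW.
  rewrite subr_ge0 ler_pdivlMr// /u mulrC divfK ?pnatr_eq0//.
  by rewrite lerD2l ler_norm.
have h4 : p * ((1 + `|b|) / u - 2) = p * (u^-1 - 1) + p * (`|b| / u - 1) by ring.
have h5 : 2 < u^-1 `^ p + (`|b| / u) `^ p by lra.
have : 2 * u `^ p < (u^-1 `^ p + (`|b| / u) `^ p) * u `^ p by rewrite ltr_pM2r.
by rewrite [X in _ < X]mulrDl E1 E2; lra.
Qed.

(** Two regimes: for b > 1 - s the left side is at most s^p <= eps. On the compact interval
    [-1, 1 - s] the convexity defect is continuous and positive, so it has a positive minimum [k c],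
    and C = 2^p / k c works because |1 - b| <= 2. *)
Lemma uniform_convexity1 p (eps : R) : 1 < p -> 0 < eps -> exists2 C, 0 <= C &
  forall b, -1 <= b <= 1 ->
  `|1 - b| `^ p <= eps * (1 + `|b| `^ p) + C * ((1 + `|b| `^ p) / 2 - ((1 + b) / 2) `^ p).
Proof.
move=> p1 e0; have p0 : 0 < p by exact: lt_trans p1.
pose s := Num.min 1 (eps `^ p^-1).
have s0 : 0 < s by rewrite lt_min ltr01 powR_gt0.
have s1 : s <= 1 by rewrite ge_min lexx.
have sp : s `^ p <= eps.
  apply: (@le_trans _ _ ((eps `^ p^-1) `^ p)).
    by apply: ge0_ler_powR; rewrite ?nnegrE ?(ltW p0) ?(ltW s0) ?powR_ge0// ge_min lexx orbT.
  by rewrite -powRrM mulVf ?gt_eqF// powRr1// ltW.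
pose k b := (1 + `|b| `^ p) / 2 - ((1 + b) / 2) `^ p.
have cpow (f : R -> R) : continuous f -> continuous (fun x => `|f x| `^ p).
  move=> cf x.
  have [fx0|fx0] := eqVneq (f x) 0.
    rewrite /continuous_at fx0 normr0 powR0 ?gt_eqF//.
    apply/cvgrPdist_le => e ee0.
    have ep : 0 < e `^ p^-1 by rewrite powR_gt0.
    have /cvgrPdist_lt/(_ _ ep) := cf x.
    apply: filterS => y; rewrite fx0 !sub0r !normrN => fy.
    rewrite ger0_norm ?powR_ge0//.
    rewrite -[leRHS]powRr1 ?(ltW ee0)// -(@mulVf _ p) ?gt_eqF// powRrM.
    by apply: ge0_ler_powR; rewrite ?nnegrE ?(ltW p0) ?powR_ge0// ltW.
  suff H : {for x, continuous ((@powR R ^~ p) \o (fun x => `|f x|))} by exact: H.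
  apply: continuous_comp; first by apply: cvg_norm; exact: cf.
  apply: differentiable_continuous; apply/derivable1_diffP.
  by apply: derivable_powR; rewrite in_itv/= normr_gt0 fx0.
(* The absolute value around (1 + b) / 2 changes nothing for b >= -1, and makes the function an
   instance of [cpow], continuous on the whole line. *)
have ck : {within `[-1, 1 - s], continuous (fun b => (1 + `|b| `^ p) / 2 - `|(1 + b) / 2| `^ p)}.
  apply: continuous_subspaceT => x; apply: cvgB.
    apply: cvgM; last exact: cvg_cst.
    by apply: cvgD; [exact: cvg_cst|apply: (cpow id) => y; exact: cvg_id].
  apply: (cpow (fun y => (1 + y) / 2)) => y; apply: cvgM; last exact: cvg_cst.
  by apply: cvgD; [exact: cvg_cst|exact: cvg_id].
have [|c cin hc] := EVT_min _ ck; first lra.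
move: cin; rewrite in_itv/= => /andP[c1 c2].
have normu b : -1 <= b -> `|(1 + b) / 2| = (1 + b) / 2.
  by move=> b1; rewrite ger0_norm// divr_ge0//; lra.
have kc : 0 < k c by rewrite subr_gt0; apply: powR_strict_convex_mid => //; rewrite c1/=; lra.
exists (2 `^ p / k c); first by rewrite divr_ge0 ?powR_ge0// ltW.
move=> b /andP[b1 b2].
have bp : 0 <= `|b| `^ p by rewrite powR_ge0.
have [bs|bs] := leP b (1 - s).
  have := hc b; rewrite in_itv/= b1 bs => /(_ isT).
  rewrite !normu// -/(k b) -/(k c) => kcb.
  apply: (@le_trans _ _ (2 `^ p / k c * k b)); last first.
    by rewrite lerDr mulr_ge0 ?(ltW e0)// addr_ge0.
  apply: (@le_trans _ _ (2 `^ p)).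
    by apply: ge0_ler_powR; rewrite ?nnegrE ?(ltW p0)// ger0_norm; lra.
  rewrite -mulrA ler_peMr ?powR_ge0//.
  by rewrite mulrC ler_pdivlMr// mul1r.
apply: (@le_trans _ _ (eps * (1 + `|b| `^ p))).
  apply: (@le_trans _ _ eps); last by rewrite ler_peMr ?(ltW e0)// lerDl.
  apply: le_trans sp; apply: ge0_ler_powR; rewrite ?nnegrE ?(ltW p0) ?(ltW s0)//.
  by rewrite ger0_norm; lra.
rewrite lerDl mulr_ge0 ?divr_ge0 ?powR_ge0 ?(ltW kc)// subr_ge0.
move: b2; rewrite le_eqVlt => /orP[/eqP->|b2].
  by rewrite normr1 powR1 (_ : (1 + 1) / 2 = 1) ?powR1//; field.
by rewrite ltW// powR_strict_convex_mid// b1 b2.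
Qed.

(** By homogeneity, divide by the larger of |a| and |b|. The inequality is linear in p-th powers, so
    it can be integrated as it stands and replaces Clarkson's inequalities for every p > 1. *)
Lemma uniform_convexity p (eps : R) : 1 < p -> 0 < eps -> exists2 C, 0 <= C &
  forall a b, `|a - b| `^ p <= eps * (`|a| `^ p + `|b| `^ p) +
     C * ((`|a| `^ p + `|b| `^ p) / 2 - `|(a + b) / 2| `^ p).
Proof.
move=> p1 e0; have p0 : 0 < p by exact: lt_trans p1.
have [C C0 hC] := uniform_convexity1 p1 e0; exists C => //.
suff key a b : `|b| <= `|a| -> `|a - b| `^ p <= eps * (`|a| `^ p + `|b| `^ p) +
     C * ((`|a| `^ p + `|b| `^ p) / 2 - `|(a + b) / 2| `^ p).
  move=> a b; have [ab|/ltW ab] := leP `|b| `|a|; first exact: key.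
  by rewrite distrC (addrC a) (addrC (`|a| `^ p)); exact: key.
have [->|a0] := eqVneq a 0.
  rewrite normr0 normr_le0 => /eqP ->.
  by rewrite subr0 addr0 mul0r normr0 powR0 ?gt_eqF// addr0 !mulr0 mul0r subr0 mulr0 addr0.
move=> ba.
have na0 : 0 < `|a| by rewrite normr_gt0.
have t1 : `|b / a| <= 1 by rewrite normrM normfV ler_pdivrMr// mul1r.
have t2 : -1 <= b / a <= 1 by rewrite -ler_norml.
have ap : 0 < `|a| `^ p by rewrite powR_gt0.
have := hC _ t2; rewrite -(ler_pM2l ap).
rewrite -powRM// -normrM mulrBr mulr1 mulrCA mulfV// mulr1.
have E1 : `|a| `^ p * `|b / a| `^ p = `|b| `^ p.
  by rewrite -powRM// -normrM mulrCA mulfV// mulr1.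
have E2 : `|a| `^ p * ((1 + b / a) / 2) `^ p = `|(a + b) / 2| `^ p.
  have n0 : 0 <= (1 + b / a) / 2 by rewrite divr_ge0//; lra.
  rewrite -{1}(ger0_norm n0) -powRM// -normrM mulrA mulrDr mulr1 (mulrCA a).
  by rewrite mulfV// mulr1.
rewrite -E1 -E2 => h; apply: (le_trans h).
by rewrite le_eqVlt; apply/orP; left; apply/eqP; ring.
Qed.

End power_inequalities.

(** * Integral inequalities of Jensen and Minkowski type *)

Section jensen.
Local Open Scope ereal_scope.

(** Neither function is assumed measurable: the integral of a nonnegative function is a supremum
    over the simple functions below it. This makes the Sobolev norm of a random distribution
    comparable with measurable functions. *)
Lemma ge0_le_integralT d (T : measurableType d) (R : realType)
    (mu : {measure set T -> \bar R}) (f g : T -> \bar R) :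
  (forall x, 0 <= f x) -> (forall x, f x <= g x) ->
  \int[mu]_x f x <= \int[mu]_x g x.
Proof.
move=> f0 fg; have g0 x : 0 <= g x by rewrite (le_trans (f0 x)).
rewrite !ge0_integralTE//; apply: ereal_sup_le => _ [h /= hf <-].
by exists h => //= x; rewrite (le_trans (hf x)).
Qed.

Context d (T : measurableType d) (R : realType) (mu : {measure set T -> \bar R}).

(** The tangent inequality at a constant [c], integrated against the density [f], whose mass is only
    bounded by [m]; then [c] is optimized. *)
Lemma jensen_powR (q m : R) (f g : T -> R) : (1 < q)%R -> (0 < m)%R ->
  measurable_fun setT f -> measurable_fun setT g ->
  (forall x, 0 <= f x)%R -> (forall x, 0 <= g x)%R ->
  \int[mu]_x (f x)%:E <= m%:E ->
  (\int[mu]_x (g x * f x)%:E) `^ q <= (m `^ (q - 1))%:E * \int[mu]_x (g x `^ q * f x)%:E.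
Proof.
move=> q1 m0 mf mg f0 g0 fm.
have q0 : (0 < q)%R by exact: lt_trans q1.
have q10 : (0 < q - 1)%R by rewrite subr_gt0.
set A := \int[mu]_x (g x * f x)%:E; set B := \int[mu]_x (g x `^ q * f x)%:E.
have A0 : 0 <= A by apply: integral_ge0 => x _; rewrite lee_fin mulr_ge0.
have B0 : 0 <= B by apply: integral_ge0 => x _; rewrite lee_fin mulr_ge0 ?powR_ge0.
have [->|Bfin] := eqVneq B +oo.
  by rewrite gt0_muley ?lte_fin ?powR_gt0// leey.
have mgq : measurable_fun setT (fun x => (g x `^ q)%R).
  by apply: (measurableT_comp (measurable_powR q)).
have key (c : R) : (0 < c)%R ->
    (q * c `^ (q - 1))%:E * A <= B + ((q - 1) * c `^ q * m)%:E.
  move=> c0; have cq0 : (0 < c `^ q)%R by rewrite powR_gt0.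
  rewrite -ge0_integralZl_EFin//; last 3 first.
  - by move=> x _; rewrite lee_fin mulr_ge0.
  - by apply/measurable_EFinP; exact: measurable_funM.
  - by rewrite mulr_ge0 ?powR_ge0// ltW.
  apply: (@le_trans _ _ (\int[mu]_x ((g x `^ q * f x)%:E + ((q - 1) * c `^ q)%:E * (f x)%:E))).
    apply: ge0_le_integralT => x.
      by rewrite mule_ge0// lee_fin mulr_ge0// ?powR_ge0// ltW.
    rewrite -!EFinM -EFinD lee_fin mulrA -mulrDl ler_wpM2r//.
    exact: powR_tangent.
  rewrite ge0_integralD//; last 4 first.
  - by move=> x _; rewrite lee_fin mulr_ge0// powR_ge0.
  - by apply/measurable_EFinP; exact: measurable_funM.
  - by move=> x _; rewrite -EFinM lee_fin !mulr_ge0 ?powR_ge0// ltW.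
  - by apply: emeasurable_funM => //; exact/measurable_EFinP.
  rewrite leeD2l// ge0_integralZl_EFin//; last 3 first.
  - by move=> x _; rewrite lee_fin.
  - exact/measurable_EFinP.
  - by rewrite mulr_ge0// ltW.
  by rewrite [leRHS]EFinM lee_wpmul2l// lee_fin mulr_ge0// ltW.
have Blt : B < +oo by rewrite ltey.
(* The choice c = 1 shows that A is finite, so that c = A / m is available below. *)
have Alt : A < +oo.
  have := key 1%R ltr01; rewrite !powR1 !mulr1 => h.
  have : q%:E * A < +oo by rewrite (le_lt_trans h)// lte_add_pinfty// ltry.
  have [->|] := eqVneq A +oo; first by rewrite gt0_muley ?lte_fin.
  by move=> A1 _; rewrite ltey.
move: key A0 B0 Alt Blt; case: A => [a| |]//; case: B {Bfin} => [b| |]// key.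
rewrite !lee_fin => a0 b0 _ _; change ((a `^ q)%:E <= (m `^ (q - 1) * b)%:E); rewrite lee_fin.
move: a0; rewrite le_eqVlt => /orP[/eqP<-|a0].
  by rewrite powR0 ?gt_eqF// mulr_ge0 ?powR_ge0.
(* The optimal tangent point is c = a / m: the inequality [key] then reduces to m (a / m)^q <= b. *)
have am0 : (0 < a / m)%R by rewrite divr_gt0.
have := key _ am0; rewrite -EFinM -EFinD lee_fin.
have E : ((a / m) `^ q = (a / m) `^ (q - 1) * (a / m))%R.
  by rewrite -{3}(powRr1 (ltW am0)) -powRD ?subrK// gt_eqF// implybT.
have aq : (a `^ q = (m `^ (q - 1) * m) * (a / m) `^ q)%R.
  rewrite -{2}(powRr1 (ltW m0)) -powRD ?subrK; last by rewrite gt_eqF// implybT.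
  by rewrite -powRM ?(ltW m0) ?(ltW am0)// mulrC divfK// gt_eqF.
have mq : (0 < m `^ (q - 1))%R by rewrite powR_gt0.
have -> : (q * (a / m) `^ (q - 1) * a = q * (a / m) `^ q * m)%R.
  by rewrite E; field; rewrite gt_eqF.
move=> h; rewrite aq -mulrA ler_wpM2l ?(ltW mq)//.
by move: h; set X := ((a / m) `^ q)%R; nra.
Qed.

End jensen.

Section minkowski_integral.
Local Open Scope ereal_scope.
Context d1 d2 (Z : measurableType d1) (A : measurableType d2) (R : realType).
Context (zeta : {sigma_finite_measure set Z -> \bar R})
        (nu : {sigma_finite_measure set A -> \bar R}).

(** Jensen in z for each fixed a, then Tonelli. The weight [kappa] and the second space [A] are left
    free so that the same statement serves the L^q part of the energy (weight 1) and the Gagliardo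
    part (pairs of points, singular kernel). *)
Lemma minkowski_integral (q m : R) (H : Z * A -> R) (f : Z -> R) (kappa : A -> R) (D : A -> R) :
  (1 < q)%R -> (0 < m)%R ->
  measurable_fun setT H -> measurable_fun setT f -> measurable_fun setT kappa ->
  (forall a, 0 <= kappa a)%R ->
  \int[zeta]_z (`|f z|)%:E <= m%:E ->
  (forall a, (`|D a|)%:E <= \int[zeta]_z (`|H (z, a)| * `|f z|)%:E) ->
  \int[nu]_a (`|D a| `^ q * kappa a)%:E <=
  (m `^ (q - 1))%:E * \int[zeta]_z ((`|f z|)%:E * \int[nu]_a (`|H (z, a)| `^ q * kappa a)%:E).
Proof.
move=> q1 m0 mH mf mk k0 fm hD.
have q0 : (0 < q)%R by exact: lt_trans q1.
have mHz a : measurable_fun setT (fun z => H (z, a)).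
  exact: (measurableT_comp mH (measurable_pair2 a)).
have mHa z : measurable_fun setT (fun a => H (z, a)).
  exact: (measurableT_comp mH (measurable_pair1 z)).
have mF : measurable_fun setT (fun za : Z * A =>
    (`|H za| `^ q * `|f za.1| * kappa za.2)%:E).
  apply/measurable_EFinP; apply: measurable_funM; last exact: (measurableT_comp mk).
  apply: measurable_funM.
    by apply: (measurableT_comp (measurable_powR q)); exact: measurableT_comp.
  by apply: measurableT_comp => //; exact: (measurableT_comp mf).
have F0 (za : Z * A) : 0 <= (`|H za| `^ q * `|f za.1| * kappa za.2)%:E.
  by rewrite lee_fin !mulr_ge0 ?powR_ge0.
have mf' : measurable_fun setT (fun z => `|f z|)%R by exact: measurableT_comp.
have mHz' a : measurable_fun setT (fun z => `|H (z, a)|)%R by exact: measurableT_comp.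
apply: (@le_trans _ _ (\int[nu]_a ((m `^ (q - 1))%:E *
   \int[zeta]_z (`|H (z, a)| `^ q * `|f z| * kappa a)%:E))).
  apply: ge0_le_integralT => a; first by rewrite lee_fin mulr_ge0 ?powR_ge0.
  rewrite EFinM (@eq_integral _ _ _ _ _
    (fun z => (kappa a)%:E * (`|H (z, a)| `^ q * `|f z|)%:E)); last first.
    by move=> z _; rewrite -EFinM mulrC.
  rewrite ge0_integralZl_EFin//; last first.
    apply/measurable_EFinP; apply: measurable_funM => //.
    exact: (measurableT_comp (measurable_powR q)).
  rewrite muleCA [leLHS]muleC lee_wpmul2l ?lee_fin//.
  apply: le_trans (jensen_powR q1 m0 mf' (mHz' a) _ _ fm) => //.
  rewrite -poweR_EFin; apply: gt0_ler_poweR; rewrite ?(ltW q0)//.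
  - by rewrite in_itv/= leey lee_fin normr_ge0.
  - by rewrite in_itv/= leey andbT; apply: integral_ge0 => z _; rewrite lee_fin mulr_ge0.
rewrite ge0_integralZl_EFin ?powR_ge0//; last 2 first.
- by move=> a _; apply: integral_ge0 => z _; exact: (F0 (z, a)).
- exact: (measurable_fun_fubini_tonelli_G _ mF F0).
rewrite lee_wpmul2l ?lee_fin ?powR_ge0//.
rewrite -(fubini_tonelli _ mF F0).
apply: ge0_le_integralT => z.
  by apply: integral_ge0 => a _; exact: (F0 (z, a)).
rewrite -ge0_integralZl_EFin//; last 2 first.
- by move=> a _; rewrite lee_fin mulr_ge0 ?powR_ge0.
- apply/measurable_EFinP; apply: measurable_funM => //.
  by apply: (measurableT_comp (measurable_powR q)); exact: measurableT_comp.
by apply: ge0_le_integralT => a; [exact: (F0 (z, a))|rewrite -EFinM lee_fin/= mulrAC mulrA (mulrC (`|f z|)%R) mulrAC].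
Qed.

End minkowski_integral.

(** * Decay of Schwartz functions *)

Section weight.
Context {R : realType} {n : nat}.
Implicit Types (x y z h v : 'rV[R]_n).
Local Notation mu := (@lebesgue_rV R n).
Local Notation leb := (@lebesgue_measure R).

(** The power n provides one factor 1 + |x|^2 for each coordinate, which is enough for integrability
    over R^n by [weight_prod]. *)
Definition weight x : R := ((1 + enorm x ^+ 2) ^+ n)^-1.

Lemma weight_base_ge1 x : 1 <= 1 + enorm x ^+ 2.
Proof. by rewrite lerDl sqr_ge0. Qed.

Lemma weight_gt0 x : 0 < weight x.
Proof. by rewrite invr_gt0 exprn_gt0// (lt_le_trans _ (weight_base_ge1 x)). Qed.

Lemma weight_le1 x : weight x <= 1.
Proof.
by rewrite invf_le1 ?exprn_gt0 ?(lt_le_trans _ (weight_base_ge1 x))// exprn_ege1// weight_base_ge1.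
Qed.

Lemma measurable_weight : measurable_fun setT weight.
Proof.
rewrite (_ : weight = fun x => ((1 + enorm x ^+ 2) ^+ n) `^ (- 1)); last first.
  by apply/funext => x; rewrite powR_inv1// exprn_ge0// (le_trans ler01 (weight_base_ge1 x)).
apply: (measurableT_comp (measurable_powR _)).
apply: measurable_funX; apply: measurable_funD => //.
by apply: measurable_funX; exact: measurable_enorm.
Qed.

Lemma weight_near x y : enorm (y - x) <= 1 -> weight y <= 4 ^+ n * weight x.
Proof.
move=> xy; have y0 := lt_le_trans ltr01 (weight_base_ge1 y).
have x0 := lt_le_trans ltr01 (weight_base_ge1 x).
rewrite /weight -ler_pdivrMl ?exprn_gt0// mulrC -exprVn -exprVn -exprMn -exprVn.
rewrite lerXn2r ?nnegrE ?mulr_ge0 ?invr_ge0 ?(ltW x0) ?(ltW y0)//.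
rewrite -invfM lef_pV2 ?posrE ?mulr_gt0//.
rewrite (le_trans (enorm_subl y x))// (mulrC _ 4) -mulrA.
have xy2 : enorm (y - x) ^+ 2 <= 1 by rewrite -(expr1n _ 2) lerXn2r ?nnegrE ?enorm_ge0.
by move: y0 xy2; set A := 1 + enorm y ^+ 2; set B := enorm _ ^+ 2; nra.
Qed.

(** Each of the n factors 1 + |x|^2 is bounded below by a different 1 + x_i^2, and 1 / (1 + r^2) is
    at most 1 and at most r^(-2). *)
Lemma weight_prod x : weight x <= \prod_(i < n) broken_power 1 1 (x ord0 i).
Proof.
apply: (@le_trans _ _ (\prod_(i < n) (1 + x ord0 i ^+ 2)^-1)); last first.
  apply: ler_prod => i _; set r := x ord0 i.
  have r0 : 0 < 1 + r ^+ 2 by rewrite ltr_pwDl// sqr_ge0.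
  rewrite invr_ge0 (ltW r0)/= /broken_power; case: ifPn => [r1|].
    by rewrite subrr powRr0 invf_le1// lerDl sqr_ge0.
  rewrite -ltNge => r1.
  have -> : - 1 - 1 = - 2%:R :> R by ring.
  rewrite powRN powR_mulrn// real_normK ?num_real//.
  have r20 : 0 < r ^+ 2 by rewrite -real_normK ?num_real// exprn_gt0// (lt_trans _ r1).
  by rewrite lef_pV2 ?posrE// lerDr.
rewrite /weight prodfV lef_pV2 ?posrE.
- rewrite -[X in _ <= _ ^+ X]card_ord -prodr_const; apply: ler_prod => i _.
  rewrite addr_ge0 ?sqr_ge0//= lerD2l enorm2 (bigD1 i)//= lerDl.
  by rewrite sumr_ge0// => j _; exact: sqr_ge0.
- by rewrite exprn_gt0// (lt_le_trans _ (weight_base_ge1 x)).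
- by rewrite prodr_gt0// => i _; rewrite ltr_pwDl// sqr_ge0.
Qed.

Lemma integral_prod_broken_power_lty (g b : R) : 0 < g -> 0 < b ->
  (\int[mu]_x (\prod_(i < n) broken_power g b (x ord0 i))%:E < +oo)%E.
Proof.
move=> g0 b0; rewrite (ge0_integral_prod_rV (f := fun i => broken_power g b)).
- have : (\int[leb]_r (broken_power g b r)%:E \is a fin_num)%E.
    rewrite ge0_fin_numE; first exact: integral_broken_power_lty.
    by apply: integral_ge0 => r _; rewrite lee_fin broken_power_ge0.
  by move=> /fineK <-; rewrite prodEFin ltry.
- by move=> _; exact: measurable_broken_power.
- by move=> _ r; exact: broken_power_ge0.
Qed.

Lemma integral_weight_lty : (\int[mu]_x (weight x)%:E < +oo)%E.
Proof.
apply: le_lt_trans (integral_prod_broken_power_lty ltr01 ltr01).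
apply: ge0_le_integralT => x; rewrite lee_fin; last exact: weight_prod.
by rewrite ltW// weight_gt0.
Qed.

(** Since 0 to a nonzero power is 0, [broken_power] with [g] different from 1 vanishes at r = 0. The
    majorant of [cut_kernel] is therefore valid only off the coordinate hyperplanes. *)
Lemma ae_coord_neq0 : {ae mu, forall x, forall i, x ord0 i != 0}.
Proof.
have H i : {ae mu, forall x, x ord0 i != 0}.
  exists [set x : 'rV[R]_n | forall j, (if j == i then [set 0] else setT : set R) (x ord0 j)].
  have mA j : measurable (if j == i then [set 0] else setT : set R) by case: ifP.
  split.
  - rewrite (_ : [set x : 'rV[R]_n | _] = \bigcap_(j in [set: 'I_n])
       ((fun x : 'rV[R]_n => x ord0 j) @^-1` (if j == i then [set 0] else setT))); last first.
      by apply/seteqP; split => x /= h j; [move=> _; exact: h|exact: h].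
    apply: fin_bigcap_measurable => // j _.
    by rewrite -[X in measurable X]setTI; exact: measurable_rV_coord.
  - rewrite (@lebesgue_rV_box R n (fun j => if j == i then [set 0] else setT))// (bigD1 i)//= eqxx.
    by rewrite (_ : lebesgue_measure _ = 0%E) ?mul0e//; exact: lebesgue_measure_set1.
  - move=> x /= /negP; rewrite negbK => /eqP xi j.
    by case: eqP => // ->.
apply: filter_forall; exact: H.
Qed.

(** The Gagliardo kernel times the q-th power of a Hölder modulus of exponent [beta] that is cut off
    at 1. *)
Definition cut_kernel (alpha q beta : R) h : R :=
  Num.min 1 (enorm h) `^ (beta * q) / enorm h `^ (n%:R + alpha * q).

Lemma cut_kernel_ge0 a q b h : 0 <= cut_kernel a q b h.
Proof. by rewrite divr_ge0// powR_ge0. Qed.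

Lemma measurable_cut_kernel a q b : measurable_fun setT (cut_kernel a q b).
Proof.
rewrite /cut_kernel; under eq_fun do rewrite -powRN.
apply: measurable_funM.
  apply: (measurableT_comp (measurable_powR _)); apply: measurable_minr => //.
  exact: measurable_enorm.
apply: (measurableT_comp (measurable_powR _)); exact: measurable_enorm.
Qed.

(** The condition g <= 1 makes both branches nonincreasing in |r|; they are separated by the value
    1, taken at |r| = 1. *)
Lemma broken_power_anti (g b r s : R) : 0 < g <= 1 -> 0 < b -> 0 < `|r| -> `|r| <= `|s| ->
  broken_power g b s <= broken_power g b r.
Proof.
move=> /andP[g0 g1] b0 r0 rs; have s0 := lt_le_trans r0 rs.
have anti (e u t : R) : 0 < u -> u <= t -> e <= 0 -> t `^ e <= u `^ e.
  move=> x0 xy e0; have t0 := lt_le_trans x0 xy.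
    have E (c : R) : c `^ e = (c `^ (- e))^-1 by rewrite powRN invrK.
    rewrite !E lef_pV2 ?posrE ?powR_gt0//.
  by apply: ge0_ler_powR; rewrite ?nnegrE ?oppr_ge0// ?ltW.
rewrite /broken_power; case: ifPn => s1.
  by rewrite (le_trans rs s1) anti// subr_le0.
case: ifPn => r1; last by rewrite anti//; lra.
rewrite -ltNge in s1.
apply: (@le_trans _ _ 1).
  have := @anti (- 1 - b) 1 `|s| ltr01 (ltW s1); rewrite powR1; apply; lra.
by have := @anti (g - 1) `|r| 1 r0 r1; rewrite powR1; apply; lra.
Qed.

(** The kernel is |h|^((b - a) q - n) near 0 and |h|^(-n - a q) far away. Each exponent is spread
    evenly over the n coordinates, which gives [g] and [c]. Capping [g] at 1 keeps [broken_power]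
    nonincreasing, so that |h| may be replaced by the smaller |h_i| in every factor. *)
Lemma integral_cut_kernel_lty a q b : (0 < n)%N -> 0 < a -> a < b -> 0 < q ->
  (\int[mu]_h (cut_kernel a q b h)%:E < +oo)%E.
Proof.
move=> n0 a0 ab q0; have nR : 0 < n%:R :> R by rewrite ltr0n.
pose g := Num.min 1 ((b - a) * q / n%:R).
have g0 : 0 < g by rewrite lt_min ltr01/= divr_gt0// mulr_gt0// subr_gt0.
have g1 : g <= 1 by rewrite ge_min lexx.
pose c := a * q / n%:R.
have c0 : 0 < c by rewrite divr_gt0// mulr_gt0.
apply: le_lt_trans (integral_prod_broken_power_lty g0 c0).
apply: ae_ge0_le_integral => //.
- by move=> x _; rewrite lee_fin cut_kernel_ge0.
- by apply/measurable_EFinP; exact: measurable_cut_kernel.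
- by move=> x _; rewrite lee_fin prodr_ge0// => i _; exact: broken_power_ge0.
- apply/measurable_EFinP; apply: (measurable_prod_rV (f := fun _ => broken_power g c)) => _.
  exact: measurable_broken_power.
apply: filterS ae_coord_neq0 => h hi _; rewrite lee_fin.
have h0 : 0 < enorm h.
  rewrite (lt_le_trans _ (enorm_coord h (Ordinal n0)))// normr_gt0; exact: hi.
apply: (@le_trans _ _ (\prod_(i < n) broken_power g c (enorm h))); last first.
  apply: ler_prod => i _; rewrite broken_power_ge0/=.
  apply: broken_power_anti => //; first by rewrite g0.
  - by rewrite normr_gt0.
  - by rewrite (ger0_norm (enorm_ge0 h)) enorm_coord.
rewrite prodr_const card_ord /cut_kernel /broken_power (ger0_norm (enorm_ge0 h)).
case: ifPn => h1.
  rewrite (min_idPr h1) -powRB; last by rewrite (gt_eqF h0) implybT.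
  rewrite -powR_mulrn ?powR_ge0// -powRrM.
  apply: ger_powR; first by rewrite h0.
  have : g <= (b - a) * q / n%:R by rewrite ge_min lexx orbT.
  by rewrite ler_pdivlMr//; lra.
rewrite -ltNge in h1; rewrite (min_idPl (ltW h1)) powR1 mul1r -powRN.
rewrite -powR_mulrn ?powR_ge0// -powRrM /c.
by rewrite (_ : (- 1 - _) * _ = - (n%:R + a * q))//; field; rewrite gt_eqF.
Qed.

End weight.

Section schwartz_estimates.
Context {R : realType} {n : nat}.
Implicit Types (x y z h v : 'rV[R]_n) (f : 'rV[R]_n -> R).

Lemma diff_partial f x v : differentiable f x ->
  'd f x v = \sum_(i < n) v ord0 i * partial i f x.
Proof.
move=> df; rewrite {1}(row_sum_delta v) linear_sum.
by apply: eq_bigr => i _; rewrite linearZ/= partialE.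
Qed.

Lemma smooth_MVT f x y : smooth f -> exists2 s : R, 0 <= s <= 1 &
  f x - f y = \sum_(i < n) (x - y) ord0 i * partial i f (y + s *: (x - y)).
Proof.
move=> sf; pose aff (s : R) := y + s *: (x - y).
have daff s : is_diff s aff (fun t => 0 + t *: (x - y)).
  exact: (@is_diffD _ _ _ (cst y) (fun s : R => s *: (x - y)) (cst 0) (fun s : R => s *: (x - y))).
have dfx z : differentiable f z by exact: (sf [::]).
have dg s : differentiable (f \o aff) s.
  by apply: differentiable_comp; [exact: ex_diff|exact: dfx].
have isd s : is_derive s (1 : R) (f \o aff) ('d f (aff s) (x - y)).
  apply: DeriveDef; first by apply: diff_derivable.
  have h1 : differentiable aff s by exact: ex_diff.
  rewrite deriveE// (diff_comp h1 (dfx (aff s)))/=.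
  by rewrite diff_val add0r scale1r.
have cg : {within `[(0 : R), 1], continuous (f \o aff)}.
  by apply: continuous_subspaceT => s; exact: differentiable_continuous.
have [s] := @MVT_segment R (f \o aff) (fun s => 'd f (aff s) (x - y)) 0 1 ler01 (fun s _ => isd s) cg.
rewrite in_itv/= => s01; rewrite subr0 mulr1 /aff/= scale1r scale0r addr0 subrKC => E.
by exists s => //; rewrite E diff_partial.
Qed.

(** If |x - y| <= 1, the mean value theorem gives the gradient at a point within distance 1 of [y],
    where the weight is at most 4^n [weight y]. For more distant points the triangle inequality is
    enough. The constant C0 + 4^n S covers both cases. *)
Lemma schwartz_decay f : smooth f -> rapidly_decreasing f -> exists2 C : R, 0 <= C &
  (forall x, `|f x| <= C * weight x) /\
  (forall x y, `|f x - f y| <= C * Num.min 1 (enorm (x - y)) * (weight x + weight y)).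
Proof.
move=> sf rf.
have bnd s : exists2 C : R, 0 <= C & forall x, `|partials s f x| <= C * weight x.
  have [C hC] := rf n s; exists (Num.max 0 C); first by rewrite le_max lexx.
  move=> x; rewrite ler_pdivlMr ?exprn_gt0 ?(lt_le_trans _ (weight_base_ge1 x))//.
  by rewrite mulrC (le_trans (hC x))// le_max lexx orbT.
have [C0 C00 hC0] := bnd [::].
have [Ci hCi] : {Ci : 'I_n -> R & forall i, 0 <= Ci i /\ forall x, `|partial i f x| <= Ci i * weight x}.
  apply: (@choice _ _ (fun i C => 0 <= C /\ forall x, `|partial i f x| <= C * weight x)) => i.
  by have [C hC1 hC2] := bnd [:: i]; exists C.
pose S := \sum_(i < n) Ci i.
have S0 : 0 <= S by apply: sumr_ge0 => i _; have [] := hCi i.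
pose C := C0 + 4 ^+ n * S.
have w0 x : 0 <= weight x by rewrite ltW// weight_gt0.
have S4 : 0 <= 4 ^+ n * S by rewrite mulr_ge0// exprn_ge0.
exists C; first by rewrite addr_ge0.
split=> [x|x y].
  by rewrite (le_trans (hC0 x))// ler_wpM2r// lerDl.
have [xy|xy] := leP (enorm (x - y)) 1; last first.
  rewrite mulr1 (le_trans (ler_normB _ _))// mulrDr lerD//.
    by rewrite (le_trans (hC0 x))// ler_wpM2r// lerDl.
  by rewrite (le_trans (hC0 y))// ler_wpM2r// lerDl.
have [s /andP[s0 s1] ->] := smooth_MVT x y sf.
set xi := y + s *: (x - y).
apply: (@le_trans _ _ (\sum_(i < n) enorm (x - y) * (Ci i * weight xi))).
  rewrite (le_trans (ler_norm_sum _ _ _))//; apply: ler_sum => i _.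
  by rewrite normrM ler_pM//; [exact: enorm_coord|have [] := hCi i].
rewrite -mulr_sumr -mulr_suml -/S.
have wxi : weight xi <= 4 ^+ n * weight y.
  apply: weight_near; rewrite /xi addrC addKr enormZ ger0_norm//.
  by rewrite (le_trans _ xy)// ler_piMl// enorm_ge0.
rewrite (mulrC C) -mulrA ler_wpM2l ?enorm_ge0//.
apply: (@le_trans _ _ (S * (4 ^+ n * weight y))); first by rewrite ler_wpM2l.
rewrite mulrA (mulrC S) ler_pM// ?mulr_ge0//; first by rewrite lerDr.
by rewrite lerDr.
Qed.

Lemma weight_shift x z : enorm z <= 1 -> weight (x - z) <= 4 ^+ n * weight x.
Proof.
by move=> z1; apply: weight_near; rewrite addrAC subrr add0r enormN.
Qed.

(* Interpolate between the bounds linear in [|z|] and in [min(1, |x - y|)]. *)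
Lemma schwartz_translation f (b : R) : smooth f -> rapidly_decreasing f -> 0 < b < 1 ->
  exists2 C : R, 0 <= C & forall z, enorm z <= 1 ->
  (forall x, `|f x - f (x - z)| <= C * enorm z `^ (1 - b) * weight x) /\
  (forall x y, `|(f x - f (x - z)) - (f y - f (y - z))| <=
     C * enorm z `^ (1 - b) * Num.min 1 (enorm (x - y)) `^ b * (weight x + weight y)).
Proof.
move=> sf rf /andP[b0 b1]; have [C C0 [hC1 hC2]] := schwartz_decay sf rf.
have w0 x : 0 <= weight x by rewrite ltW// weight_gt0.
pose K := C * (1 + 4 ^+ n); have K0 : 0 <= K by rewrite mulr_ge0// addr_ge0// exprn_ge0.
exists K => // z z1.
have b10 : 0 < 1 - b by rewrite subr_gt0.
have zb : enorm z <= enorm z `^ (1 - b).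
  have := enorm_ge0 z; rewrite le_eqVlt => /orP[/eqP <-|z0]; first exact: powR_ge0.
  by apply: ger1_powR; [rewrite z0|lra].
have hz x : `|f x - f (x - z)| <= K * enorm z * weight x.
  rewrite (le_trans (hC2 _ _))// opprB addrCA subrr addr0 (min_idPr z1).
  rewrite /K -mulrA -[leRHS]mulrA -[leRHS]mulrA ler_wpM2l// mulrCA.
  rewrite ler_wpM2l ?enorm_ge0// mulrDl mul1r lerD2l.
  exact: weight_shift.
split=> [x|x y].
  by rewrite (le_trans (hz x))// ler_wpM2r// ler_wpM2l.
set X := `|_|; set M := weight x + weight y; set m := Num.min 1 _.
have M0 : 0 <= M by rewrite addr_ge0.
have m0 : 0 <= m by rewrite le_min ler01 enorm_ge0.
have h1 : X <= K * M * enorm z.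
  rewrite /X (le_trans (ler_normB _ _))// /M mulrDr mulrDl lerD//.
    by rewrite (le_trans (hz x))// mulrAC.
  by rewrite (le_trans (hz y))// mulrAC.
have h2 : X <= K * M * m.
  (* The second difference is regrouped as the increment from y to x minus the increment from y - z
     to x - z: both have the same displacement, hence the same factor [m]. *)
  rewrite /X (_ : f x - _ - _ = (f x - f y) - (f (x - z) - f (y - z))); last by ring.
  rewrite (le_trans (ler_normB _ _))// (le_trans (lerD (hC2 _ _) (hC2 _ _)))//.
  rewrite (_ : x - z - (y - z) = x - y); last by rewrite opprB addrA subrK.
  rewrite -/m -mulrDr /K (_ : C * (1 + _) * M * m = C * m * ((1 + 4 ^+ n) * M)); last by ring.
  rewrite ler_wpM2l ?mulr_ge0// /M mulrDl mul1r lerD2l mulrDr lerD//.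
    exact: weight_shift.
  exact: weight_shift.
have X0 : 0 <= X by exact: normr_ge0.
have KM : 0 <= K * M by rewrite mulr_ge0.
have E (t : R) : 0 <= t -> t = t `^ (1 - b) * t `^ b.
  by move=> t0; rewrite -powRD ?subrK ?powRr1// oner_eq0.
have -> : K * enorm z `^ (1 - b) * m `^ b * M = (K * M * enorm z) `^ (1 - b) * (K * M * m) `^ b.
  rewrite (powRM _ KM (enorm_ge0 z)) (powRM _ KM m0) mulrACA -E//; ring.
rewrite {1}(E _ X0) ler_pM ?powR_ge0//; apply: ge0_ler_powR; rewrite ?nnegrE ?(ltW b0) ?(ltW b10)//.
  by rewrite mulr_ge0// enorm_ge0.
by rewrite mulr_ge0.
Qed.

End schwartz_estimates.

(** * The fractional Sobolev energy *)

Section lebesgue_pair.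
Context {R : realType} {n : nat}.
Local Notation mu := (@lebesgue_rV R n).
Local Open Scope ereal_scope.

(* A separate constant: for the product measure itself, the inferred
   sigma-finite structure is the one of subprobabilities. *)
Definition lebesgue_pair : set ('rV[R]_n * 'rV[R]_n)%type -> \bar R := mu \x mu.

HB.instance Definition _ := Measure.copy lebesgue_pair (mu \x mu).

Let lebesgue_pair_sigma_finite : sigma_finite setT lebesgue_pair.
Proof.
have /sigma_finiteP[F [TF ndF Foo]] := sigma_finiteT mu.
exists (fun k => F k `*` F k).
  apply/esym; rewrite -subTset => -[x y] _.
  have [i _ Fi] : (\bigcup_i F i) x by rewrite -TF.
  have [j _ Fj] : (\bigcup_i F i) y by rewrite -TF.
  exists (maxn i j) => //; split => /=.
    by move: Fi; exact/subsetPset/ndF/leq_maxl.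
  by move: Fj; exact/subsetPset/ndF/leq_maxr.
move=> k; have [mFk Fk] := Foo k; split; first exact: measurableX.
rewrite [X in X < _](product_measure1E mu mu mFk mFk).
by rewrite lte_mul_pinfty// ge0_fin_numE.
Qed.

HB.instance Definition _ := @Measure_isSigmaFinite.Build _ _ _
  lebesgue_pair lebesgue_pair_sigma_finite.

Lemma integral_lebesgue_pair (f : 'rV[R]_n * 'rV[R]_n -> \bar R) :
  measurable_fun setT f -> (forall z, 0 <= f z) ->
  \int[lebesgue_pair]_z f z = \int[mu]_y \int[mu]_x f (y, x).
Proof. exact: fubini_tonelli1. Qed.

Lemma integral_lebesgue_pair_swap (f : 'rV[R]_n * 'rV[R]_n -> \bar R) :
  measurable_fun setT f -> (forall z, 0 <= f z) ->
  \int[lebesgue_pair]_z f z = \int[mu]_x \int[mu]_y f (y, x).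
Proof. exact: fubini_tonelli2. Qed.

End lebesgue_pair.

(** The q-th power of [sobolev_norm] (see [sobolev_normE]). Only smallness and finiteness matter
    below, so the quasi-triangle inequality with factor 2^q replaces Minkowski's inequality. The
    definition is locked against unwanted unfolding. *)
HB.lock Definition energy {R : realType} {n : nat} (alpha q : R) (g : 'rV[R]_n -> R) : \bar R :=
  (\int[@lebesgue_rV R n]_x (`|g x| `^ q)%:E + gagliardo alpha q g)%E.

Section energy.
Context {R : realType} {n : nat}.
Local Notation mu := (@lebesgue_rV R n).
Local Open Scope ereal_scope.
Implicit Types (g h : 'rV[R]_n -> R).

Lemma energy_ge0 alpha q g : 0 <= energy alpha q g.
Proof.
rewrite energy.unlock adde_ge0//; first by apply: integral_ge0 => x _; rewrite lee_fin powR_ge0.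
apply: integral_ge0 => y _; apply: integral_ge0 => x _.
by rewrite lee_fin divr_ge0// powR_ge0.
Qed.

Lemma lee_scale_addACA (c A B a b d e : \bar R) : 0 <= a -> 0 <= b -> 0 <= d -> 0 <= e ->
  A <= c * (a + b) -> B <= c * (d + e) -> A + B <= c * ((a + d) + (b + e)).
Proof.
move=> a0 b0 d0 e0 h1 h2; rewrite addeACA ge0_muleDr ?adde_ge0//.
exact: leeD.
Qed.

Lemma sobolev_normE (alpha q : R) g : (q != 0)%R ->
  sobolev_norm alpha q g = energy alpha q g `^ q^-1.
Proof.
by move=> q0; rewrite /sobolev_norm poweR_Lnorm// energy.unlock.
Qed.

Context (alpha q : R) (q1 : (1 < q)%R).
Local Notation E := (energy alpha q).

Let q0 : (0 < q)%R. Proof. exact: lt_trans q1. Qed.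

Let ker (x : 'rV[R]_n) : R := (enorm x `^ (n%:R + alpha * q))^-1.

Let ker_ge0 x : (0 <= ker x)%R.
Proof. by rewrite invr_ge0 powR_ge0. Qed.

Let mker : measurable_fun setT ker.
Proof.
rewrite /ker; under eq_fun do rewrite -powRN.
by apply: (measurableT_comp (measurable_powR _)); exact: measurable_enorm.
Qed.

Lemma measurable_subrV :
  measurable_fun setT (fun z : 'rV[R]_n * 'rV[R]_n => (z.2 - z.1)%R).
Proof.
apply: measurable_rVP => i; under eq_fun do rewrite !mxE.
apply: measurable_funB.
  exact: (measurableT_comp (measurable_rV_coord i) measurable_snd).
exact: (measurableT_comp (measurable_rV_coord i) measurable_fst).
Qed.

Let mker2 : measurable_fun setT (fun z : 'rV[R]_n * 'rV[R]_n => ker (z.2 - z.1)).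
Proof. exact: (measurableT_comp mker measurable_subrV). Qed.

Let mdiff g : measurable_fun setT g ->
  measurable_fun setT (fun z : 'rV[R]_n * 'rV[R]_n => g z.2 - g z.1)%R.
Proof.
move=> mg; apply: measurable_funB.
  exact: (measurableT_comp mg measurable_snd).
exact: (measurableT_comp mg measurable_fst).
Qed.

Let mgag g : measurable_fun setT g ->
  measurable_fun setT (fun z : 'rV[R]_n * 'rV[R]_n => (`|g z.2 - g z.1| `^ q * ker (z.2 - z.1))%:E).
Proof.
move=> mg; apply/measurable_EFinP; apply: measurable_funM => //.
apply: (measurableT_comp (measurable_powR _)).
by apply: measurableT_comp => //; exact: mdiff.
Qed.

Let gag_ge0 g (z : 'rV[R]_n * 'rV[R]_n) : 0 <= (`|g z.2 - g z.1| `^ q * ker (z.2 - z.1))%:E.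
Proof. by rewrite lee_fin mulr_ge0 ?powR_ge0. Qed.

(** Turns the iterated integral into one integral over a sigma-finite space of pairs, the form that
    [minkowski_integral] takes. *)
Lemma gagliardo_prod g : measurable_fun setT g -> gagliardo alpha q g =
  \int[@lebesgue_pair R n]_z (`|g z.2 - g z.1| `^ q * (enorm (z.2 - z.1) `^ (n%:R + alpha * q))^-1)%:E.
Proof.
by move=> mg; rewrite (integral_lebesgue_pair (mgag mg) (gag_ge0 g)).
Qed.

Let mpow g : measurable_fun setT g -> measurable_fun setT (fun x => (`|g x| `^ q)%:E).
Proof.
move=> mg; apply/measurable_EFinP; apply: (measurableT_comp (measurable_powR _)).
exact: measurableT_comp.
Qed.

Let pow_ge0 g (x : 'rV[R]_n) : 0 <= (`|g x| `^ q)%:E.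
Proof. by rewrite lee_fin powR_ge0. Qed.

Let gag0 g : 0 <= gagliardo alpha q g.
Proof.
apply: integral_ge0 => y _; apply: integral_ge0 => x _.
by rewrite lee_fin divr_ge0// powR_ge0.
Qed.

Lemma energyZ (a : R) g : measurable_fun setT g ->
  E (fun x => a * g x)%R = (`|a| `^ q)%:E * E g.
Proof.
move=> mg; have mag : measurable_fun setT (fun x => a * g x)%R by exact: measurable_funM.
have E1 : \int[mu]_x (`|a * g x| `^ q)%:E = (`|a| `^ q)%:E * \int[mu]_x (`|g x| `^ q)%:E.
  rewrite -ge0_integralZl_EFin ?powR_ge0//; last exact: mpow.
  by apply: eq_integral => x _; rewrite -EFinM normrM powRM.
have E2 : gagliardo alpha q (fun x => a * g x)%R = (`|a| `^ q)%:E * gagliardo alpha q g.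
  rewrite (gagliardo_prod mag) (gagliardo_prod mg) -ge0_integralZl_EFin ?powR_ge0//.
  - by apply: eq_integral => z _; rewrite -EFinM -mulrBr normrM powRM// mulrA.
  - exact: (mgag mg).
rewrite energy.unlock E1 E2; apply/esym/ge0_muleDr; last exact: gag0.
by apply: integral_ge0 => x _; exact: pow_ge0.
Qed.

Lemma energyD g h : measurable_fun setT g -> measurable_fun setT h ->
  E (fun x => g x + h x)%R <= (2 `^ q)%:E * (E g + E h).
Proof.
move=> mg mh; have mgh : measurable_fun setT (fun x => g x + h x)%R by exact: measurable_funD.
have I0 (k : 'rV[R]_n -> R) : 0 <= \int[mu]_x (`|k x| `^ q)%:E by apply: integral_ge0 => x _; exact: pow_ge0.
have E1 : \int[mu]_x (`|g x + h x| `^ q)%:E <=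
    (2 `^ q)%:E * (\int[mu]_x (`|g x| `^ q)%:E + \int[mu]_x (`|h x| `^ q)%:E).
  rewrite -ge0_integralD//; [|exact: mpow|exact: mpow].
  rewrite -ge0_integralZl_EFin ?powR_ge0//; last 2 first.
  - by move=> x _; rewrite adde_ge0.
  - by apply: emeasurable_funD; exact: mpow.
  apply: ge0_le_integralT => x; first by rewrite lee_fin powR_ge0.
  by rewrite -EFinD -EFinM lee_fin powR_add_le// ltW.
have E2 : gagliardo alpha q (fun x => g x + h x)%R <=
    (2 `^ q)%:E * (gagliardo alpha q g + gagliardo alpha q h).
  rewrite (gagliardo_prod mgh) (gagliardo_prod mg) (gagliardo_prod mh).
  rewrite -ge0_integralD//; [|exact: (mgag mg)|exact: (mgag mh)].
  rewrite -ge0_integralZl_EFin ?powR_ge0//; last 2 first.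
  - by move=> x _; rewrite adde_ge0//; exact: gag_ge0.
  - by apply: emeasurable_funD; exact: mgag.
  apply: ge0_le_integralT => z; first by exact: (gag_ge0 (fun x => g x + h x)%R).
  rewrite -EFinD -EFinM lee_fin -mulrDl mulrA ler_wpM2r//; first exact: ker_ge0.
  by rewrite opprD addrACA powR_add_le// ltW.
rewrite energy.unlock; exact: lee_scale_addACA.
Qed.

Lemma energy_shift (a : 'rV[R]_n) g : measurable_fun setT g ->
  E (fun x => g (x - a))%R = E g.
Proof.
move=> mg; rewrite energy.unlock.
rewrite (ge0_integral_shift (- a) (f := fun x => (`|g x| `^ q)%:E) (mpow mg) (pow_ge0 g)).
suff -> : gagliardo alpha q (fun x => g (x - a))%R = gagliardo alpha q g by [].
rewrite /gagliardo.
pose F (z : 'rV[R]_n * 'rV[R]_n) := (`|g z.2 - g z.1| `^ q * ker (z.2 - z.1))%:E.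
have mF y : measurable_fun setT (fun x => F (y, x)).
  exact: (measurableT_comp (mgag mg) (measurable_pair1 y)).
have F0 y x : 0 <= F (y, x) by exact: gag_ge0.
rewrite -[RHS]/(\int[mu]_y \int[mu]_x F (y, x)).
have mI := measurable_fun_fubini_tonelli_F _ (mgag mg) (gag_ge0 g) : measurable_fun setT (fun y => \int[mu]_x F (y, x)).
have I0 y : 0 <= \int[mu]_x F (y, x) by apply: integral_ge0 => x _; exact: F0.
have S y := ge0_integral_shift (- a) (mF (y - a)%R) (F0 (y - a)%R).
apply: etrans (ge0_integral_shift (- a) mI I0).
apply: eq_integral => y _; apply: etrans (S y).
apply: eq_integral => x _; rewrite /F/= /ker.
by rewrite (_ : x - a - (y - a) = x - y)%R// opprB addrA subrK.
Qed.

Lemma sobolevP g : measurable_fun setT g -> E g < +oo -> sobolev alpha q g.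
Proof.
rewrite energy.unlock => mg Eg.
have E0 := gag0 g.
have I0 : 0 <= \int[mu]_x (`|g x| `^ q)%:E by exact: integral_ge0.
split; last by apply: le_lt_trans Eg; rewrite leeDr.
rewrite inE; apply/andP; split; first by rewrite inE.
rewrite inE /= /finite_norm unlock/=.
apply: poweR_lty; apply: le_lt_trans Eg; rewrite leeDl//.
Qed.

Lemma sobolev_measurable g : sobolev alpha q g -> measurable_fun setT g.
Proof. by move=> [/andP[]]; rewrite inE. Qed.

Lemma sobolev_energy g : sobolev alpha q g -> E g < +oo.
Proof.
rewrite energy.unlock => -[/andP[_]]; rewrite inE/= /finite_norm => N G; rewrite lte_add_pinfty//.
by have := poweR_lty q N; rewrite poweR_Lnorm ?gt_eqF.
Qed.

Lemma sobolev_lin (a : R) g h : sobolev alpha q g -> sobolev alpha q h ->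
  sobolev alpha q (a *: g + h)%R.
Proof.
move=> sg sh; have mg := sobolev_measurable sg; have mh := sobolev_measurable sh.
have mag : measurable_fun setT (fun x => a * g x)%R by exact: measurable_funM.
apply: sobolevP; first exact: measurable_funD.
apply: (le_lt_trans (energyD mag mh)).
rewrite (energyZ _ mg); apply: lte_mul_pinfty => //.
apply: lte_add_pinfty; last exact: sobolev_energy.
apply: lte_mul_pinfty => //.
exact: sobolev_energy.
Qed.

Lemma energy0 : E (fun _ : 'rV[R]_n => 0%R) = 0.
Proof.
rewrite energy.unlock gagliardo_prod//.
rewrite !integral0_eq ?adde0// => x _; rewrite ?subrr normr0 powR0 ?gt_eqF//.
by rewrite mul0r.
Qed.

Lemma energyB_shift g (a b : 'rV[R]_n) : measurable_fun setT g ->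
  E (fun x => g (x - a) - g (x - b))%R = E (fun x => g x - g (x - (b - a)))%R.
Proof.
move=> mg.
have mh : measurable_fun setT (fun x : 'rV[R]_n => g x - g (x - (b - a)))%R.
  by apply: measurable_funB => //; apply: (measurableT_comp mg); exact: measurable_addrV.
rewrite -(energy_shift a mh); congr E; apply/funext => x.
by rewrite opprB addrA subrK.
Qed.

Lemma energyB_le g (a : 'rV[R]_n) : measurable_fun setT g ->
  E (fun x => g x - g (x - a))%R <= (2 `^ q * 2)%:E * E g.
Proof.
move=> mg.
have mh : measurable_fun setT (fun x : 'rV[R]_n => - 1 * g (x - a))%R.
  by apply: measurable_funM => //; apply: (measurableT_comp mg); exact: measurable_addrV.
rewrite (_ : (fun x => _) = (fun x => g x + - 1 * g (x - a))%R); last first.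
  by apply/funext => x; rewrite mulN1r.
rewrite (le_trans (energyD mg mh))// energyZ; last first.
  by apply: (measurableT_comp mg); exact: measurable_addrV.
rewrite normrN1 powR1 mul1e energy_shift// EFinM -muleA lee_wpmul2l ?lee_fin ?powR_ge0//.
by rewrite mule_natl mule2n.
Qed.

(** [minkowski_integral] used twice: on points with weight 1, and on pairs of points with the
    Gagliardo kernel as weight. The two bounds have the same constant and add up. *)
Lemma energy_minkowski (m : R) (H : 'rV[R]_n * 'rV[R]_n -> R) (f D : 'rV[R]_n -> R) :
  (0 < m)%R -> measurable_fun setT H -> measurable_fun setT f -> measurable_fun setT D ->
  \int[mu]_z (`|f z|)%:E <= m%:E ->
  (forall x, (`|D x|)%:E <= \int[mu]_z (`|H (z, x)| * `|f z|)%:E) ->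
  (forall x y, (`|D x - D y|)%:E <= \int[mu]_z (`|H (z, x) - H (z, y)| * `|f z|)%:E) ->
  E D <= (m `^ (q - 1))%:E * \int[mu]_z ((`|f z|)%:E * E (fun x => H (z, x))).
Proof.
rewrite energy.unlock => m0 mH mf mD fm h1 h2.
have mHz z : measurable_fun setT (fun x => H (z, x)).
  exact: (measurableT_comp mH (measurable_pair1 z)).
pose H2 (w : 'rV[R]_n * ('rV[R]_n * 'rV[R]_n)) := (H (w.1, w.2.2) - H (w.1, w.2.1))%R.
have mH2 : measurable_fun setT H2.
  apply: measurable_funB; apply: (measurableT_comp mH).
    apply/measurable_fun_pairP; split; first exact: measurable_fst.
    exact: (measurableT_comp measurable_snd measurable_snd).
  apply/measurable_fun_pairP; split; first exact: measurable_fst.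
  exact: (measurableT_comp measurable_fst measurable_snd).
have mF1 : measurable_fun setT (fun w : 'rV[R]_n * 'rV[R]_n => (`|H w| `^ q)%:E).
  apply/measurable_EFinP; apply: (measurableT_comp (measurable_powR _)).
  exact: measurableT_comp.
have mF2 : measurable_fun setT (fun w : 'rV[R]_n * ('rV[R]_n * 'rV[R]_n) =>
    (`|H2 w| `^ q * ker (w.2.2 - w.2.1))%:E).
  apply/measurable_EFinP; apply: measurable_funM.
    by apply: (measurableT_comp (measurable_powR _)); exact: measurableT_comp.
  exact: (measurableT_comp mker2 measurable_snd).
have F20 (w : 'rV[R]_n * ('rV[R]_n * 'rV[R]_n)) : 0 <= (`|H2 w| `^ q * ker (w.2.2 - w.2.1))%:E.
  by rewrite lee_fin mulr_ge0 ?powR_ge0.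
have mI1 : measurable_fun setT (fun z => \int[mu]_x (`|H (z, x)| `^ q)%:E).
  by apply: (measurable_fun_fubini_tonelli_F _ mF1) => w; rewrite lee_fin powR_ge0.
have mI2 : measurable_fun setT (fun z => \int[@lebesgue_pair R n]_a (`|H2 (z, a)| `^ q * ker (a.2 - a.1))%:E).
  exact: (measurable_fun_fubini_tonelli_F _ mF2 F20).
have I10 z : 0 <= \int[mu]_x (`|H (z, x)| `^ q)%:E by exact: integral_ge0.
have I20 z : 0 <= \int[@lebesgue_pair R n]_a (`|H2 (z, a)| `^ q * ker (a.2 - a.1))%:E.
  by apply: integral_ge0 => a _; exact: (F20 (z, a)).
have mf' : measurable_fun setT (fun z => (`|f z|)%:E).
  by apply/measurable_EFinP; exact: measurableT_comp.
under [X in _ <= _ * X]eq_integral => z _.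
  rewrite gagliardo_prod// ge0_muleDr//; last exact: (I20 z).
  over.
rewrite ge0_integralD//; last 4 first.
- by move=> z _; rewrite mule_ge0// lee_fin.
- exact: emeasurable_funM.
- by move=> z _; rewrite mule_ge0//; exact: (I20 z).
- exact: (emeasurable_funM mf' mI2).
rewrite ge0_muleDr; last 2 first.
- by apply: integral_ge0 => z _; rewrite mule_ge0// lee_fin.
- by apply: integral_ge0 => z _; rewrite mule_ge0//; exact: (I20 z).
apply: leeD.
  have := @minkowski_integral _ _ _ _ R mu mu q m H f (cst 1%R) D q1 m0 mH mf (measurable_cst _)
    (fun _ => ler01) fm h1.
  rewrite /cst/=.
  under eq_integral do rewrite mulr1.
  under [X in _ <= _ * X -> _]eq_integral do under eq_integral do rewrite mulr1.
  exact.
rewrite gagliardo_prod//.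
apply: (@minkowski_integral _ _ _ _ R mu (@lebesgue_pair R n) q m H2 f (fun a => ker (a.2 - a.1)%R)
   (fun a => D a.2 - D a.1)%R) => //.
Qed.

Lemma measurable_energy (H : 'rV[R]_n * 'rV[R]_n -> R) : measurable_fun setT H ->
  measurable_fun setT (fun z => E (fun x => H (z, x))).
Proof.
move=> mH.
have mHz z : measurable_fun setT (fun x => H (z, x)).
  exact: (measurableT_comp mH (measurable_pair1 z)).
pose H2 (w : 'rV[R]_n * ('rV[R]_n * 'rV[R]_n)) := (H (w.1, w.2.2) - H (w.1, w.2.1))%R.
have mH2 : measurable_fun setT H2.
  apply: measurable_funB; apply: (measurableT_comp mH).
    apply/measurable_fun_pairP; split; first exact: measurable_fst.
    exact: (measurableT_comp measurable_snd measurable_snd).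
  apply/measurable_fun_pairP; split; first exact: measurable_fst.
  exact: (measurableT_comp measurable_fst measurable_snd).
have mF1 : measurable_fun setT (fun w : 'rV[R]_n * 'rV[R]_n => (`|H w| `^ q)%:E).
  apply/measurable_EFinP; apply: (measurableT_comp (measurable_powR _)).
  exact: measurableT_comp.
have mF2 : measurable_fun setT (fun w : 'rV[R]_n * ('rV[R]_n * 'rV[R]_n) =>
    (`|H2 w| `^ q * ker (w.2.2 - w.2.1))%:E).
  apply/measurable_EFinP; apply: measurable_funM.
    by apply: (measurableT_comp (measurable_powR _)); exact: measurableT_comp.
  exact: (measurableT_comp mker2 measurable_snd).
rewrite (_ : (fun z => _) = (fun z => \int[mu]_x (`|H (z, x)| `^ q)%:E +
   \int[@lebesgue_pair R n]_a (`|H2 (z, a)| `^ q * ker (a.2 - a.1))%:E)); last first.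
  by apply/funext => z; rewrite energy.unlock gagliardo_prod.
apply: emeasurable_funD.
  by apply: (measurable_fun_fubini_tonelli_F _ mF1) => w; rewrite lee_fin powR_ge0.
have F20 (w : 'rV[R]_n * ('rV[R]_n * 'rV[R]_n)) : 0 <= (`|H2 w| `^ q * ker (w.2.2 - w.2.1))%:E.
  by rewrite lee_fin mulr_ge0 ?powR_ge0.
exact: (measurable_fun_fubini_tonelli_F _ mF2 F20).
Qed.

(** The Hölder factor over the Gagliardo kernel is [cut_kernel], integrable because alpha < b, and
    weight^q <= weight because the weight is at most 1. The sum weight x + weight y splits into two
    double integrals, both equal to K W: one integrates the kernel in y first, the other in x. *)
Lemma energy_bound (b : R) : (0 < n)%N -> (0 < alpha)%R -> (alpha < b)%R ->
  exists2 K : R, (0 <= K)%R & forall (c : R) (D : 'rV[R]_n -> R), (0 <= c)%R ->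
  (forall x, `|D x| <= c * weight x)%R ->
  (forall x y, `|D x - D y| <= c * Num.min 1 (enorm (x - y)) `^ b * (weight x + weight y))%R ->
  E D <= (c `^ q * K)%:E.
Proof.
move=> n0 a0 ab; have b0 : (0 < b)%R by exact: lt_trans ab.
have Wfin := @integral_weight_lty R n.
have Kfin := @integral_cut_kernel_lty R n alpha q b n0 a0 ab q0.
set W := \int[mu]_x _ in Wfin; set K := \int[mu]_h _ in Kfin.
have w0 (x : 'rV[R]_n) : (0 <= weight x)%R by rewrite ltW// weight_gt0.
have mw : measurable_fun setT (fun x : 'rV[R]_n => (weight x)%:E).
  by apply/measurable_EFinP; exact: measurable_weight.
have mk : measurable_fun setT (fun x : 'rV[R]_n => (cut_kernel alpha q b x)%:E).
  by apply/measurable_EFinP; exact: measurable_cut_kernel.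
have W0 : 0 <= W by apply: integral_ge0 => x _; rewrite lee_fin.
have K0 : 0 <= K by apply: integral_ge0 => x _; rewrite lee_fin cut_kernel_ge0.
have wq (x : 'rV[R]_n) : (weight x `^ q <= weight x)%R.
  by apply: ge1r_powR; rewrite ?weight_gt0 ?weight_le1// ltW.
exists (fine W + 2 `^ q * (fine K * fine W + fine K * fine W))%R.
  by rewrite addr_ge0 ?fine_ge0// mulr_ge0 ?powR_ge0// addr_ge0// mulr_ge0 ?fine_ge0.
move=> c D c0 h1 h2; rewrite energy.unlock.
have cq0 : (0 <= c `^ q)%R by rewrite powR_ge0.
rewrite mulrDr EFinD; apply: leeD.
  apply: (@le_trans _ _ (\int[mu]_x ((c `^ q)%:E * (weight x)%:E))).
    apply: ge0_le_integralT => x; first by rewrite lee_fin powR_ge0.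
    rewrite -EFinM lee_fin (@le_trans _ _ ((c * weight x) `^ q)%R)//.
      by apply: ge0_ler_powR; rewrite ?nnegrE ?(ltW q0) ?mulr_ge0.
    by rewrite powRM// ler_wpM2l.
  rewrite ge0_integralZl_EFin//; last by move=> x _; rewrite lee_fin.
  by rewrite EFinM fineK// ge0_fin_numE.
have mkd : measurable_fun setT (fun z : 'rV[R]_n * 'rV[R]_n => (cut_kernel alpha q b (z.2 - z.1))%:E).
  exact: (measurableT_comp mk measurable_subrV).
pose F1 (z : 'rV[R]_n * 'rV[R]_n) := (weight z.2)%:E * (cut_kernel alpha q b (z.2 - z.1))%:E.
pose F2 (z : 'rV[R]_n * 'rV[R]_n) := (weight z.1)%:E * (cut_kernel alpha q b (z.2 - z.1))%:E.
have mF1 : measurable_fun setT F1.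
  by apply: emeasurable_funM => //; exact: (measurableT_comp mw measurable_snd).
have mF2 : measurable_fun setT F2.
  by apply: emeasurable_funM => //; exact: (measurableT_comp mw measurable_fst).
have F10 z : 0 <= F1 z by rewrite mule_ge0 ?lee_fin// cut_kernel_ge0.
have F20 z : 0 <= F2 z by rewrite mule_ge0 ?lee_fin// cut_kernel_ge0.
have k0 (h : 'rV[R]_n) : 0 <= (cut_kernel alpha q b h)%:E by rewrite lee_fin cut_kernel_ge0.
have R1 x : \int[mu]_y (cut_kernel alpha q b (x - y))%:E = K.
  exact: (ge0_integral_reflect x mk k0).
have R2 y : \int[mu]_x (cut_kernel alpha q b (x - y))%:E = K.
  exact: (ge0_integral_shift (- y)%R mk k0).
have mk1 (x : 'rV[R]_n) : measurable_fun setT (fun y : 'rV[R]_n => (cut_kernel alpha q b (x - y))%:E).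
  exact: (measurableT_comp mkd (measurable_pair2 x)).
have mk2 (y : 'rV[R]_n) : measurable_fun setT (fun x : 'rV[R]_n => (cut_kernel alpha q b (x - y))%:E).
  exact: (measurableT_comp mkd (measurable_pair1 y)).
have ZW (x : 'rV[R]_n) (k : 'rV[R]_n -> \bar R) : (forall y, 0 <= k y) -> measurable_fun setT k ->
    \int[mu]_y ((weight x)%:E * k y) = (weight x)%:E * \int[mu]_y k y.
  by move=> kk mkk; apply: ge0_integralZl_EFin.
have ZK : \int[mu]_x (K * (weight x)%:E) = K * W.
  by apply: ge0_integralZl => // x _; rewrite lee_fin.
apply: (@le_trans _ _ (\int[@lebesgue_pair R n]_z ((c `^ q * 2 `^ q)%:E * (F1 z + F2 z)))).
  rewrite [leRHS](@integral_lebesgue_pair _ _ (fun z => (c `^ q * 2 `^ q)%:E * (F1 z + F2 z))); last 2 first.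
  - by apply: emeasurable_funM => //; exact: emeasurable_funD.
  - by move=> z; apply: mule_ge0; [rewrite lee_fin mulr_ge0 ?powR_ge0|rewrite adde_ge0].
  apply: ge0_le_integralT => y.
    by apply: integral_ge0 => x _; rewrite lee_fin divr_ge0 ?powR_ge0.
  apply: ge0_le_integralT => x; first by rewrite lee_fin divr_ge0 ?powR_ge0.
  have -> : F1 (y, x) + F2 (y, x) = ((weight x + weight y) * cut_kernel alpha q b (x - y))%:E.
    by rewrite mulrDl EFinD !EFinM.
  rewrite -EFinM lee_fin.
  rewrite /cut_kernel mulrA mulrA ler_wpM2r ?invr_ge0 ?powR_ge0//.
  set mm := Num.min 1%R _; have mm0 : (0 <= mm)%R by rewrite le_min ler01 enorm_ge0.
  apply: (@le_trans _ _ ((c * mm `^ b * (weight x + weight y)) `^ q)%R).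
    apply: ge0_ler_powR; rewrite ?nnegrE ?(ltW q0)//.
    by rewrite !mulr_ge0 ?powR_ge0// addr_ge0.
  rewrite !powRM ?mulr_ge0 ?powR_ge0 ?addr_ge0// -powRrM.
  have H : ((weight x + weight y) `^ q <= 2 `^ q * (weight x + weight y))%R.
    have := @powR_add_le R q (weight x) (weight y) (ltW q0).
    rewrite !ger0_norm ?addr_ge0// => H; apply: (le_trans H).
    by rewrite ler_wpM2l ?powR_ge0// lerD.
  rewrite (_ : c `^ q * 2 `^ q * (_ * _) = c `^ q * mm `^ (b * q) * (2 `^ q * (weight x + weight y)))%R; last by ring.
  by rewrite ler_wpM2l// mulr_ge0 ?powR_ge0.
rewrite ge0_integralZl_EFin//; last 3 first.
- by move=> z _; rewrite adde_ge0.
- exact: emeasurable_funD.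
- by rewrite mulr_ge0 ?powR_ge0.
rewrite ge0_integralD// mulrA [leRHS]EFinM lee_wpmul2l ?lee_fin ?mulr_ge0 ?powR_ge0//.
rewrite EFinD !EFinM !fineK ?ge0_fin_numE//; apply: leeD.
  rewrite le_eqVlt; apply/orP; left; apply/eqP; rewrite (integral_lebesgue_pair_swap mF1 F10).
  rewrite -ZK.
  apply: eq_integral => x _; rewrite -(R1 x) muleC.
  exact: (ZW x _ (fun y => k0 (x - y)%R) (mk1 x)).
rewrite le_eqVlt; apply/orP; left; apply/eqP; rewrite (integral_lebesgue_pair mF2 F20).
rewrite -ZK.
apply: eq_integral => y _; rewrite -(R2 y) muleC.
exact: (ZW y _ (fun x => k0 (x - y)%R) (mk2 y)).
Qed.

End energy.

(** * Functionals on the Sobolev space under integration *)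

Section parametric_integral.
Context d1 d2 (Z : measurableType d1) (A : measurableType d2) (R : realType).
Context (zeta : {sigma_finite_measure set Z -> \bar R}).

Lemma measurable_Rintegral_param (F : Z * A -> R) : measurable_fun setT F ->
  measurable_fun setT (fun a => \int[zeta]_z F (z, a)).
Proof.
move=> mF; have mEF : measurable_fun setT (EFin \o F) by exact/measurable_EFinP.
rewrite /Rintegral; apply: (measurableT_comp (fine_measurable measurableT)).
under eq_fun do rewrite integralE.
have mP := measurable_funepos mEF; have mN := measurable_funeneg mEF.
apply: emeasurable_funB.
  have G1 := @measurable_fun_fubini_tonelli_G _ _ _ _ R zeta _ mP (fun za => funepos_ge0 _ za).
  by move: G1; congr measurable_fun; apply/funext => a; apply: eq_integral => z _; rewrite !funeposE.
have G2 := @measurable_fun_fubini_tonelli_G _ _ _ _ R zeta _ mN (fun za => funeneg_ge0 _ za).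
by move: G2; congr measurable_fun; apply/funext => a; apply: eq_integral => z _; rewrite !funenegE.
Qed.

Lemma integrable_bounded_mul (h f : Z -> R) (B : R) :
  measurable_fun setT h -> measurable_fun setT f -> (forall z, `|h z| <= B) ->
  (\int[zeta]_z (`|f z|)%:E < +oo)%E ->
  zeta.-integrable setT (fun z => (h z * f z)%:E).
Proof.
move=> mh mf hB fi; apply/integrableP; split.
  by apply/measurable_EFinP; exact: measurable_funM.
have mf' : measurable_fun setT (fun z => (`|f z|)%:E).
  by apply/measurable_EFinP; exact: measurableT_comp.
apply: (@le_lt_trans _ _ (\int[zeta]_z ((Num.max 0 B)%:E * (`|f z|)%:E))%E).
  apply: ge0_le_integralT => z; first exact: abse_ge0.
  rewrite -EFinM lee_fin normrM ler_wpM2r//.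
  by rewrite (le_trans (hB z))// le_max lexx orbT.
rewrite ge0_integralZl_EFin//; last by rewrite le_max lexx.
by rewrite lte_mul_pinfty// lee_fin le_max lexx.
Qed.

Lemma normr_Rintegral_le (h f : Z -> R) :
  zeta.-integrable setT (fun z => (h z * f z)%:E) ->
  ((`|\int[zeta]_z (h z * f z)|)%:E <= \int[zeta]_z (`|h z| * `|f z|)%:E)%E.
Proof.
move=> hf; rewrite EFin_normr_Rintegral//.
have mhf : measurable_fun setT (fun z => (h z * f z)%:E) by exact: measurable_int hf.
apply: (le_trans (le_abse_integral _ _ mhf)) => //.
by apply: ge0_le_integralT => z; [exact: abse_ge0|rewrite lee_fin normrM].
Qed.

End parametric_integral.

Section energy_Rintegral.
Context {R : realType} {n : nat}.
Local Notation mu := (@lebesgue_rV R n).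
Context (alpha q : R) (q1 : 1 < q).

Lemma energy_Rintegral (m B : R) (H : 'rV[R]_n * 'rV[R]_n -> R) (f : 'rV[R]_n -> R) :
  0 < m -> measurable_fun setT H -> (forall w, `|H w| <= B) -> measurable_fun setT f ->
  (\int[mu]_z (`|f z|)%:E <= m%:E)%E ->
  (energy alpha q (fun x : 'rV[R]_n => \int[mu]_z (H (z, x) * f z))%R <=
   (m `^ (q - 1))%:E * \int[mu]_z ((`|f z|)%:E * energy alpha q (fun x => H (z, x))))%E.
Proof.
move=> m0 mH HB mf fm.
have fi : (\int[mu]_z (`|f z|)%:E < +oo)%E by apply: le_lt_trans fm _; exact: ltry.
have mHx x : measurable_fun setT (fun z => H (z, x)).
  exact: (measurableT_comp mH (measurable_pair2 x)).
have iH x : mu.-integrable setT (fun z => (H (z, x) * f z)%:E).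
  exact: (@integrable_bounded_mul _ _ _ mu _ f B).
apply: energy_minkowski => //.
- apply: (@measurable_Rintegral_param _ _ _ _ _ mu (fun w => H w * f w.1)).
  by apply: measurable_funM => //; exact: (measurableT_comp mf measurable_fst).
- by move=> x; exact: normr_Rintegral_le.
move=> x y; rewrite -RintegralB//; [|exact: iH|exact: iH].
under eq_Rintegral do rewrite -mulrBl.
apply: normr_Rintegral_le.
under eq_fun do rewrite mulrBl EFinB.
exact: integrableB.
Qed.

End energy_Rintegral.

(** * Dual functionals applied to translates and convolutions *)

Section functional.
Context {R : realType} {n : nat}.
Local Notation mu := (@lebesgue_rV R n).
Context (alpha q : R) (q1 : 1 < q).
Local Notation E := (energy alpha q).
Local Notation S := (sobolev alpha q).

Let q0 : 0 < q. Proof. exact: lt_trans q1. Qed.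

(** What the exchange of a dual functional with a convolution integral requires of [phi]. The last
    clause is continuity of translations at 0 in the Sobolev energy; by [energyB_shift] it is
    continuity at every point, uniformly. *)
Definition translatable (phi : 'rV[R]_n -> R) : Prop :=
  [/\ measurable_fun setT phi, exists B, forall x, `|phi x| <= B, (E phi < +oo)%E &
   forall eps : R, 0 < eps -> exists2 delta : R, 0 < delta &
     forall z, enorm z < delta -> (E (fun x : 'rV[R]_n => phi x - phi (x - z))%R <= eps%:E)%E].

Lemma schwartz_translatable (f : 'rV[R]_n -> R) : (0 < n)%N -> 0 < alpha < 1 ->
  smooth f -> rapidly_decreasing f -> translatable f.
Proof.
move=> n0 /andP[a0 a1] sf rf.
(* Above alpha, so that [energy_bound] applies; below 1, so that a translation by z keeps the
   positive power |z|^(1 - b). *)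
pose b := (1 + alpha) / 2.
have ab : alpha < b by rewrite /b; lra.
have b01 : 0 < b < 1 by rewrite /b; lra.
have /andP[b0 b1] := b01.
have [K K0 hK] := @energy_bound R n alpha q q1 b n0 a0 ab.
have [C C0 [hC1 hC2]] := schwartz_decay sf rf.
have w0 (x : 'rV[R]_n) : 0 <= weight x by rewrite ltW// weight_gt0.
have mf : measurable_fun setT f.
  apply: continuous_measurable_rV => x; apply: differentiable_continuous.
  exact: (sf [::]).
split => //.
- by exists C => x; rewrite (le_trans (hC1 x))// ler_piMr// weight_le1.
- apply: (@le_lt_trans _ _ ((C `^ q * K)%:E)); last exact: ltry.
  apply: hK => // x y; rewrite (le_trans (hC2 x y))// ler_wpM2r ?addr_ge0// ler_wpM2l//.
  set t := Num.min _ _.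
  have : 0 <= t by rewrite le_min ler01 enorm_ge0.
  have t1 : t <= 1 by rewrite ge_min lexx.
  rewrite le_eqVlt => /orP[/eqP<-|t0]; first exact: powR_ge0.
  by apply: ger1_powR; [rewrite t0|exact: ltW].
move=> eps eps0; have [D D0 hD] := schwartz_translation sf rf b01.
pose c := D `^ q * K; have c0 : 0 <= c by rewrite mulr_ge0 ?powR_ge0.
pose e := (1 - b) * q; have e0 : 0 < e by rewrite mulr_gt0// subr_gt0.
have ec : 0 < eps / (c + 1) by rewrite divr_gt0// ltr_wpDl.
(* The energy of the increment is at most c |z|^e, and c + 1 avoids a division by 0. *)
exists (Num.min 1 ((eps / (c + 1)) `^ e^-1)).
  by rewrite lt_min ltr01/= powR_gt0.
move=> z; rewrite lt_min => /andP[/ltW z1 z2].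
have [hD1 hD2] := hD z z1.
have Dz0 : 0 <= D * enorm z `^ (1 - b) by rewrite mulr_ge0 ?powR_ge0.
apply: (le_trans (hK _ _ Dz0 hD1 hD2)); rewrite lee_fin.
rewrite powRM ?powR_ge0// -powRrM -/e mulrAC -/c.
have ze : enorm z `^ e <= eps / (c + 1).
  apply: (@le_trans _ _ (((eps / (c + 1)) `^ e^-1) `^ e)).
    by apply: ge0_ler_powR; rewrite ?nnegrE ?(ltW e0) ?enorm_ge0 ?powR_ge0// ltW.
  by rewrite -powRrM mulVf ?gt_eqF// powRr1// ltW.
rewrite (le_trans (ler_wpM2l c0 ze))// mulrA ler_pdivrMr ?ltr_wpDl// mulrC.
by rewrite ler_wpM2l ?(ltW eps0)// lerDl.
Qed.

Context (l : ('rV[R]_n -> R) -> R) (hl : sobolev_dual alpha q l).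

Let l_lin (a : R) g h : S g -> S h -> l (a *: g + h) = a * l g + l h.
Proof. by case: hl => h1 _; exact: h1. Qed.

Lemma functionalB g h : S g -> S h -> l (fun x : 'rV[R]_n => g x - h x) = l g - l h.
Proof.
move=> sg sh; have -> : l g - l h = l (-1 *: h + g) by rewrite l_lin// mulN1r addrC.
by congr l; apply/funext => x; rewrite [RHS]/= [RHS]/GRing.add/= scaleN1r addrC.
Qed.

Lemma sobolevB g h : S g -> S h -> S (fun x : 'rV[R]_n => g x - h x).
Proof.
move=> sg sh; have := sobolev_lin q1 (-1) sh sg.
rewrite (_ : _ *: h + g = fun x => g x - h x)//.
by apply/funext => x; rewrite /= scaleN1r addrC.
Qed.

Lemma sobolev0 : S (fun _ : 'rV[R]_n => 0).
Proof.
have E0 : (E (fun _ : 'rV[R]_n => 0%R) < +oo)%E by rewrite (energy0 alpha q1) ltry.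
exact: sobolevP (measurable_cst _) E0.
Qed.

Lemma functional0 : l (fun _ : 'rV[R]_n => 0) = 0.
Proof.
rewrite -[RHS](subrr (l (fun _ : 'rV[R]_n => 0))) -(functionalB sobolev0 sobolev0).
by congr l; apply/funext => x; rewrite subrr.
Qed.

Lemma functional_sum (I : Type) (s : seq I) (a : I -> R) (g : I -> 'rV[R]_n -> R) :
  (forall i, S (g i)) ->
  S (fun x : 'rV[R]_n => \sum_(i <- s) a i * g i x) /\
  l (fun x : 'rV[R]_n => \sum_(i <- s) a i * g i x) = \sum_(i <- s) a i * l (g i).
Proof.
move=> sg; elim: s => [|i s [IH1 IH2]].
  rewrite big_nil; under eq_fun do rewrite big_nil.
  by split; [exact: sobolev0|exact: functional0].
pose G (x : 'rV[R]_n) := \sum_(j <- s) a j * g j x.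
have GE : (fun x : 'rV[R]_n => \sum_(j <- i :: s) a j * g j x) = a i *: g i + G.
  by apply/funext => x; rewrite big_cons.
rewrite GE big_cons -IH2; split; first exact: (sobolev_lin q1 (a i) (sg i) IH1).
exact: (l_lin (a i) (sg i) IH1).
Qed.

Lemma functional_small (eps : R) : 0 < eps -> exists2 eta : R, 0 < eta &
  forall g, S g -> (E g <= eta%:E)%E -> `|l g| <= eps.
Proof.
move=> e0; case: hl => _ [C hC].
(* The continuity constant of [l] may be zero or negative; a positive one is needed to divide by
   it. *)
pose C' := Num.max 0 C + 1.
have C'0 : 0 < C' by rewrite ltr_wpDl// le_max lexx.
exists ((eps / C') `^ q); first by rewrite powR_gt0// divr_gt0.
move=> g sg Eg; have := hC g sg; rewrite sobolev_normE ?gt_eqF// => h.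
have E0 : (0 <= E g `^ q^-1)%E by exact: poweR_ge0.
have h2 : (E g `^ q^-1 <= (eps / C')%:E)%E.
  apply: (@le_trans _ _ ((((eps / C') `^ q)%:E `^ q^-1)%E)).
    apply: gt0_ler_poweR => //; first by rewrite invr_ge0 ltW.
    - by rewrite in_itv/= leey energy_ge0.
    - by rewrite in_itv/= leey lee_fin powR_ge0.
  by rewrite poweR_EFin -powRrM mulfV ?gt_eqF// powRr1// divr_ge0 ?ltW.
rewrite -lee_fin (le_trans h)//.
apply: (@le_trans _ _ (C'%:E * (eps / C')%:E)%E); last first.
  by rewrite -EFinM lee_fin mulrC divfK// gt_eqF.
apply: (@le_trans _ _ (C'%:E * E g `^ q^-1)%E); last first.
  by rewrite lee_wpmul2l// lee_fin ltW.
rewrite lee_wpmul2r// lee_fin (@le_trans _ _ (Num.max 0 C))//.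
  by rewrite le_max lexx orbT.
by rewrite lerDl.
Qed.

(** For an even [phi], such as the heat kernel, this is the convolution with [phi] of the
    distribution represented by [l]. *)
Definition shifted (phi : 'rV[R]_n -> R) (z : 'rV[R]_n) : R := l (fun x : 'rV[R]_n => phi (x - z)).

Section translatable_theory.
Context (phi : 'rV[R]_n -> R) (tphi : translatable phi).

Let mphi : measurable_fun setT phi. Proof. by case: tphi. Qed.
Let Ephi : (E phi < +oo)%E. Proof. by case: tphi. Qed.

Let mphiz (z : 'rV[R]_n) : measurable_fun setT (fun x : 'rV[R]_n => phi (x - z)).
Proof. by apply: (measurableT_comp mphi); exact: measurable_addrV. Qed.

Lemma sobolev_shift (z : 'rV[R]_n) : S (fun x : 'rV[R]_n => phi (x - z)).
Proof. by apply: sobolevP => //; rewrite energy_shift. Qed.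

Lemma shifted_ucontinuous (eps : R) : 0 < eps -> exists2 delta : R, 0 < delta &
  forall z w, enorm (w - z) < delta -> `|shifted phi z - shifted phi w| <= eps.
Proof.
move=> e0; have [eta eta0 heta] := functional_small e0.
have [_ _ _ /(_ _ eta0)[delta d0 hd]] := tphi.
exists delta => // z w zw.
rewrite /shifted -(functionalB (sobolev_shift z) (sobolev_shift w)).
apply: heta; first by apply: sobolevB; exact: sobolev_shift.
by rewrite energyB_shift//; exact: hd.
Qed.

Lemma shifted_bounded : exists M, forall z, `|shifted phi z| <= M.
Proof.
case: hl => _ [C hC].
exists (fine (`|C|%:E * E phi `^ q^-1)) => z.
have := hC _ (sobolev_shift z); rewrite sobolev_normE ?gt_eqF// energy_shift// => h.
have fin : (`|C|%:E * E phi `^ q^-1 \is a fin_num)%E.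
  rewrite fin_numM// ge0_fin_numE ?poweR_ge0//; exact: poweR_lty.
rewrite -lee_fin fineK// (le_trans h)// lee_wpmul2r ?poweR_ge0//.
by rewrite lee_fin ler_norm.
Qed.

Lemma shifted_cvg_mesh z : shifted phi (mesh k z) @[k --> \oo] --> shifted phi z.
Proof.
apply/cvgrPdist_le => e e0; have [d d0 hd] := shifted_ucontinuous e0.
have /cvgrPdist_lt/(_ _ d0) := cvg_mesh_enorm z.
apply: filterS => k; rewrite sub0r normrN (ger0_norm (enorm_ge0 _)) => h.
by apply: hd; rewrite -enormN opprB.
Qed.

Lemma measurable_shifted : measurable_fun setT (shifted phi).
Proof. by apply: measurable_mesh_lim => z; exact: shifted_cvg_mesh. Qed.

Context (f : 'rV[R]_n -> R) (mf : measurable_fun setT f)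
        (fi : (\int[mu]_z (`|f z|)%:E < +oo)%E).

(** The extra 1 provides the strictly positive mass bound that Jensen's inequality asks for. *)
Let m : R := fine (\int[mu]_z (`|f z|)%:E) + 1.

Let I0 : (0 <= \int[mu]_z (`|f z|)%:E)%E.
Proof. by apply: integral_ge0 => z _; rewrite lee_fin. Qed.

Let m0 : 0 < m. Proof. by rewrite ltr_wpDl// fine_ge0. Qed.

Let fm : (\int[mu]_z (`|f z|)%:E <= m%:E)%E.
Proof. by rewrite EFinD fineK ?ge0_fin_numE// leeDl. Qed.

Let mf' : measurable_fun setT (fun z => (`|f z|)%:E).
Proof. by apply/measurable_EFinP; exact: measurableT_comp. Qed.

Let mH1 : measurable_fun setT (fun w : 'rV[R]_n * 'rV[R]_n => phi (w.2 - w.1)).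
Proof. exact: (measurableT_comp mphi measurable_subrV). Qed.

Lemma measurable_convolve :
  measurable_fun setT (fun x : 'rV[R]_n => \int[mu]_z (phi (x - z) * f z)).
Proof.
apply: (@measurable_Rintegral_param _ _ _ _ _ mu (fun w : 'rV[R]_n * 'rV[R]_n => phi (w.2 - w.1) * f w.1)).
by apply: measurable_funM => //; exact: (measurableT_comp mf measurable_fst).
Qed.

Lemma sobolev_convolve : S (fun x : 'rV[R]_n => \int[mu]_z (phi (x - z) * f z)).
Proof.
apply: sobolevP; first exact: measurable_convolve.
have [_ [B hB] _ _] := tphi.
apply: le_lt_trans (@energy_Rintegral R n alpha q q1 m B (fun w => phi (w.2 - w.1)) f
  m0 mH1 (fun w => hB _) mf fm) _.
rewrite lte_mul_pinfty ?lee_fin ?powR_ge0//=.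
under eq_integral do rewrite energy_shift//.
by rewrite ge0_integralZr ?energy_ge0// lte_mul_pinfty// ge0_fin_numE.
Qed.

Let meshH k (w : 'rV[R]_n * 'rV[R]_n) := phi (w.2 - w.1) - phi (w.2 - mesh k w.1).

Let mmeshH k : measurable_fun setT (meshH k).
Proof.
apply: measurable_funB; first exact: mH1.
apply: (measurableT_comp mphi).
apply: measurable_rVP => i; under eq_fun do rewrite 2!mxE.
apply: measurable_funB.
  exact: (measurableT_comp (measurable_rV_coord i) measurable_snd).
exact: (measurableT_comp (measurable_mesh_comp k (fun x : 'rV[R]_n => x ord0 i)) measurable_fst).
Qed.

(** Dominated convergence: for fixed z the energy tends to 0 by continuity of translations, and by
    [energyB_le] it never exceeds 2^q 2 E(phi), so a multiple of |f| dominates. *)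
Let mesh_energy0 : (\int[mu]_z ((`|f z|)%:E * E (fun x => meshH k (z, x))) @[k --> \oo] --> 0)%E.
Proof.
pose g k z := ((`|f z|)%:E * E (fun x => meshH k (z, x)))%E.
have EfE : (E phi \is a fin_num)%E by rewrite ge0_fin_numE ?energy_ge0.
have mEk k : measurable_fun setT (fun z => E (fun x => meshH k (z, x))).
  exact: measurable_energy.
have bnd k z : (E (fun x => meshH k (z, x)) <= (2 `^ q * 2)%:E * E phi)%E.
  by rewrite /meshH/= energyB_shift//; exact: energyB_le.
have mgk k : measurable_fun setT (g k) by exact: emeasurable_funM.
have gcvg : {ae mu, forall z, setT z -> (g k z @[k --> \oo] --> 0)%E}.
  apply/nearW => z _; rewrite /g.
  have h : (E (fun x => meshH k (z, x)) @[k --> \oo] --> 0)%E.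
    have ffin k : E (fun x => meshH k (z, x)) \is a fin_num.
      rewrite ge0_fin_numE ?energy_ge0// (le_lt_trans (bnd k z))//.
      by rewrite lte_mul_pinfty// lee_fin mulr_ge0// powR_ge0.
    apply/fine_cvgP; split; first exact: nearW.
    apply/cvgrPdist_le => e e0; have [_ _ _ /(_ _ e0)[d d0 hd]] := tphi.
    have /cvgrPdist_lt/(_ _ d0) := cvg_mesh_enorm z.
    apply: filterS => k; rewrite !sub0r !normrN (ger0_norm (enorm_ge0 _)) => h.
    rewrite /= ger0_norm ?fine_ge0 ?energy_ge0// -lee_fin fineK//.
    rewrite /meshH/= energyB_shift//; apply: hd.
    by rewrite -enormN opprB.
  rewrite -[X in _ --> X](mule0 (`|f z|)%:E).
  exact: cvgeZl.
pose c := ((2 `^ q * 2)%:E * E phi)%E.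
have c0 : (0 <= c)%E by rewrite mule_ge0 ?energy_ge0// lee_fin mulr_ge0 ?powR_ge0.
have cfin : c \is a fin_num by rewrite fin_numM.
have ig : mu.-integrable setT (fun z => c * (`|f z|)%:E)%E.
  rewrite -(fineK cfin); apply: integrableZl => //; apply/integrableP; split => //.
  by under eq_integral do rewrite gee0_abs ?lee_fin//.
have dom : {ae mu, forall z k, setT z -> (`|g k z| <= c * (`|f z|)%:E)%E}.
  apply/nearW => z k _; rewrite /g gee0_abs ?mule_ge0 ?energy_ge0 ?lee_fin//.
  by rewrite muleC lee_wpmul2r ?lee_fin//; exact: bnd.
have [_ _] := dominated_convergence measurableT mgk (measurable_cst _) gcvg ig dom.
by rewrite integral0.
Qed.

(** An integrand depending on z through its cell, times [f], integrates to a finite sum, and [l]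
    commutes with finite sums by linearity alone. *)
Let Rintegral_cell k (V : {ffun 'I_n -> 'I_(2 * k.+1 ^ 2).+1} -> R) :
  \int[mu]_z (V (cell k z) * f z) =
  \sum_c (\int[mu]_z ((cell k z == c)%:R * f z)) * V c.
Proof.
have ic c : mu.-integrable setT (fun z => ((cell k z == c)%:R * f z)%:E).
  apply: (@integrable_bounded_mul _ _ _ mu _ f 1) => //.
    exact: (measurable_cell_comp (fun c' => (c' == c)%:R : R)).
  by move=> z; case: eqP => _; rewrite ?normr1 ?normr0.
have key (s : seq {ffun 'I_n -> 'I_(2 * k.+1 ^ 2).+1}) :
    mu.-integrable setT (fun z => (\sum_(c <- s) V c * ((cell k z == c)%:R * f z))%:E) /\
    \int[mu]_z (\sum_(c <- s) V c * ((cell k z == c)%:R * f z)) =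
    \sum_(c <- s) (\int[mu]_z ((cell k z == c)%:R * f z)) * V c.
  elim: s => [|c s [IH1 IH2]].
    rewrite big_nil; under eq_fun do rewrite big_nil.
    split; first exact: integrable0.
    by under eq_Rintegral do rewrite big_nil; rewrite Rintegral_cst// mul0r.
  have iV : mu.-integrable setT (fun z => (V c * ((cell k z == c)%:R * f z))%:E).
    by under eq_fun do rewrite EFinM; exact: integrableZl.
  split.
    by under eq_fun do rewrite big_cons EFinD; exact: integrableD.
  under eq_Rintegral do rewrite big_cons.
  by rewrite (RintegralD measurableT iV IH1) IH2 big_cons (RintegralZl _ measurableT (ic c)) mulrC.
rewrite -(key _).2; apply: eq_Rintegral => z _.
rewrite (bigD1 (cell k z))//= eqxx mul1r big1 ?addr0// => c /negPf.
by rewrite eq_sym => ->; rewrite mul0r mulr0.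
Qed.

(* Approximate the integral by its Riemann sums over the mesh. *)
Lemma functional_convolve :
  l (fun x : 'rV[R]_n => \int[mu]_z (phi (x - z) * f z)) = \int[mu]_z (shifted phi z * f z).
Proof.
have [_ [B hB] _ _] := tphi.
pose G x := \int[mu]_z (phi (x - z) * f z).
pose Gk k x := \int[mu]_z (phi (x - mesh k z) * f z).
have iphi x : mu.-integrable setT (fun z => (phi (x - z) * f z)%:E).
  apply: (@integrable_bounded_mul _ _ _ mu _ f B) => //.
  exact: (measurableT_comp mH1 (measurable_pair2 x)).
have imesh k x : mu.-integrable setT (fun z => (phi (x - mesh k z) * f z)%:E).
  apply: (@integrable_bounded_mul _ _ _ mu _ f B) => //.
  exact: (measurable_mesh_comp k (fun z => phi (x - z))).
have GkE k : S (Gk k) /\ l (Gk k) = \int[mu]_z (shifted phi (mesh k z) * f z).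
  have := functional_sum (index_enum _)
    (fun c => \int[mu]_z ((cell k z == c)%:R * f z)) (fun c => sobolev_shift (node c)).
  rewrite -(Rintegral_cell (fun c => shifted phi (node c))).
  rewrite (_ : (fun x => \sum_c _) = Gk k)//.
  apply/funext => x; rewrite -(Rintegral_cell (fun c => phi (x - node c)))//.
(* By [energy_Rintegral] the energy of G - Gk is at most a constant times the integral in
   [mesh_energy0]. *)
have c1 : l (Gk k) @[k --> \oo] --> l G.
  apply/cvgrPdist_le => e e0; have [eta eta0 heta] := functional_small e0.
  have mq0 : (0 < m `^ (q - 1)) by rewrite powR_gt0.
  have eq0 : 0 < eta / m `^ (q - 1) by rewrite divr_gt0.
  have /fine_cvgP[] := mesh_energy0.
  move=> fin /cvgrPdist_le/(_ _ eq0) small.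
  near=> k; rewrite -functionalB//; last 2 first.
  - exact: sobolev_convolve.
  - exact: (GkE k).1.
  apply: heta.
    by apply: sobolevB; [exact: sobolev_convolve|exact: (GkE k).1].
  rewrite (_ : (fun x => _) = fun x => \int[mu]_z (meshH k (z, x) * f z)); last first.
    apply/funext => x; rewrite /G /Gk -RintegralB//; [|exact: iphi|exact: imesh].
    by apply: eq_Rintegral => z _; rewrite mulrBl.
  have HB w : `|meshH k w| <= B + B by rewrite (le_trans (ler_normB _ _))// lerD.
  apply: le_trans (@energy_Rintegral R n alpha q q1 m (B + B) (meshH k) f
    m0 (mmeshH k) HB mf fm) _.
  have finI : (\int[mu]_z ((`|f z|)%:E * E (fun x => meshH k (z, x))))%E \is a fin_num.
    by near: k.
  have I0k : (0 <= \int[mu]_z ((`|f z|)%:E * E (fun x => meshH k (z, x))))%E.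
    by apply: integral_ge0 => z _; rewrite mule_ge0 ?energy_ge0// lee_fin.
  rewrite -(fineK finI) -EFinM lee_fin mulrC -ler_pdivlMr//.
  have : `|0 - fine (\int[mu]_z ((`|f z|)%:E * E (fun x => meshH k (z, x))))%E| <= eta / m `^ (q - 1).
    by near: k.
  by rewrite sub0r normrN ger0_norm ?fine_ge0.
(* On the scalar side, [shifted phi] is bounded and continuous along the mesh, and [f] is
   integrable. *)
have c2 : l (Gk k) @[k --> \oo] --> \int[mu]_z (shifted phi z * f z).
  under eq_fun do rewrite (GkE _).2.
  have [M hM] := shifted_bounded.
  have ms := measurable_shifted.
  have mk k : measurable_fun setT (fun z => (shifted phi (mesh k z) * f z)%:E).
    apply/measurable_EFinP; apply: measurable_funM => //.
    exact: (measurable_mesh_comp k (shifted phi)).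
  have ml : measurable_fun setT (fun z => (shifted phi z * f z)%:E).
    by apply/measurable_EFinP; exact: measurable_funM.
  have cz : {ae mu, forall z, setT z ->
      ((shifted phi (mesh k z) * f z)%:E @[k --> \oo] --> (shifted phi z * f z)%:E)%E}.
    apply/nearW => z _; apply: cvg_EFin; first exact: nearW.
    by apply: cvgM; [exact: shifted_cvg_mesh|exact: cvg_cst].
  have ig : mu.-integrable setT (fun z => (M * `|f z|)%:E).
    under eq_fun do rewrite EFinM; apply: integrableZl => //.
    apply/integrableP; split => //.
    by under eq_integral do rewrite gee0_abs ?lee_fin//.
  have dom : {ae mu, forall z k, setT z -> (`|(shifted phi (mesh k z) * f z)%:E| <= (M * `|f z|)%:E)%E}.
    apply/nearW => z k _; rewrite lee_fin normrM ler_wpM2r//.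
  have [_ _ H] := dominated_convergence measurableT mk ml cz ig dom.
  have fin : (\int[mu]_z (shifted phi z * f z)%:E \is a fin_num)%E.
    by apply: integrable_fin_num => //; exact: (@integrable_bounded_mul _ _ _ mu _ f M).
  by move: H; rewrite -[X in _ --> X](fineK fin) => /fine_cvg.
by have := cvg_unique _ c1 c2; apply.
Unshelve. all: by end_near. Qed.

End translatable_theory.

End functional.

(** * The heat flow of a distribution in a negative Sobolev space *)

Section reflected_integrals.
Context {R : realType} {n : nat}.
Local Notation mu := (@lebesgue_rV R n).

Lemma measurable_reflect (f : 'rV[R]_n -> R) (x : 'rV[R]_n) : measurable_fun setT f ->
  measurable_fun setT (fun z : 'rV[R]_n => f (x - z)).
Proof.
move=> mf; apply: (measurableT_comp mf).
under eq_fun do rewrite addrC.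
exact: (measurableT_comp (measurable_addrV x) (@measurable_opprV R n)).
Qed.

Lemma Rintegral_reflect (x : 'rV[R]_n) (f : 'rV[R]_n -> R) : measurable_fun setT f ->
  \int[mu]_z f (x - z) = \int[mu]_z f z.
Proof.
move=> mf; have mEf : measurable_fun setT (EFin \o f) by exact/measurable_EFinP.
have mP := measurable_funepos mEf; have mN := measurable_funeneg mEf.
rewrite /Rintegral; congr fine; rewrite integralE [RHS]integralE; congr (_ - _)%E.
  apply: etrans (ge0_integral_reflect x mP (fun z => funepos_ge0 _ z)).
  by apply: eq_integral => z _; rewrite !funeposE.
apply: etrans (ge0_integral_reflect x mN (fun z => funeneg_ge0 _ z)).
by apply: eq_integral => z _; rewrite !funenegE.
Qed.

Lemma integral_heat_kernel_norm t x : 0 < t ->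
  (\int[mu]_z (`|heat_kernel t (x - z)|)%:E = 1)%E.
Proof.
move=> t0; rewrite -(integral_heat_kernel (n := n) t0).
have mh : measurable_fun setT (fun z => (@heat_kernel R n t z)%:E).
  by apply/measurable_EFinP; exact: measurable_heat_kernel.
rewrite -(ge0_integral_reflect x mh); last by move=> z; rewrite lee_fin heat_kernel_ge0.
by apply: eq_integral => z _; rewrite ger0_norm// heat_kernel_ge0.
Qed.

Lemma integral_heat_kernel_norm0 t : 0 < t ->
  (\int[mu]_z (`|heat_kernel t z|)%:E = 1)%E.
Proof.
move=> t0; rewrite -(integral_heat_kernel (n := n) t0).
by apply: eq_integral => z _; rewrite ger0_norm// heat_kernel_ge0.
Qed.

Lemma heat_kernel_Rconv s t (x y : 'rV[R]_n) : 0 < s -> 0 < t ->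
  \int[mu]_z (heat_kernel s (y - z) * heat_kernel t (x - z)) = heat_kernel (s + t) (y - x).
Proof.
move=> s0 t0; rewrite -(Rintegral_reflect x); last first.
  by apply: measurable_funM; apply: measurable_reflect; exact: measurable_heat_kernel.
have mF : measurable_fun setT (fun z : 'rV[R]_n => (heat_kernel s (y - x - z) * heat_kernel t z)%:E).
  apply/measurable_EFinP; apply: measurable_funM; last exact: measurable_heat_kernel.
  by apply: measurable_reflect; exact: measurable_heat_kernel.
have F0 (z : 'rV[R]_n) : (0 <= (heat_kernel s (y - x - z) * heat_kernel t z)%:E)%E.
  by rewrite lee_fin mulr_ge0// heat_kernel_ge0.
have E : (\int[mu]_z (heat_kernel s (y - (x - z)) * heat_kernel t (x - (x - z)))%:E =
    (heat_kernel (s + t) (y - x))%:E)%E.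
  apply: etrans (heat_kernel_conv (y - x) s0 t0).
  apply: etrans (ge0_integralN mF F0).
  apply: eq_integral => z _.
  by rewrite !opprB opprK heat_kernelN addrA addrAC (addrCA x) subrr addr0.
by rewrite /Rintegral E.
Qed.

Lemma integrable_heat t (h : 'rV[R]_n -> R) (M : R) : 0 < t ->
  measurable_fun setT h -> (forall x, `|h x| <= M) ->
  mu.-integrable setT (fun z => (h z * heat_kernel t z)%:E).
Proof.
move=> t0 mh hM; apply: (@integrable_bounded_mul _ _ _ mu _ _ M) => //.
  exact: measurable_heat_kernel.
by rewrite integral_heat_kernel_norm0// ltry.
Qed.

Lemma heat_average_diff t (v : 'rV[R]_n -> R) (M : R) x : 0 < t ->
  measurable_fun setT v -> (forall x, `|v x| <= M) ->
  v x - \int[mu]_z (v (x - z) * heat_kernel t z) =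
  \int[mu]_z ((v x - v (x - z)) * heat_kernel t z).
Proof.
move=> t0 mv vM.
have i1 : mu.-integrable setT (fun z => (v x * heat_kernel t z)%:E).
  exact: (integrable_heat t0 (measurable_cst _) (fun _ => vM x)).
have i2 : mu.-integrable setT (fun z => (v (x - z) * heat_kernel t z)%:E).
  exact: (integrable_heat t0 (measurable_reflect x mv) (fun z => vM (x - z))).
have i3 : mu.-integrable setT (fun z => (@heat_kernel R n t z)%:E).
  have := @integrable_heat t (cst 1) 1 t0 (measurable_cst _) (fun _ => ltac:(by rewrite normr1)).
  by under eq_fun do rewrite mul1r.
have -> : v x = \int[mu]_z (v x * heat_kernel t z).
  by rewrite (RintegralZl _ measurableT i3) /Rintegral integral_heat_kernel//= mulr1.
rewrite -(RintegralB measurableT i1 i2); apply: eq_Rintegral => z _.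
rewrite (RintegralZl _ measurableT i3) /Rintegral integral_heat_kernel//= mulr1.
by rewrite mulrBl.
Qed.

(* Young's inequality for the convolution with a probability density. *)
Lemma heat_contraction (p M t : R) (v : 'rV[R]_n -> R) : 1 < p -> 0 < t ->
  measurable_fun setT v -> (forall x, `|v x| <= M) ->
  (\int[mu]_x (`|\int[mu]_z (v (x - z) * heat_kernel t z)| `^ p)%:E <=
   \int[mu]_x (`|v x| `^ p)%:E)%E.
Proof.
move=> p1 t0 mv vM; have mh := @measurable_heat_kernel R n t.
pose H (w : 'rV[R]_n * 'rV[R]_n) := v (w.2 - w.1).
have mH : measurable_fun setT H by exact: (measurableT_comp mv measurable_subrV).
have h1 : (\int[mu]_z (`|heat_kernel t z|)%:E <= 1%:E)%E by rewrite integral_heat_kernel_norm0.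
have ih x : mu.-integrable setT (fun z => (H (z, x) * heat_kernel t z)%:E).
  apply: (@integrable_bounded_mul _ _ _ mu _ _ M) => //.
  - exact: measurable_reflect.
  - by move=> z; exact: vM.
  - by rewrite integral_heat_kernel_norm0// ltry.
have := @minkowski_integral _ _ _ _ R mu mu p 1 H (heat_kernel t) (cst 1)
  (fun x => \int[mu]_z (v (x - z) * heat_kernel t z)) p1 ltr01 mH mh (measurable_cst _)
  (fun _ => ler01) h1 (fun x => normr_Rintegral_le (ih x)).
rewrite powR1 mul1e /cst/=.
under eq_integral do rewrite mulr1.
under [X in (_ <= X -> _)%E]eq_integral => z _.
  under eq_integral do rewrite mulr1.
  have mvp : measurable_fun setT (fun x => (`|v x| `^ p)%:E).
    apply/measurable_EFinP; apply: (measurableT_comp (measurable_powR _)).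
    exact: measurableT_comp.
  rewrite (ge0_integral_shift (- z) mvp); last by move=> x; rewrite lee_fin powR_ge0.
  over.
move=> /le_trans; apply.
rewrite ge0_integralZr//; last 2 first.
- by apply/measurable_EFinP; exact: measurableT_comp.
- by apply: integral_ge0 => x _; rewrite lee_fin powR_ge0.
by rewrite integral_heat_kernel_norm0// mul1e.
Qed.

End reflected_integrals.

Section heat_flow.
Context {R : realType} {n : nat} (n0 : (0 < n)%N) (p alpha : R) (p1 : 1 < p)
        (a01 : 0 < alpha < 1) (T : tempered R n) (hT : neg_sobolev alpha p T).
Local Notation mu := (@lebesgue_rV R n).
Local Notation u t := (convolution T (heat n t)).

Let q := (1 - p^-1)^-1.

Let q1 : 1 < q.
Proof.
have p0 : 0 < p by exact: lt_trans p1.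
by rewrite invf_gt1 ?subr_gt0 ?invf_lt1// gtrBl invr_gt0.
Qed.

Let heat_translatable t : 0 < t -> translatable alpha q (@heat_kernel R n t).
Proof.
move=> t0; have := @heat_kernel_in_schwartz R n t t0; rewrite inE/= => -[h1 h2].
exact: schwartz_translatable.
Qed.

(** Evenness of the heat kernel turns the reflected argument x - y of the convolution into the
    translate y - x. *)
Let uE (l : ('rV[R]_n -> R) -> R) t x : (forall phi : schwartz R n, T phi = l phi) -> 0 < t ->
  u t x = shifted l (heat_kernel t) x.
Proof.
move=> Tl t0; rewrite /convolution Tl /shifted; congr l; apply/funext => y /=.
by rewrite heatE// -heat_kernelN opprB.
Qed.

Lemma heat_flow_bounded t : 0 < t -> exists M, forall x, `|u t x| <= M.
Proof.
move=> t0; have [l hl Tl] := hT.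
have [M hM] := shifted_bounded q1 hl (heat_translatable t0).
by exists M => x; rewrite (uE _ Tl).
Qed.

Lemma measurable_heat_flow t : 0 < t -> measurable_fun setT (u t).
Proof.
move=> t0; have [l hl Tl] := hT.
have := measurable_shifted q1 hl (heat_translatable t0).
by congr measurable_fun; apply/funext => x; rewrite (uE _ Tl).
Qed.

Lemma heat_flow_ucontinuous t (eps : R) : 0 < t -> 0 < eps ->
  exists2 delta : R, 0 < delta &
  forall z w, enorm (w - z) < delta -> `|u t z - u t w| <= eps.
Proof.
move=> t0 e0; have [l hl Tl] := hT.
have [d d0 hd] := shifted_ucontinuous q1 hl (heat_translatable t0) e0.
by exists d => // z w zw; rewrite !(uE _ Tl)//; exact: hd.
Qed.

(** [functional_convolve] for the kernel at time s, against the integrable function z -> Phi_t(x -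
    z). The function inside [l] is then a translate of the kernel at time s + t. *)
Lemma heat_flow_semigroup s t x : 0 < s -> 0 < t ->
  u (s + t) x = \int[mu]_z (u s (x - z) * heat_kernel t z).
Proof.
move=> s0 t0; have [l hl Tl] := hT.
have mh : measurable_fun setT (fun z : 'rV[R]_n => heat_kernel t (x - z)).
  by apply: measurable_reflect; exact: measurable_heat_kernel.
have fi : (\int[mu]_z (`|heat_kernel t (x - z)|)%:E < +oo)%E.
  by rewrite integral_heat_kernel_norm// ltry.
have E := functional_convolve q1 hl (heat_translatable s0) mh fi.
apply: (etrans (uE x Tl (addr_gt0 s0 t0))).
have -> : shifted l (heat_kernel (s + t)) x =
    l (fun y : 'rV[R]_n => \int[mu]_z (heat_kernel s (y - z) * heat_kernel t (x - z))).
  by rewrite /shifted; congr l; apply/funext => y; rewrite heat_kernel_Rconv.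
apply: (etrans E).
have mU : measurable_fun setT (fun z => shifted l (heat_kernel s) z * heat_kernel t (x - z)).
  apply: measurable_funM; last exact: mh.
  have ms := measurable_shifted q1 hl (heat_translatable s0); exact: ms.
apply: (etrans (esym (Rintegral_reflect x mU))).
by apply: eq_Rintegral => z _; rewrite (uE _ Tl s0) opprB addrCA subrr addr0.
Qed.

(* The modulus of continuity of [u r] is inherited from the Sobolev functional,
   hence the convergence is uniform in space. *)
Lemma heat_flow_cvg_uniform r (eps : R) : 0 < r -> 0 < eps ->
  exists2 t0 : R, 0 < t0 &
  forall t x, 0 < t < t0 -> `|u r x - u (r + t) x| <= eps.
Proof.
move=> r0 e0; have [M hM] := heat_flow_bounded r0.
have M0 : 0 <= M by exact: le_trans (hM 0).
have e20 : 0 < eps / 2 by rewrite divr_gt0.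
have [d d0 hd] := heat_flow_ucontinuous r0 e20.
(* A crude modulus: far increments are bounded by 2 M, while those below distance d are covered by
   the separate term eps / 2. *)
pose e (z : 'rV[R]_n) : R := if enorm z < d then 0 else M + M.
have e0' z : 0 <= e z by rewrite /e; case: ifP => // _; exact: addr_ge0.
have me : measurable_fun setT e.
  apply: measurable_fun_if => //.
  by apply: measurable_fun_ltr => //; exact: measurable_enorm.
have mEe : measurable_fun setT (EFin \o e) by exact/measurable_EFinP.
have eB z : (0 <= (EFin \o e) z <= (M + M)%:E)%E.
  by rewrite /= !lee_fin e0'/= /e; case: ifP => // _; exact: addr_ge0.
have [|t0 t00 ht0] := heat_approx_identity mEe eB _ e20.
  by move=> eps' e'0; exists d => // z zd; rewrite /= /e zd lee_fin ltW.
exists t0 => // t x tt0; have /andP[t_gt0 _] := tt0.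
have mu_r := measurable_heat_flow r0.
rewrite heat_flow_semigroup// (heat_average_diff x t_gt0 mu_r hM).
have HB z : `|u r x - u r (x - z)| <= M + M by rewrite (le_trans (ler_normB _ _))// lerD.
have mD : measurable_fun setT (fun z : 'rV[R]_n => u r x - u r (x - z)).
  by apply: measurable_funB => //; exact: measurable_reflect.
rewrite -lee_fin (le_trans (normr_Rintegral_le (integrable_heat t_gt0 mD HB)))//.
apply: (@le_trans _ _ (\int[mu]_z (((eps / 2)%:E * (heat_kernel t z)%:E) +
    (EFin \o e) z * (heat_kernel t z)%:E))%E).
  apply: ge0_le_integralT => z; first by rewrite lee_fin mulr_ge0.
  rewrite -EFinM -EFinM -EFinD lee_fin (ger0_norm (heat_kernel_ge0 _ _)) -mulrDl.
  rewrite ler_wpM2r ?heat_kernel_ge0// /e; case: ifPn => [zd|_].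
    by rewrite addr0; apply: hd; rewrite addrAC subrr sub0r enormN.
  by rewrite (le_trans (HB z))// lerDr ltW.
have mh : measurable_fun setT (fun z => (@heat_kernel R n t z)%:E).
  by apply/measurable_EFinP; exact: measurable_heat_kernel.
rewrite ge0_integralD//; last 4 first.
- by move=> z _; rewrite mule_ge0// lee_fin ?heat_kernel_ge0// ltW.
- exact: emeasurable_funM.
- by move=> z _; rewrite mule_ge0// lee_fin ?heat_kernel_ge0//.
- exact: emeasurable_funM.
rewrite ge0_integralZl_EFin//; last 2 first.
- by move=> z _; rewrite lee_fin heat_kernel_ge0.
- exact: ltW.
rewrite integral_heat_kernel// mule1 (splitr eps) EFinD; apply: leeD => //.
  by rewrite -splitr.
exact: ht0.
Qed.

(** Exchanging [l] with the integral against [phi] gives l(phi * Phi_t). The energy of phi - phi *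
    Phi_t is at most the average against Phi_t of the energies of phi - phi(. - z), which tend to 0
    with z. *)
Lemma heat_flow_pairing (phi : schwartz R n) (eps : R) : 0 < eps ->
  exists2 t0 : R, 0 < t0 & forall t, 0 < t < t0 ->
  `|T phi - \int[mu]_z (u t z * phi z)| <= eps.
Proof.
move=> eps0; have [l hl Tl] := hT.
have := schwartz_funP phi; rewrite inE/= => -[sphi rphi].
have tphi : translatable alpha q phi by exact: schwartz_translatable.
have [mphi [B hB] Ephi _] := tphi.
have Efin : energy alpha q phi \is a fin_num by rewrite ge0_fin_numE ?energy_ge0.
have [eta eta0 heta] := functional_small q1 hl eps0.
pose H (w : 'rV[R]_n * 'rV[R]_n) := phi w.2 - phi (w.2 - w.1).
have mH : measurable_fun setT H.
  apply: measurable_funB; first exact: (measurableT_comp mphi measurable_snd).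
  exact: (measurableT_comp mphi measurable_subrV).
have HB w : `|H w| <= B + B by rewrite (le_trans (ler_normB _ _))// lerD.
have cfin : ((2 `^ q * 2)%:E * energy alpha q phi)%E \is a fin_num by rewrite fin_numM.
have eB z : (0 <= energy alpha q (fun x => H (z, x)) <=
    (fine ((2 `^ q * 2)%:E * energy alpha q phi))%:E)%E.
  by rewrite energy_ge0/= fineK//; exact: energyB_le.
have [|t0 t00 ht0] := heat_approx_identity (measurable_energy alpha q mH) eB _ eta0.
  by case: tphi => _ _ _ + e e0 => /(_ e e0)[d d0 hd]; exists d.
exists t0 => // t tt0; have /andP[t_gt0 _] := tt0.
have mh := @measurable_heat_kernel R n t.
have fi : (\int[mu]_z (`|phi z|)%:E < +oo)%E.
  have [C C0 [hC _]] := schwartz_decay sphi rphi.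
  apply: (@le_lt_trans _ _ (\int[mu]_z (C%:E * (weight z)%:E))%E).
    by apply: ge0_le_integralT => z; rewrite lee_fin.
  rewrite ge0_integralZl_EFin//; last 2 first.
  - by move=> z _; rewrite lee_fin ltW// weight_gt0.
  - by apply/measurable_EFinP; exact: measurable_weight.
  by rewrite lte_mul_pinfty// integral_weight_lty.
have hfi : (\int[mu]_z (`|@heat_kernel R n t z|)%:E < +oo)%E.
  by rewrite integral_heat_kernel_norm0// ltry.
pose G (x : 'rV[R]_n) := \int[mu]_z (phi (x - z) * heat_kernel t z).
have -> : \int[mu]_z (u t z * phi z) = l G.
  under eq_Rintegral do rewrite (uE _ Tl)//.
  rewrite -(functional_convolve q1 hl (heat_translatable t_gt0) mphi fi); congr l.
  apply/funext => x; rewrite /G -(Rintegral_reflect x).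
    by apply: eq_Rintegral => z _; rewrite opprB addrCA subrr addr0 mulrC.
  by apply: measurable_funM => //; exact: measurable_reflect.
have SG := sobolev_convolve q1 tphi mh hfi.
have Sphi : sobolev alpha q phi by exact: sobolevP.
rewrite Tl -(functionalB hl Sphi SG); apply: heta; first exact: (sobolevB q1).
rewrite (_ : (fun x => _) = (fun x => \int[mu]_z (H (z, x) * heat_kernel t z))); last first.
  by apply/funext => x; rewrite (heat_average_diff x t_gt0 mphi hB).
have h1 : (\int[mu]_z (`|@heat_kernel R n t z|)%:E <= 1%:E)%E by rewrite integral_heat_kernel_norm0.
have := energy_Rintegral alpha q1 ltr01 mH HB mh h1.
rewrite powR1 mul1e => /le_trans; apply; apply: le_trans (ht0 t tt0).
by apply: ge0_le_integralT => z; rewrite ?mule_ge0 ?energy_ge0 ?lee_fin// muleC ger0_norm ?heat_kernel_ge0.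
Qed.

End heat_flow.

(** * Completeness of L^p *)

Section Lp_completeness.
Context d (Tt : measurableType d) (R : realType) (mu : {measure set Tt -> \bar R}).
Local Open Scope ereal_scope.

Lemma limn_einf_le (f : nat -> \bar R) (c : \bar R) : (forall k, f k <= c) -> limn_einf f <= c.
Proof.
move=> fc; rewrite limn_einf_lim; apply: lime_le; first exact: is_cvg_einfs.
apply: nearW => k; apply: le_trans (fc k).
by apply: ereal_inf_lbound; exists k => /=.
Qed.

Lemma fatou_le (f : nat -> Tt -> \bar R) (g : Tt -> \bar R) (c : \bar R) :
  (forall k, measurable_fun setT (f k)) -> (forall k x, 0 <= f k x) ->
  (forall x, f k x @[k --> \oo] --> g x) ->
  (forall k, \int[mu]_x f k x <= c) -> \int[mu]_x g x <= c.
Proof.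
move=> mf f0 fg fc.
have gE x : g x = limn_einf (f ^~ x) by have [-> _] := cvg_limn_einf_sup (fg x).
under eq_integral do rewrite gE.
apply: (le_trans (fatou mu measurableT mf (fun k x _ => f0 k x))).
exact: limn_einf_le.
Qed.

Local Close Scope ereal_scope.

Lemma cvg_powR_norm (p : R) (a : nat -> R) (b : R) : 0 < p ->
  a k @[k --> \oo] --> b -> `|a k| `^ p @[k --> \oo] --> `|b| `^ p.
Proof.
move=> p0 ab; have nab : `|a k| @[k --> \oo] --> `|b| by exact: cvg_norm.
have [b0|b0] := eqVneq b 0.
  rewrite b0 normr0 powR0 ?gt_eqF//; apply/cvgrPdist_le => e e0.
  have e1 : 0 < e `^ p^-1 by rewrite powR_gt0.
  have /cvgrPdist_le/(_ _ e1) := nab; rewrite b0 normr0.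
  apply: filterS => k; rewrite !sub0r !normrN normr_id (ger0_norm (powR_ge0 _ _)) => h.
  rewrite -[leRHS]powRr1 ?(ltW e0)// -(@mulVf _ p) ?gt_eqF// powRrM.
  by apply: ge0_ler_powR; rewrite ?nnegrE ?powR_ge0// ltW.
have nb : 0 < `|b| by rewrite normr_gt0.
have cp := @powR_continuous_pos R p _ nb.
exact: (continuous_cvg _ cp nab).
Qed.

Section limit.
Context (p : R) (p0 : 0 < p) (v : nat -> Tt -> R).
Context (mv : forall k, measurable_fun setT (v k)).
Context (cv : forall eps : R, 0 < eps -> exists K, forall j k, (K <= j)%N -> (K <= k)%N ->
  (\int[mu]_x (`|v j x - v k x| `^ p)%:E <= eps%:E)%E).

Let mpow (g : Tt -> R) : measurable_fun setT g -> measurable_fun setT (fun x => (`|g x| `^ p)%:E).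
Proof.
move=> mg; apply/measurable_EFinP; apply: (measurableT_comp (measurable_powR _)).
exact: measurableT_comp.
Qed.

Let pow_ge0 (r : R) : (0 <= (`|r| `^ p)%:E)%E.
Proof. by rewrite lee_fin powR_ge0. Qed.

(** The factor 2^j is inserted so that finiteness at a point of the sum of these p-th powers already
    forces geometric decay of the increments there; no triangle inequality in L^p is needed. *)
Let subsequence : exists kk : nat -> nat, (forall j, j <= kk j)%N /\
  forall j, (\int[mu]_x (`|2 ^+ j * (v (kk j.+1) x - v (kk j) x)| `^ p)%:E <=
             (1 / (2 ^ j.+1)%:R)%:E)%E.
Proof.
pose eps j : R := (2 ^+ j) `^ (- p) / (2 ^ j.+1)%:R.
have eps0 j : 0 < eps j by rewrite divr_gt0 ?powR_gt0// ?exprn_gt0// ltr0n expn_gt0.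
have [K hK] := choice (fun j => cv (eps0 j)).
(* The partial sums make [kk j] and [kk j.+1] both at least [K j], and the summand j gives [kk j] >=
   j. *)
pose kk j := (j + \sum_(i < j.+1) K i)%N.
have Kk j : (K j <= kk j)%N by rewrite /kk big_ord_recr/= addnA leq_addl.
have Kk1 j : (K j <= kk j.+1)%N.
  rewrite (leq_trans (Kk j))// /kk [in leqRHS]big_ord_recr/= leq_add//.
  exact: leq_addr.
exists kk; split => [j|j]; first exact: leq_addr.
have -> : (\int[mu]_x (`|2 ^+ j * (v (kk j.+1) x - v (kk j) x)| `^ p)%:E =
    ((2 ^+ j) `^ p)%:E * \int[mu]_x (`|v (kk j.+1) x - v (kk j) x| `^ p)%:E)%E.
  rewrite -ge0_integralZl_EFin ?powR_ge0//.
    by apply: eq_integral => x _; rewrite -EFinM normrM powRM// ger0_norm// exprn_ge0.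
  by apply: mpow; exact: measurable_funB.
apply: (@le_trans _ _ (((2 ^+ j) `^ p)%:E * (eps j)%:E)%E).
  by rewrite lee_wpmul2l ?lee_fin ?powR_ge0//; exact: hK.
rewrite -EFinM lee_fin /eps mulrA -powRD; last first.
  by rewrite (expf_eq0 2) pnatr_eq0 andbF implybT.
by rewrite addrN powRr0.
Qed.

Lemma Lp_cauchy_limit : exists Y : Tt -> R, [/\ measurable_fun setT Y,
  forall eps : R, 0 < eps -> exists K, forall k, (K <= k)%N ->
    (\int[mu]_x (`|v k x - Y x| `^ p)%:E <= eps%:E)%E &
  forall c, (forall k, \int[mu]_x (`|v k x| `^ p)%:E <= c)%E ->
    (\int[mu]_x (`|Y x| `^ p)%:E <= c)%E].
Proof.
have [kk [kkj hkk]] := subsequence.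
pose D j x := (`|2 ^+ j * (v (kk j.+1) x - v (kk j) x)| `^ p)%:E.
have mD j : measurable_fun setT (D j).
  by apply: mpow; apply: measurable_funM => //; exact: measurable_funB.
have D0 j x : (0 <= D j x)%E by exact: pow_ge0.
pose S x := (\sum_(j <oo) D j x)%E.
have mS : measurable_fun setT S by exact: ge0_emeasurable_sum.
have S0 x : (0 <= S x)%E by exact: nneseries_ge0.
have IS : (\int[mu]_x S x < +oo)%E.
  rewrite /S (integral_nneseries mu measurableT mD (fun j x _ => D0 j x)).
  apply: (@le_lt_trans _ _ 1%:E); last exact: ltry.
  apply: le_trans (epsilon_trick0 xpredT (ler01 : 0 <= 1 :> R)).
  apply: lee_nneseries => j *; first exact: integral_ge0.
  have := hkk j; rewrite /D; exact.
have iS : mu.-integrable setT S.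
  apply/integrableP; split => //.
  by under eq_integral do rewrite gee0_abs//.
(* Replacing the values by 0 on the null set where S is infinite makes the sequence converge at
   every point. *)
pose w j x := if (S x < +oo)%E then v (kk j) x else 0.
have mw j : measurable_fun setT (w j).
  by apply: measurable_fun_if => //; [exact: measurable_fun_lte|exact: measurable_funTS].
have cw x : cvgn (w ^~ x).
  rewrite /w; have [Sx|_] := boolP (S x < +oo)%E; last exact: is_cvg_cst.
  pose a j := v (kk j) x.
  have -> : (fun j => v (kk j) x) = (fun j => a 0%N + series (telescope a) j).
    by apply/funext => j; rewrite -eq_sum_telescope.
  apply: is_cvgD; first exact: is_cvg_cst.
  apply: normed_cvg.
  apply: (@series_le_cvg _ _ (geometric (fine (S x) `^ p^-1) 2^-1)).
  - by move=> j; exact: normr_ge0.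
  - by move=> j; rewrite mulr_ge0 ?powR_ge0// exprn_ge0// invr_ge0.
  - move=> j; rewrite /geometric/= exprVn ler_pdivlMr ?exprn_gt0//.
    have : (D j x <= S x)%E.
      apply: (@le_trans _ _ (\sum_(0 <= i < j.+1) D i x)%E).
        by rewrite big_nat_recr//= leeDr// sume_ge0.
      exact: nneseries_lim_ge.
    have Sfin : S x \is a fin_num by rewrite ge0_fin_numE.
    have fS0 : 0 <= fine (S x) by exact: fine_ge0.
    rewrite -(fineK Sfin) lee_fin normrM ger0_norm ?exprn_ge0// => h.
    rewrite mulrC -[leLHS](@powRr1 R)// -[X in _ `^ X](@mulfV _ p) ?gt_eqF// powRrM.
    apply: ge0_ler_powR => //; rewrite ?nnegrE ?powR_ge0 ?fine_ge0//.
    by rewrite invr_ge0 ltW.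
  - by apply: is_cvg_geometric_series; rewrite ger0_norm// invf_lt1// ltr1n.
pose Y x := limn (w ^~ x).
have wY x : w j x @[j --> \oo] --> Y x by exact: cw.
have mY : measurable_fun setT Y by exact: measurable_fun_cvg mw (fun x _ => wY x).
have wv j (g : Tt -> R) : measurable_fun setT g ->
   (\int[mu]_x (`|g x - w j x| `^ p)%:E = \int[mu]_x (`|g x - v (kk j) x| `^ p)%:E)%E.
  move=> mg; apply: ae_eq_integral => //.
  - by apply: mpow; exact: measurable_funB.
  - by apply: mpow; exact: measurable_funB.
  have := integrable_ae measurableT iS; apply: filterS => x /(_ I) Sx _.
  by rewrite /w -ge0_fin_numE// Sx.
have cpow (g : Tt -> R) x : (`|g x - w j x| `^ p)%:E @[j --> \oo] --> (`|g x - Y x| `^ p)%:E.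
  apply: cvg_EFin; first exact: nearW.
  apply: (@cvg_powR_norm p (fun j => g x - w j x)) => //.
  by apply: cvgB; [exact: cvg_cst|exact: wY].
exists Y; split => //.
  move=> eps eps0; have [K hK] := cv eps0; exists K => k Kk.
  (* Shifting the sequence by K makes every index [kk (j + K)] at least K, where the Cauchy estimate
     holds. *)
  apply: (@fatou_le (fun j x => (`|v k x - w (j + K)%N x| `^ p)%:E)) => //.
  - by move=> j; apply: mpow; exact: measurable_funB.
  - by move=> x; have := cpow (v k) x; rewrite -(cvg_shiftn K).
  - move=> j; rewrite wv//; apply: hK => //.
    by rewrite (leq_trans _ (kkj _))// leq_addl.
move=> c hc; apply: (@fatou_le (fun j x => (`|w j x| `^ p)%:E)) => //.
- by move=> j; exact: mpow.
- move=> x; have := cpow (cst 0) x.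
  by rewrite /cst sub0r normrN; under eq_fun do rewrite sub0r normrN.
- move=> j; have := wv j (cst 0) (measurable_cst _).
  rewrite /cst; under eq_integral do rewrite sub0r normrN.
  under [X in _ = X -> _]eq_integral do rewrite sub0r normrN.
  by move=> ->.
Qed.

End limit.
End Lp_completeness.

(** * The limit of the heat flow at time zero *)

Section pairing.
Context d (Tt : measurableType d) (R : realType) (mu : {sigma_finite_measure set Tt -> \bar R}).

Lemma le_poweR_root (p : R) (x : \bar R) (c : R) : 0 < p -> 0 <= c -> (0 <= x)%E ->
  (x `^ p <= c%:E)%E -> (x <= (c `^ p^-1)%:E)%E.
Proof.
move=> p0 c0 x0 xc; rewrite -[x]poweRe1// -(@mulfV _ p) ?gt_eqF// poweRrM -poweR_EFin.
apply: gt0_ler_poweR => //; first by rewrite invr_ge0 ltW.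
- by rewrite in_itv/= leey poweR_ge0.
- by rewrite in_itv/= leey lee_fin c0.
Qed.

(** Jensen's inequality with density |phi| takes the place of Hölder's: [phi] is integrable, and
    bounded by [B]. *)
Lemma Rintegral_Lp_close (p m B eps : R) (g h phi : Tt -> R) : 1 < p -> 0 < m -> 0 <= B ->
  0 <= eps ->
  measurable_fun setT g -> measurable_fun setT h -> measurable_fun setT phi ->
  (forall x, `|phi x| <= B) -> (\int[mu]_x (`|phi x|)%:E <= m%:E)%E ->
  (\int[mu]_x (`|g x - h x| `^ p)%:E <= eps%:E)%E ->
  mu.-integrable setT (fun x => (g x * phi x)%:E) ->
  mu.-integrable setT (fun x => (h x * phi x)%:E) /\
  `|\int[mu]_x (g x * phi x) - \int[mu]_x (h x * phi x)| <=
    (m `^ (p - 1) * (B * eps)) `^ p^-1.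
Proof.
move=> p1 m0 B0 e0 mg mh mphi hB hm gh ig; have p0 : 0 < p by exact: lt_trans p1.
have mD : measurable_fun setT (fun x => g x - h x) by exact: measurable_funB.
have mnD : measurable_fun setT (fun x => `|g x - h x|) by exact: measurableT_comp.
have mnphi : measurable_fun setT (fun x => `|phi x|) by exact: measurableT_comp.
have mpD : measurable_fun setT (fun x => (`|g x - h x| `^ p)%:E).
  by apply/measurable_EFinP; exact: (measurableT_comp (measurable_powR _)).
have I1 : (\int[mu]_x (`|g x - h x| * `|phi x|)%:E <= ((m `^ (p - 1) * (B * eps)) `^ p^-1)%:E)%E.
  apply: le_poweR_root => //.
  - by rewrite mulr_ge0 ?powR_ge0// mulr_ge0.
  - by apply: integral_ge0 => x _; rewrite lee_fin mulr_ge0.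
  have := @jensen_powR _ _ R mu p m (fun x => `|phi x|) (fun x => `|g x - h x|) p1 m0 mnphi mnD
    (fun x => normr_ge0 _) (fun x => normr_ge0 _) hm.
  move=> /le_trans; apply; rewrite EFinM lee_wpmul2l ?lee_fin ?powR_ge0//.
  apply: (@le_trans _ _ (\int[mu]_x (B%:E * (`|g x - h x| `^ p)%:E))%E).
    apply: ge0_le_integralT => x; first by rewrite lee_fin mulr_ge0 ?powR_ge0.
    by rewrite -EFinM lee_fin mulrC ler_wpM2r ?powR_ge0.
  rewrite ge0_integralZl_EFin//; by rewrite EFinM lee_wpmul2l ?lee_fin.
have iD : mu.-integrable setT (fun x => ((g x - h x) * phi x)%:E).
  apply/integrableP; split; first by apply/measurable_EFinP; exact: measurable_funM.
  apply: le_lt_trans (ltry ((m `^ (p - 1) * (B * eps)) `^ p^-1)).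
  apply: le_trans I1.
  by apply: ge0_le_integralT => x; [exact: abse_ge0|rewrite lee_fin normrM].
have ih : mu.-integrable setT (fun x => (h x * phi x)%:E).
  have -> : (fun x => (h x * phi x)%:E) =
      (fun x => ((g x * phi x)%:E - ((g x - h x) * phi x)%:E)%E).
    by apply/funext => x; rewrite -EFinB -mulrBl opprB addrCA subrr addr0.
  exact: integrableB.
split => //; rewrite -(RintegralB measurableT ig ih).
under eq_Rintegral do rewrite -mulrBl.
by rewrite -lee_fin (le_trans (normr_Rintegral_le iD)).
Qed.

End pairing.

(** * Bounded heat evolutions: contraction, Cauchy property and initial value *)

Section heat_evolution.
Context {R : realType} {n : nat} (p : R) (p1 : 1 < p).
Local Notation mu := (@lebesgue_rV R n).
Context (u : R -> 'rV[R]_n -> R)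
  (mu_ : forall t, 0 < t -> measurable_fun setT (u t))
  (bu : forall t, 0 < t -> exists M, forall x, `|u t x| <= M)
  (su : forall s t x, 0 < s -> 0 < t ->
     u (s + t) x = \int[mu]_z (u s (x - z) * heat_kernel t z))
  (cu : forall r (eps : R), 0 < r -> 0 < eps -> exists2 t0 : R, 0 < t0 &
     forall t x, 0 < t < t0 -> `|u r x - u (r + t) x| <= eps).

Let p0 : 0 < p. Proof. exact: lt_trans p1. Qed.

Let mpow (g : 'rV[R]_n -> R) : measurable_fun setT g -> measurable_fun setT (fun x => (`|g x| `^ p)%:E).
Proof.
move=> mg; apply/measurable_EFinP; apply: (measurableT_comp (measurable_powR _)).
exact: measurableT_comp.
Qed.

Let pow_ge0 (r : R) : (0 <= (`|r| `^ p)%:E)%E.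
Proof. by rewrite lee_fin powR_ge0. Qed.

(** By linearity of the convolution, the average at times s + r and t + r is the average at s and t
    smoothed for a time r, so [heat_contraction] applies. *)
Lemma evolution_average_contraction s t r : 0 < s -> 0 < t -> 0 < r ->
  (\int[mu]_x (`|(u (s + r) x + u (t + r) x) / 2| `^ p)%:E <=
   \int[mu]_x (`|(u s x + u t x) / 2| `^ p)%:E)%E.
Proof.
move=> s0 t0 r0.
have [M hM] := bu s0.
have [M' hM'] := bu t0.
pose v x := (u s x + u t x) / 2.
have mv : measurable_fun setT v.
  by apply: measurable_funM => //; apply: measurable_funD; exact: mu_.
have vM x : `|v x| <= (M + M') / 2.
  rewrite /v normrM normfV (ger0_norm (ler0n _ 2)) ler_pM2r ?invr_gt0//.
  by rewrite (le_trans (ler_normD _ _))// lerD.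
have E x : (u (s + r) x + u (t + r) x) / 2 = \int[mu]_z (v (x - z) * heat_kernel r z).
  have i1 : mu.-integrable setT (fun z => (u s (x - z) * heat_kernel r z)%:E).
    exact: (integrable_heat r0 (measurable_reflect x (mu_ s0)) (fun z => hM (x - z))).
  have i2 : mu.-integrable setT (fun z => (u t (x - z) * heat_kernel r z)%:E).
    exact: (integrable_heat r0 (measurable_reflect x (mu_ t0)) (fun z => hM' (x - z))).
  have i3 : mu.-integrable setT (fun z => (u s (x - z) * heat_kernel r z + u t (x - z) * heat_kernel r z)%:E).
    by under eq_fun do rewrite EFinD; exact: integrableD.
  rewrite su// su//.
  rewrite -(RintegralD measurableT i1 i2) mulrC -(RintegralZl _ measurableT i3).
  by apply: eq_Rintegral => z _; rewrite /v; ring.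
under eq_integral do rewrite E.
exact: (heat_contraction p1 r0 mv vM).
Qed.

Lemma evolution_noninc s t : 0 < s -> s <= t ->
  (\int[mu]_x (`|u t x| `^ p)%:E <= \int[mu]_x (`|u s x| `^ p)%:E)%E.
Proof.
move=> s0; rewrite le_eqVlt => /predU1P[->//|st].
have ts : 0 < t - s by rewrite subr_gt0.
have E r : (\int[mu]_x (`|(u r x + u r x) / 2| `^ p)%:E = \int[mu]_x (`|u r x| `^ p)%:E)%E.
  by apply: eq_integral => x _; congr ((`|_| `^ p)%:E); field.
have H := evolution_average_contraction s0 s0 ts.
rewrite (_ : s + (t - s) = t) in H; last by rewrite addrC subrK.
have eq_le (a b : \bar R) : a = b -> (a <= b)%E by move=> ->.
exact: le_trans (eq_le _ _ (esym (E t))) (le_trans H (eq_le _ _ (E s))).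
Qed.

Context (A : R) (uA : forall t, 0 < t -> (\int[mu]_x (`|u t x| `^ p)%:E <= A%:E)%E).

Let N t := (\int[mu]_x (`|u t x| `^ p)%:E)%E.

Let N0 t : (0 <= N t)%E.
Proof. by apply: integral_ge0. Qed.

Let supN := ereal_sup [set N t | t in [set t | 0 < t]].

Let supN_le : (supN <= A%:E)%E.
Proof. by apply: ge_ereal_sup => _ [t t0 <-]; exact: uA. Qed.

Let le_supN t : 0 < t -> (N t <= supN)%E.
Proof. by move=> t0; apply: ereal_sup_ubound; exists t. Qed.

Let supN0 : (0 <= supN)%E.
Proof. exact: le_trans (N0 1) (le_supN ltr01). Qed.

Let S := fine supN.

Let SE : supN = S%:E.
Proof. by rewrite /S fineK// ge0_fin_numE// (le_lt_trans supN_le)// ltry. Qed.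

Let S0 : 0 <= S. Proof. by rewrite -lee_fin -SE. Qed.

(* The average of two heat flows at small times dominates, after further
   smoothing, the norm of the flow at a fixed time. *)
Let average_lower (eta : R) : 0 < eta -> exists2 t0 : R, 0 < t0 & forall s t,
  0 < s < t0 -> 0 < t < t0 ->
  ((S - eta)%:E <= \int[mu]_x (`|(u s x + u t x) / 2| `^ p)%:E)%E.
Proof.
move=> e0.
have [_ [r r0 <-] rS] : exists2 y, [set N t | t in [set t | 0 < t]] y & ((S - eta)%:E < y)%E.
  by apply: ereal_sup_gt; rewrite -/supN SE lte_fin ltrBlDr ltrDl.
(* Lowering |u_r| by 1 / (k + 1) costs little in the integral: by Fatou some k still exceeds S -
   eta. In exchange, any function within 1 / (k + 1) of u_r uniformly has its p-th power at least
   [f k] everywhere, a comparison that survives integration over infinite measure. *)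
pose f k x := `|Num.max 0 (`|u r x| - k.+1%:R^-1)| `^ p.
have mf k : measurable_fun setT (fun x => (f k x)%:E).
  apply: mpow; apply: measurable_maxr => //; apply: measurable_funB => //.
  by apply: measurableT_comp => //; exact: mu_.
have [k hk] : exists k, ((S - eta)%:E < \int[mu]_x (f k x)%:E)%E.
  apply: contrapT => /forallNP h.
  move: rS; rewrite ltNge => /negP; apply.
  apply: (@fatou_le _ _ R mu (fun k x => (f k x)%:E)) => //.
  - by move=> k x; exact: pow_ge0.
  - move=> x; apply: cvg_EFin; first exact: nearW.
    suff : f k x @[k --> \oo] --> `| (`|u r x|) | `^ p by rewrite normr_id.
    apply: (@cvg_powR_norm R p (fun k => Num.max 0 (`|u r x| - k.+1%:R^-1))) => //.
    apply/cvgrPdist_le => e e1.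
    have /cvgrPdist_le/(_ _ e1) := @cvg_harmonic R.
    apply: filterS => k; rewrite sub0r normrN /harmonic/= ger0_norm ?invr_ge0// => ke.
    have := normr_ge0 (u r x); set a := `|u r x| => a0.
    have k0 : 0 <= k.+1%:R^-1 :> R by rewrite invr_ge0.
    have [ak|ak] := leP 0 (a - k.+1%:R^-1).
      by rewrite opprB addrCA subrr addr0 ger0_norm.
    by rewrite subr0 ger0_norm// (le_trans _ ke)// ltW// -subr_lt0.
  - by move=> k; rewrite leNgt; apply/negP; exact: h.
have d0 : 0 < k.+1%:R^-1 :> R by rewrite invr_gt0.
have [t0 t00 ht0] := cu r0 d0.
exists t0; [exact: t00|move=> s t st tt]; have /andP[s0 _] := st; have /andP[t_gt0 _] := tt.
apply: le_trans (evolution_average_contraction s0 t_gt0 r0).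
apply: (le_trans (ltW hk)); apply: ge0_le_integralT => x; first exact: pow_ge0.
rewrite lee_fin /f; apply: ge0_ler_powR; rewrite ?nnegrE//; first exact: ltW.
have := ht0 s x st; have := ht0 t x tt; rewrite (addrC s) (addrC t).
move: (u r x) (u (r + s) x) (u (r + t) x) (k.+1%:R^-1 : R) => a b c e h1 h2.
rewrite [leLHS]ger0_norm ?le_max ?lexx// ge_max normr_ge0/=.
have -> : (b + c) / 2 = a - ((a - b) + (a - c)) / 2 by field.
rewrite lerBlDr (le_trans (_ : `|a| <= `|a - (a - b + (a - c)) / 2| + `|(a - b + (a - c)) / 2|))//.
  by rewrite -{1}(subrK ((a - b + (a - c)) / 2) a) ler_normD.
rewrite lerD2l normrM normfV (ger0_norm (ler0n _ 2)) ler_pdivrMr//.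
by rewrite (le_trans (ler_normD _ _))// mulrDr !mulr1 lerD.
Qed.

Lemma evolution_cauchy (eps : R) : 0 < eps -> exists2 t0 : R, 0 < t0 & forall s t,
  0 < s < t0 -> 0 < t < t0 -> (\int[mu]_x (`|u s x - u t x| `^ p)%:E <= eps%:E)%E.
Proof.
(* The final bound is 2 e1 S + C eta; [e1] and the later [eta] make each term at most eps / 2. *)
move=> eps0; pose e1 := eps / (4 * (S + 1)).
have S1 : 0 < S + 1 by rewrite ltr_wpDl.
have e10 : 0 < e1 by rewrite divr_gt0// mulr_gt0.
have [C C0 hC] := uniform_convexity p1 e10.
pose eta := eps / (2 * (C + 1)).
have C1 : 0 < C + 1 by rewrite ltr_wpDl.
have eta0 : 0 < eta by rewrite divr_gt0// mulr_gt0.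
have [t0 t00 ht0] := average_lower eta0.
exists t0; [exact: t00|move=> s t st tt]; have /andP[s0 _] := st; have /andP[t_gt0 _] := tt.
have mD : measurable_fun setT (fun x => u s x - u t x) by apply: measurable_funB; exact: mu_.
have mAv : measurable_fun setT (fun x => (u s x + u t x) / 2).
  by apply: measurable_funM => //; apply: measurable_funD; exact: mu_.
have c0 : 0 <= e1 + C / 2 by apply: addr_ge0; [exact: ltW|exact: divr_ge0].
(* Uniform convexity integrated in additive form, which avoids subtracting extended reals. *)
have H : (\int[mu]_x (`|u s x - u t x| `^ p)%:E +
    C%:E * \int[mu]_x (`|(u s x + u t x) / 2| `^ p)%:E <=
    (e1 + C / 2)%:E * (N s + N t))%E.
  rewrite -ge0_integralZl_EFin//; last exact: mpow.
  rewrite -ge0_integralD//; last 3 first.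
  - exact: mpow.
  - by move=> x _; rewrite mule_ge0.
  - by apply: emeasurable_funM => //; exact: mpow.
  rewrite /N -ge0_integralD//; [|exact: mpow (mu_ s0)|exact: mpow (mu_ t_gt0)].
  rewrite -ge0_integralZl_EFin//; last 2 first.
  - by move=> x _; rewrite adde_ge0.
  - by apply: emeasurable_funD; [exact: mpow (mu_ s0)|exact: mpow (mu_ t_gt0)].
  apply: ge0_le_integralT => x; first by rewrite adde_ge0// mule_ge0.
  rewrite -[leLHS]/((_ + C * _)%:E) -[leRHS]/((_ * (_ + _))%:E) lee_fin.
  have := hC (u s x) (u t x).
  move: (_ `^ p) (_ `^ p) (_ `^ p) (_ `^ p) => a b c d h.
  by rewrite -lerBrDr (le_trans h)// le_eqVlt; apply/orP; left; apply/eqP; field.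
have Nfin r : 0 < r -> N r \is a fin_num.
  by move=> r0; rewrite ge0_fin_numE// (le_lt_trans (uA r0))// ltry.
have NS r : 0 < r -> fine (N r) <= S.
  by move=> r0; rewrite -lee_fin fineK ?Nfin// -SE; exact: le_supN.
have I0 : (0 <= \int[mu]_x (`|u s x - u t x| `^ p)%:E)%E by exact: integral_ge0.
have J := ht0 s t st tt.
move: H I0 J; rewrite -(fineK (Nfin _ s0)) -(fineK (Nfin _ t_gt0)).
have := NS _ s0; have := NS _ t_gt0.
move: (fine _) (fine _) => a b hb ha.
set I := (\int[mu]_x (`|u s x - u t x| `^ p)%:E)%E.
set J := (\int[mu]_x (`|(u s x + u t x) / 2| `^ p)%:E)%E.
move: I J => I J H I0 hJ.
have h2 : (I + (C * (S - eta))%:E <= ((e1 + C / 2) * (a + b))%:E)%E.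
  rewrite (EFinM C) (EFinM (e1 + _)) (EFinD a); apply: le_trans H.
  by rewrite leeD2l// lee_wpmul2l ?lee_fin.
have Ifin : I \is a fin_num.
  rewrite ge0_fin_numE// ltey; apply/eqP => Iy; move: h2; rewrite Iy.
  by rewrite addye// leye_eq.
move: h2; rewrite -(fineK Ifin) -EFinD !lee_fin -lerBrDr => /le_trans; apply.
have h3 : (e1 + C / 2) * (a + b) <= (e1 + C / 2) * (S + S).
  by rewrite ler_wpM2l// lerD.
rewrite lerBlDr (le_trans h3)//.
have h4 : e1 * (S + 1) = eps / 4 by rewrite /e1; field; rewrite gt_eqF.
have h5 : eta * (C + 1) = eps / 2 by rewrite /eta; field; rewrite gt_eqF.
have := ltW eta0; have := ltW e10; nra.
Qed.

Let k0 k : 0 < k.+1%:R^-1 :> R. Proof. by rewrite invr_gt0. Qed.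

Let small (t0 : R) : 0 < t0 -> exists K, forall k, (K <= k)%N -> 0 < (k.+1%:R^-1 : R) < t0.
Proof.
move=> t00; have /cvgrPdist_lt/(_ _ t00) := @cvg_harmonic R.
move=> [K _ hK]; exists K => k Kk; rewrite k0/=.
by have := hK k Kk; rewrite /= sub0r normrN ger0_norm// ltW.
Qed.

Lemma evolution_limit : exists Y : 'rV[R]_n -> R, [/\ measurable_fun setT Y,
  forall eps : R, 0 < eps -> exists K, forall k, (K <= k)%N ->
    (\int[mu]_x (`|u k.+1%:R^-1 x - Y x| `^ p)%:E <= eps%:E)%E,
  forall c, (forall k, \int[mu]_x (`|u k.+1%:R^-1 x| `^ p)%:E <= c)%E ->
    (\int[mu]_x (`|Y x| `^ p)%:E <= c)%E &
  forall (phi : schwartz R n) (L : R), (forall eps : R, 0 < eps ->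
    exists2 t0 : R, 0 < t0 & forall t, 0 < t < t0 ->
      `|L - \int[mu]_z (u t z * phi z)| <= eps) ->
    L = \int[mu]_x (Y x * phi x)].
Proof.
have [|Y [mY hY hc]] := @Lp_cauchy_limit _ _ R mu p p0 (fun k => u k.+1%:R^-1) (fun k => mu_ (k0 k)).
  move=> eps /evolution_cauchy[t0 /small[K hK] ht0]; exists K => j k Kj Kk.
  by apply: ht0; exact: hK.
exists Y; split => // phi L hL.
have := schwartz_funP phi; rewrite inE/= => -[sphi rphi].
have [C C0 [hC _]] := schwartz_decay sphi rphi.
have mphi : measurable_fun setT phi.
  apply: continuous_measurable_rV => x; apply: differentiable_continuous.
  exact: (sphi [::]).
have phiC x : `|phi x| <= C by rewrite (le_trans (hC x))// ler_piMr// weight_le1.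
have fi : (\int[mu]_z (`|phi z|)%:E < +oo)%E.
  apply: (@le_lt_trans _ _ (\int[mu]_z (C%:E * (weight z)%:E))%E).
    by apply: ge0_le_integralT => z; rewrite lee_fin.
  rewrite ge0_integralZl_EFin//; last 2 first.
  - by move=> z _; rewrite lee_fin ltW// weight_gt0.
  - by apply/measurable_EFinP; exact: measurable_weight.
  by rewrite lte_mul_pinfty// integral_weight_lty.
pose m := fine (\int[mu]_z (`|phi z|)%:E) + 1.
have I0 : (0 <= \int[mu]_z (`|phi z|)%:E)%E by exact: integral_ge0.
have m0 : 0 < m by rewrite ltr_wpDl// fine_ge0.
have fm : (\int[mu]_z (`|phi z|)%:E <= m%:E)%E by rewrite EFinD fineK ?ge0_fin_numE// leeDl.
apply/eqP; rewrite -subr_eq0 -normr_le0; apply/ler_addgt0Pr => e e0; rewrite add0r.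
have e20 : 0 < e / 2 by rewrite divr_gt0.
have [t0 /small[K hK] ht0] := hL _ e20.
pose c := m `^ (p - 1) * (C + 1).
have c0 : 0 < c by rewrite mulr_gt0 ?powR_gt0// ltr_wpDl.
(* Makes the bound of [Rintegral_Lp_close], which is (c eps)^(1/p), equal to e / 2. *)
pose eps := (e / 2) `^ p / c.
have eps0 : 0 < eps by rewrite divr_gt0 ?powR_gt0.
have [K' hK'] := hY eps eps0.
pose k := maxn K K'.
have [M hM] := bu (k0 k).
have C10 : 0 <= C + 1 by rewrite addr_ge0.
have phiC1 x : `|phi x| <= C + 1 by rewrite (le_trans (phiC x))// lerDl.
have iu : mu.-integrable setT (fun x => (u k.+1%:R^-1 x * phi x)%:E).
  exact: (@integrable_bounded_mul _ _ _ mu _ _ M) (mu_ (k0 k)) mphi hM fi.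
have [iY close] := Rintegral_Lp_close p1 m0 C10 (ltW eps0) (mu_ (k0 k)) mY mphi phiC1 fm
  (hK' k (leq_maxr _ _)) iu.
have := ht0 k.+1%:R^-1 (hK k (leq_maxl _ _)) => close2.
rewrite -(subrK (\int[mu]_x (u k.+1%:R^-1 x * phi x)) L) -addrA.
rewrite (le_trans (ler_normD _ _))// (splitr e) lerD//.
rewrite (le_trans close)// /eps mulrA -/c mulrC divfK ?gt_eqF//.
by rewrite -powRrM mulfV ?gt_eqF// powRr1// ltW.
Qed.

End heat_evolution.

Section heat_limit.
Context {R : realType} {n : nat} (n0 : (0 < n)%N) (p alpha : R) (p1 : 1 < p)
        (a01 : 0 < alpha < 1) (T : tempered R n) (hT : neg_sobolev alpha p T).
Local Notation mu := (@lebesgue_rV R n).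
Local Notation u := (fun t => convolution T (heat n t)).

Lemma heat_flow_noninc s t : 0 < s -> s <= t ->
  (\int[mu]_x (`|u t x| `^ p)%:E <= \int[mu]_x (`|u s x| `^ p)%:E)%E.
Proof.
exact: (@evolution_noninc R n p p1 u (measurable_heat_flow n0 p1 a01 hT)
  (heat_flow_bounded n0 p1 a01 hT) (heat_flow_semigroup n0 p1 a01 hT)).
Qed.

Lemma heat_flow_limit (A : R) :
  (forall t, 0 < t -> (\int[mu]_x (`|u t x| `^ p)%:E <= A%:E)%E) ->
  exists Y : 'rV[R]_n -> R, [/\ measurable_fun setT Y,
  forall eps : R, 0 < eps -> exists K, forall k, (K <= k)%N ->
    (\int[mu]_x (`|u k.+1%:R^-1 x - Y x| `^ p)%:E <= eps%:E)%E,
  forall c, (forall k, \int[mu]_x (`|u k.+1%:R^-1 x| `^ p)%:E <= c)%E ->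
    (\int[mu]_x (`|Y x| `^ p)%:E <= c)%E &
  forall phi : schwartz R n, T phi = \int[mu]_x (Y x * phi x)].
Proof.
move=> uA; have [Y [mY h1 h2 h3]] := @evolution_limit R n p p1 u
  (measurable_heat_flow n0 p1 a01 hT) (heat_flow_bounded n0 p1 a01 hT)
  (heat_flow_semigroup n0 p1 a01 hT) (heat_flow_cvg_uniform n0 p1 a01 hT) A uA.
exists Y; split => // phi; apply: h3 => eps e0.
exact: (heat_flow_pairing n0 p1 a01 hT phi e0).
Qed.

End heat_limit.

(** * Random elements of L^p *)

Section Lp_elements.
Context {R : realType} {n : nat} {p : R} (p1 : 1 < p).
Local Notation mu := (@lebesgue_rV R n).
Local Notation L := (Lp n p1).
Implicit Types (f g h : L).

Let p0 : 0 < p. Proof. exact: lt_trans p1. Qed.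

Lemma Lp_measurable f : measurable_fun setT f.
Proof. exact: measurable_funPT. Qed.

Lemma Lp_norm_pow f : (Lp_norm f `^ p = \int[mu]_x (`|f x| `^ p)%:E)%E.
Proof. by rewrite /Lp_norm poweR_Lnorm// gt_eqF. Qed.

Lemma Lp_dist_pow f g : (Lp_dist f g `^ p = \int[mu]_x (`|f x - g x| `^ p)%:E)%E.
Proof. by rewrite /Lp_dist poweR_Lnorm// gt_eqF. Qed.

Lemma Lp_norm_ge0 f : (0 <= Lp_norm f)%E.
Proof. exact: Lnorm_ge0. Qed.

Lemma Lp_dist_ge0 f g : (0 <= Lp_dist f g)%E.
Proof. exact: Lnorm_ge0. Qed.

Lemma Lp_dist_sym f g : Lp_dist f g = Lp_dist g f.
Proof.
rewrite /Lp_dist -oppe_Lnorm; congr Lnorm; apply/funext => x /=.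
by rewrite opprB.
Qed.

Lemma Lp_dist_triangle f g h : (Lp_dist f h <= Lp_dist f g + Lp_dist g h)%E.
Proof.
have m1 : measurable_fun setT (fun x => f x - g x).
  by apply: measurable_funB; exact: Lp_measurable.
have m2 : measurable_fun setT (fun x => g x - h x).
  by apply: measurable_funB; exact: Lp_measurable.
have := minkowski_EFin mu m1 m2 (ltW p1).
rewrite /Lp_dist (_ : EFin \o _ = (fun x => (f x - h x)%:E))//.
by apply/funext => x /=; rewrite addrA subrK.
Qed.

Lemma Lp_dist_refl f : Lp_dist f f = 0%E.
Proof.
rewrite /Lp_dist; under eq_fun do rewrite subrr.
by apply: Lnorm0; rewrite eqe gt_eqF.
Qed.

Lemma Lp_norm_triangle f g : (Lp_norm f <= Lp_norm g + Lp_dist f g)%E.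
Proof.
have m1 : measurable_fun setT (fun x => f x - g x).
  by apply: measurable_funB; exact: Lp_measurable.
have := minkowski_EFin mu (Lp_measurable g) m1 (ltW p1).
rewrite /Lp_norm (_ : EFin \o (g \+ _)%R = EFin \o f)//.
by apply/funext => x /=; rewrite addrC subrK.
Qed.

(** An element of [Lp] is built from the quotient class of [v]. Its coercion to functions picks a
    representative, hence the equality only almost everywhere. *)
Lemma Lp_class (v : 'rV[R]_n -> R) : measurable_fun setT v ->
  (\int[mu]_x (`|v x| `^ p)%:E < +oo)%E ->
  exists f, {ae mu, forall x, f x = v x}.
Proof.
move=> mv vfin.
pose hv := isMeasurableFun.Build _ _ 'rV[R]_n (measurableTypeR R) v mv.
pose vm : {mfun 'rV[R]_n >-> measurableTypeR R} := HB.pack v hv.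
pose q : {mfun_ mu, 'rV[R]_n >-> measurableTypeR R} := (\pi vm)%qT.
have qv : {ae mu, forall x, q x = v x}.
  have : ae_eq_op mu (repr q) vm by rewrite -eqmodE reprK.
  by move=> /asboolP; apply: filterS => x /(_ I).
have mq : measurable_fun setT q by exact: measurable_funPT.
have qfin : finite_norm mu p%:E q.
  rewrite /finite_norm; apply: (@lty_poweRy _ _ p); first by rewrite gt_eqF.
  have -> : ('N[mu]_p%:E[EFin \o q] `^ p)%E = (\int[mu]_x (`|q x| `^ p)%:E)%E.
    by rewrite poweR_Lnorm// gt_eqF.
  have -> : (\int[mu]_x (`|q x| `^ p)%:E)%E = (\int[mu]_x (`|v x| `^ p)%:E)%E; last exact: vfin.
  apply: ae_eq_integral => //.
  - by apply/measurable_EFinP; apply: (measurableT_comp (measurable_powR _)); exact: measurableT_comp.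
  - by apply/measurable_EFinP; apply: (measurableT_comp (measurable_powR _)); exact: measurableT_comp.
  by apply: filterS qv => x qvx _; rewrite qvx.
pose hq := isFinLebesgue.Build _ _ _ mu p%:E (ltW_EFin p1) q qfin.
pose f : L := HB.pack q hq.
by exists f.
Qed.

Lemma Lp_zero_class : exists f, Lp_norm f = 0%E.
Proof.
have [|f hf] := @Lp_class (cst 0) (measurable_cst _).
  by rewrite integral0_eq// => x _; rewrite /cst normr0 powR0// gt_eqF.
exists f.
have H : (Lp_norm f `^ p = 0)%E.
  rewrite Lp_norm_pow -[RHS](@integral0 _ _ _ mu setT); apply: ae_eq_integral => //.
    apply/measurable_EFinP; apply: (measurableT_comp (measurable_powR _)).
    by apply: measurableT_comp => //; exact: Lp_measurable.
  by apply: filterS hf => x -> _; rewrite /cst normr0 powR0// gt_eqF.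
rewrite -[Lp_norm f]poweRe1 ?Lp_norm_ge0// -(@mulfV _ p) ?gt_eqF// poweRrM H poweR0r ?invr_eq0 ?gt_eqF//.
Qed.

Lemma Lp_to_distribution_ae f (v : 'rV[R]_n -> R) (phi : schwartz R n) :
  measurable_fun setT v -> measurable_fun setT phi ->
  {ae mu, forall x, f x = v x} ->
  Lp_to_distribution f phi = \int[mu]_x (v x * phi x).
Proof.
move=> mv mphi fv; rewrite /Lp_to_distribution /Rintegral; congr fine.
apply: ae_eq_integral => //.
- by apply/measurable_EFinP; apply: measurable_funM => //; exact: Lp_measurable.
- by apply/measurable_EFinP; exact: measurable_funM.
by apply: filterS fv => x -> _.
Qed.

(** Feeds [measurable_Lp_norm]: the rays ]c, +oo] generate the sigma-algebra of the extended
    reals. *)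
Lemma Lp_open_gt (c : \bar R) : Lp_open [set f : L | (c < Lp_norm f)%E].
Proof.
move=> f /= cf.
have ffin : Lp_norm f \is a fin_num.
  by rewrite ge0_fin_numE ?Lp_norm_ge0//; exact: Lebesgue_finite.
case: c cf => [c| |]; last 2 first.
- by rewrite ltNge leey.
- by move=> _; exists 1 => // g _ /=; rewrite (lt_le_trans _ (Lp_norm_ge0 g))// ltNy0.
rewrite -(fineK ffin) lte_fin => cf.
exists (fine (Lp_norm f) - c); first by rewrite subr_gt0.
move=> g /= fg; rewrite ltNge; apply/negP => gc.
have h : (c%:E + Lp_dist f g < c%:E + (fine (Lp_norm f) - c)%:E)%E by rewrite lteD2lE.
have := le_lt_trans (Lp_norm_triangle f g) (le_lt_trans (leeD gc (lexx _)) h).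
by rewrite -EFinD addrC subrK fineK// ltxx.
Qed.

(** * Measurability of maps with values in L^p *)

Section random.
Context (d : measure_display) (Omega : measurableType d).
Implicit Types (Z Y : Omega -> L).

Definition Lp_open_measurable Z := forall U, Lp_open U -> measurable (Z @^-1` U).

Lemma Lp_simple_open_measurable Z : Lp_simple Z -> Lp_open_measurable Z.
Proof.
move=> [fZ mZ] U _.
rewrite (_ : Z @^-1` U = \bigcup_(f in range Z `&` U) Z @^-1` [set f]); last first.
  apply/seteqP; split => [w Uw|w [f [_ Uf] /= ->]//].
  by exists (Z w) => //; split => //; exists w.
by apply: fin_bigcup_measurable => [|f _]; [exact: finite_setIl|exact: mZ].
Qed.

(** The limit lies in [U] exactly when, for some m, the approximations eventually lie in the set
    [V m] of points deeper than 1 / (m + 1) inside [U]. This writes the preimage with countable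
    operations. *)
Lemma Lp_limit_open_measurable (Zk : nat -> Omega -> L) Z :
  (forall k, Lp_open_measurable (Zk k)) ->
  (forall w, Lp_dist (Zk k w) (Z w) @[k --> \oo] --> 0%E) -> Lp_open_measurable Z.
Proof.
move=> mZk cZ U oU.
(* The strict inequality on the radius leaves the room that makes [V m] open. *)
pose V m := [set f | exists2 e : R, m.+1%:R^-1 < e & [set g | (Lp_dist f g < e%:E)%E] `<=` U].
have oV m : Lp_open (V m).
  move=> f [e me eU]; pose e' := (m.+1%:R^-1 + e) / 2.
  have [me' e'e] : m.+1%:R^-1 < e' /\ e' < e.
    by move: me; rewrite /e'; move: (_^-1 : R) => a ae; split; lra.
  exists (e - e'); first by rewrite subr_gt0.
  move=> g /= fg; exists e' => // h /= gh; apply: eU => /=.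
  rewrite (le_lt_trans (Lp_dist_triangle f g h))//.
  by rewrite -(subrK e' e) EFinD lteD.
rewrite (_ : Z @^-1` U = \bigcup_m \bigcup_K \bigcap_(k in [set k | (K <= k)%N]) (Zk k @^-1` V m)).
  apply: bigcup_measurable => m _; apply: bigcup_measurable => K _.
  by apply: bigcap_measurable; [exists K => /=|move=> k _; exact: mZk].
apply/seteqP; split => w /=.
  move=> Uw; have [e e0 eU] := oU _ Uw.
  have e20 : 0 < e / 2 by rewrite divr_gt0.
  have [M _ hM] : \forall k \near \oo, k.+1%:R^-1 < e / 2.
    have /cvgrPdist_lt/(_ _ e20) := @cvg_harmonic R.
    by apply: filterS => k; rewrite /= sub0r normrN ger0_norm.
  have [K _ hK] : \forall k \near \oo, (Lp_dist (Zk k w) (Z w) < (e / 2)%:E)%E.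
    have /fine_cvgP[fin /cvgrPdist_lt/(_ _ e20)] := cZ w.
    move: fin; apply: filterS2 => k fin; rewrite /= sub0r normrN ger0_norm ?fine_ge0 ?Lp_dist_ge0//.
    by rewrite -lte_fin fineK.
  exists M => //; exists K => // k /= Kk; exists (e / 2); first by apply: hM => /=.
  move=> g /= Zg; apply: eU => /=; rewrite (le_lt_trans (Lp_dist_triangle _ (Zk k w) _))//.
  by rewrite (splitr e) EFinD lteD// Lp_dist_sym; exact: hK.
move=> [M _ [K _ hK]].
have m0 : 0 < M.+1%:R^-1 :> R by rewrite invr_gt0.
have [K' _ hK'] : \forall k \near \oo, (Lp_dist (Zk k w) (Z w) < (M.+1%:R^-1)%:E)%E.
  have /fine_cvgP[fin /cvgrPdist_lt/(_ _ m0)] := cZ w.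
  move: fin; apply: filterS2 => k fin; rewrite /= sub0r normrN ger0_norm ?fine_ge0 ?Lp_dist_ge0//.
  by rewrite -lte_fin fineK.
have [e Me eU] := hK (maxn K K') (leq_maxl _ _).
by apply: eU => /=; rewrite (lt_trans (hK' _ (leq_maxr _ _)))// lte_fin.
Qed.

Lemma Lp_strongly_open_measurable Z : Lp_strongly_measurable Z -> Lp_open_measurable Z.
Proof.
move=> [Zk [sZ cZ]]; apply: Lp_limit_open_measurable cZ => k.
exact: Lp_simple_open_measurable.
Qed.

Lemma Lp_open_measurable_random Z : Lp_open_measurable Z -> Lp_random_variable Z.
Proof.
move=> mZ B BB; rewrite -[X in measurable X]setTI.
suff H : <<s @Lp_open R n p p1 >> `<=` image_set_system setT Z measurable by exact: H.
apply: smallest_sub; first exact: sigma_algebra_image (sigma_algebra_measurable _).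
by move=> U oU; rewrite /image_set_system /= setTI; exact: mZ.
Qed.

Lemma measurable_Lp_norm Z : Lp_open_measurable Z -> measurable_fun setT (fun w => Lp_norm (Z w)).
Proof.
move=> mZ; apply: (measurability _ (ErealGenOInfty.measurableE R)).
move=> _ [_ [c ->] <-]; rewrite setTI.
have := mZ _ (@Lp_open_gt c%:E); congr measurable.
by apply/seteqP; split => w /=; rewrite in_itv/= andbT.
Qed.

(** Convergence is only known on the good event [A]. Setting the approximations to [f0] outside
    makes them converge everywhere and keeps them measurable. *)
Lemma Lp_random_limit_on (A : set Omega) (Zk : nat -> Omega -> L) Y (f0 : L) :
  measurable A -> (forall k, Lp_open_measurable (Zk k)) ->
  (forall w, A w -> Lp_dist (Zk k w) (Y w) @[k --> \oo] --> 0%E) ->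
  (forall w, ~ A w -> Y w = f0) -> Lp_random_variable Y.
Proof.
move=> mA mZ cZ Yf0; apply: Lp_open_measurable_random.
pose Z' k w := if w \in A then Zk k w else f0.
have Z'in k w : A w -> Z' k w = Zk k w by move=> Aw; rewrite /Z' mem_set.
have Z'out k w : ~ A w -> Z' k w = f0 by move=> nA; rewrite /Z' memNset.
apply: (@Lp_limit_open_measurable Z') => [k U oU|w]; last first.
  have [Aw|nA] := pselect (A w).
    by under eq_fun do rewrite Z'in//; exact: cZ.
  under eq_fun do rewrite Z'out//.
  by rewrite Yf0// Lp_dist_refl; exact: cvg_cst.
rewrite (_ : Z' k @^-1` U = (A `&` Zk k @^-1` U) `|` (~` A `&` [set _ | U f0])); last first.
  apply/seteqP; split => w; last first.
    by move=> [[Aw Uw]|[nA Uf]]; rewrite /preimage/= ?(Z'in _ _ Aw) ?(Z'out _ _ nA).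
  rewrite {1}/preimage/=; have [Aw|nA] := pselect (A w).
    by rewrite Z'in//; left.
  by rewrite Z'out//; right.
apply: measurableU; first by apply: measurableI => //; exact: mZ.
apply: measurableI; first exact: measurableC.
have [Uf|nUf] := pselect (U f0).
  by rewrite (_ : [set _ | _] = setT)//; apply/seteqP; split.
by rewrite (_ : [set _ | _] = set0)//; apply/seteqP; split.
Qed.

End random.
End Lp_elements.

(** * The random distribution *)

Section extended_sequences.
Context {R : realType}.
Local Open Scope ereal_scope.

Lemma lee_limn_einf (u v : nat -> \bar R) : (forall k, u k <= v k) -> limn_einf u <= limn_einf v.
Proof.
move=> uv; rewrite !limn_einf_lim; apply: lee_lim; [exact: is_cvg_einfs|exact: is_cvg_einfs|].
apply: nearW => k; apply: le_ereal_inf_tmp => _ [m /= km <-].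
by apply: le_trans (uv m); apply: ereal_inf_lbound; exists m.
Qed.

Lemma ge0_cvge0 (u : nat -> \bar R) : (forall k, 0 <= u k) ->
  (forall e : R, (0 < e)%R -> exists K, forall k, (K <= k)%N -> u k <= e%:E) ->
  u k @[k --> \oo] --> 0.
Proof.
move=> u0 hu; apply/fine_cvgP.
have fin e K k : (forall k, (K <= k)%N -> u k <= e%:E) -> (K <= k)%N -> u k \is a fin_num.
  by move=> h Kk; rewrite ge0_fin_numE// (le_lt_trans (h k Kk))// ltry.
split.
  by have [K hK] := hu _ ltr01; exists K => // k /= Kk; exact: (fin _ _ _ hK Kk).
apply/cvgrPdist_le => e e0; have [K hK] := hu e e0; exists K => // k /= Kk.
by rewrite sub0r normrN ger0_norm ?fine_ge0// -lee_fin fineK ?(fin e K)//; exact: hK.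
Qed.

(** For fixed [delta] the power of [delta] tends to 1 as its exponent tends to 0, so the left factor
    converges to 2 / p. [E] is finite because already the inequality for j = 0 bounds it. *)
Lemma le_limn_einf_powR (p delta : R) (E : \bar R) (alpha : nat -> R) (I : nat -> \bar R) :
  (0 < p)%R -> (0 < delta)%R -> 0 <= E -> (alpha j @[j --> \oo] --> 0)%R ->
  (forall j, I j < +oo) ->
  (forall j, (2 / p * delta `^ (alpha j * p / 2))%:E * E <= I j) ->
  E <= (p / 2)%:E * limn_einf I.
Proof.
move=> p0 d0 E0 alpha0 Iy step.
pose c j := (2 / p * delta `^ (alpha j * p / 2))%R.
have cj j : (0 < c j)%R by rewrite mulr_gt0 ?powR_gt0// divr_gt0.
have Efin : E \is a fin_num.
  rewrite ge0_fin_numE// ltey; apply/eqP => Ey.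
  have := le_lt_trans (step 0%N) (Iy 0%N); rewrite -/(c 0%N) Ey.
  by rewrite gt0_muley ?lte_fin// ltxx.
have cc : (c j @[j --> \oo] --> 2 / p)%R.
  rewrite -[X in _ --> X]mulr1; apply: cvgM; first exact: cvg_cst.
  have e0 : (alpha j * p / 2 * ln delta @[j --> \oo] --> 0 * p / 2 * ln delta)%R.
    by do 3 (apply: cvgM; last exact: cvg_cst).
  rewrite !mul0r in e0.
  have := continuous_cvg _ (@continuous_expR R 0%R) e0; rewrite expR0.
  rewrite (_ : (fun j => _ `^ _)%R = (fun j => expR (alpha j * p / 2 * ln delta)%R)).
    by apply.
  by apply/funext => j; rewrite /powR gt_eqF.
have cE : (c j)%:E * E @[j --> \oo] --> (2 / p)%:E * E.
  rewrite -(fineK Efin); under eq_fun do rewrite -EFinM.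
  rewrite -EFinM; apply: cvg_EFin; first exact: nearW.
  by apply: cvgM => //; exact: cvg_cst.
have [HL _] := cvg_limn_einf_sup cE.
have := lee_limn_einf step; rewrite HL => h.
apply: (@le_trans _ _ ((p / 2)%:E * ((2 / p)%:E * E))).
  rewrite muleA -EFinM (_ : p / 2 * (2 / p) = 1)%R ?mul1e//.
  by field; rewrite gt_eqF.
by rewrite lee_wpmul2l// lee_fin divr_ge0// ltW.
Qed.

End extended_sequences.

Section negative_sobolev_norm.
Context {R : realType} {n : nat} (n0 : (0 < n)%N) (p alpha : R) (p1 : 1 < p)
        (a01 : 0 < alpha < 1) (T : tempered R n) (hT : neg_sobolev alpha p T).
Local Notation mu := (@lebesgue_rV R n).
Local Notation leb := (@lebesgue_measure R).

Let p0 : 0 < p. Proof. exact: lt_trans p1. Qed.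

Lemma neg_sobolev_norm_ge (delta : R) : 0 < delta <= 1 ->
  ((2 / p * delta `^ (alpha * p / 2))%:E *
     \int[mu]_x (`|convolution T (heat n delta) x| `^ p)%:E <=
   alpha%:E * neg_sobolev_norm alpha p T `^ p)%E.
Proof.
move=> /andP[d0 d1]; have /andP[a0 a1] := a01.
pose N t := (\int[mu]_x (`|convolution T (heat n t) x| `^ p)%:E)%E.
have N0 t : (0 <= N t)%E by apply: integral_ge0 => x _; rewrite lee_fin powR_ge0.
pose b := alpha * p / 2; have b0 : 0 < b by rewrite divr_gt0// mulr_gt0.
pose F (t : R) := (((t `^ (alpha / 2))%:E *
        'N[mu]_p%:E [EFin \o convolution T (heat n t)]) `^ p * t^-1%:E)%E.
have F0 t : 0 < t -> (0 <= F t)%E.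
  by move=> t0; rewrite mule_ge0 ?poweR_ge0// lee_fin invr_ge0 ltW.
have normE : (neg_sobolev_norm alpha p T `^ p = \int[leb]_(t in `]0%R, 1%R[) F t)%E.
  rewrite /neg_sobolev_norm; case: asboolP => // _.
  rewrite -poweRrM mulVf ?gt_eqF// poweRe1//.
  by apply: integral_ge0 => t /=; rewrite in_itv/= => /andP[t0 _]; exact: F0.
have FE t : 0 < t -> F t = ((t `^ (b - 1))%:E * N t)%E.
  move=> t0; rewrite /F poweRM ?lee_fin ?powR_ge0 ?Lnorm_ge0// poweR_EFin.
  rewrite poweR_Lnorm ?gt_eqF// -powRrM muleAC -EFinM.
  have -> : alpha / 2 * p = b by rewrite /b mulrAC.
  have -> : t `^ (b - 1) = t `^ b / t.
    have tn0 : (b == 1) ==> (t != 0) by rewrite gt_eqF// implybT.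
    by rewrite (powRB tn0) powRr1// ltW.
  by [].
have key : ((delta `^ b / b)%:E * N delta <= \int[leb]_(t in `]0%R, 1%R[) F t)%E.
  apply: (@le_trans _ _ (\int[leb]_(t in `]0%R, delta[) ((t `^ (b - 1))%:E * N delta))%E).
    rewrite ge0_integralZr//; last 2 first.
    - by apply/measurable_EFinP; apply: measurable_funTS; exact: measurable_powR.
    - by move=> t _; rewrite lee_fin powR_ge0.
    by rewrite lee_wpmul2r//; exact: integral_powR_ge.
  (* With both integrands extended by 0 to the line, [ge0_le_integralT] applies without
     measurability of [F] in t. *)
  rewrite integral_mkcond [leRHS]integral_mkcond.
  apply: ge0_le_integralT => t; rewrite !patchE.
    by case: ifPn => // _; rewrite mule_ge0// lee_fin powR_ge0.
  case: ifPn => [|_]; last first.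
    by case: ifPn => //; rewrite inE/= in_itv/= => /andP[t0 _]; exact: F0.
  rewrite inE/= in_itv/= => /andP[t0 td].
  rewrite ifT; last by rewrite inE/= in_itv/= t0 (lt_le_trans td).
  rewrite (FE t t0); apply: lee_wpmul2l; first by rewrite lee_fin powR_ge0.
  exact: (heat_flow_noninc n0 p1 a01 hT t0 (ltW td)).
(* Since b = alpha p / 2, the factor alpha cancels; this is the origin of the constant p / 2. *)
rewrite normE (_ : 2 / p * _ = alpha * (delta `^ b / b)); last first.
  by rewrite /b; field; rewrite !gt_eqF.
by rewrite EFinM -muleA lee_wpmul2l// lee_fin ltW.
Qed.

(** Transfers [heat_flow_limit] from functions to classes. The bound at the times 1 / (k + 1)
    extends to all times because the flow is nonincreasing. *)
Lemma heat_flow_Lp_limit (z : nat -> Lp n p1) (G : \bar R) :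
  (forall k, {ae mu, forall x, z k x = convolution T (heat n k.+1%:R^-1) x}) ->
  G \is a fin_num ->
  (forall k, (\int[mu]_x (`|convolution T (heat n k.+1%:R^-1) x| `^ p)%:E <= G)%E) ->
  exists y : Lp n p1, [/\ Lp_dist (z k) y @[k --> \oo] --> 0%E,
    (Lp_norm y `^ p <= G)%E &
    forall phi : schwartz R n, T phi = Lp_to_distribution y phi].
Proof.
move=> zu Gfin NG.
have t0 k : 0 < k.+1%:R^-1 :> R by rewrite invr_gt0.
have mu_ k : measurable_fun setT (convolution T (heat n k.+1%:R^-1)).
  by have H := measurable_heat_flow n0 p1 a01 hT (t0 k); exact: H.
have mpow (g : 'rV[R]_n -> R) : measurable_fun setT g -> measurable_fun setT (fun x => (`|g x| `^ p)%:E).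
  move=> mg; apply/measurable_EFinP; apply: (measurableT_comp (measurable_powR _)).
  exact: measurableT_comp.
have uA t : 0 < t -> (\int[mu]_x (`|convolution T (heat n t) x| `^ p)%:E <= (fine G)%:E)%E.
  move=> t_gt0; rewrite fineK//.
  have [K _ hK] : \forall k \near \oo, k.+1%:R^-1 < t.
    have /cvgrPdist_lt/(_ _ t_gt0) := @cvg_harmonic R.
    by apply: filterS => k; rewrite /= sub0r normrN ger0_norm.
  apply: le_trans (NG K).
  apply: (heat_flow_noninc n0 p1 a01 hT (t0 K)).
  by apply: ltW; apply: hK => /=.
have [v [mv hv1 hv2 hv3]] := heat_flow_limit n0 p1 a01 hT uA.
have vG := hv2 _ NG.
have [|y yv] := @Lp_class R n p p1 v mv.
  by rewrite (le_lt_trans vG)// ltey_eq Gfin.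
exists y; split.
- apply: ge0_cvge0 => [k|e e0]; first exact: Lp_dist_ge0.
  have ep : 0 < e `^ p by rewrite powR_gt0.
  have [K hK] := hv1 _ ep; exists K => k Kk.
  rewrite -[e]powRr1 ?(ltW e0)// -(@mulfV _ p) ?gt_eqF// powRrM.
  apply: le_poweR_root => //; first by rewrite powR_ge0.
    exact: Lp_dist_ge0.
  apply: le_trans (hK k Kk); rewrite Lp_dist_pow.
  rewrite le_eqVlt; apply/orP; left; apply/eqP; apply: ae_eq_integral => //.
  + by apply: mpow; apply: measurable_funB; exact: Lp_measurable.
  + by apply: mpow; exact: measurable_funB.
  by move: (zu k) yv; apply: filterS2 => x -> -> _.
- apply: le_trans vG; rewrite Lp_norm_pow.
  rewrite le_eqVlt; apply/orP; left; apply/eqP; apply: ae_eq_integral => //.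
  + by apply: mpow; exact: Lp_measurable.
  + exact: mpow.
  by apply: filterS yv => x -> _.
- move=> phi; rewrite hv3; apply/esym/Lp_to_distribution_ae => //.
  have := schwartz_funP phi; rewrite inE/= => -[sphi _].
  apply: continuous_measurable_rV => x; apply: differentiable_continuous.
  exact: (sphi [::]).
Qed.

End negative_sobolev_norm.

Section probability_space.
Context d (Omega : measurableType d) (R : realType) (P : {measure set Omega -> \bar R}).

Lemma ae_measurable_subset (Q : Omega -> Prop) : {ae P, forall w, Q w} ->
  exists A, [/\ measurable A, P (~` A) = 0%E & forall w, A w -> Q w].
Proof.
move=> [N [mN PN QN]]; exists (~` N); split; first exact: measurableC.
  by rewrite setCK.
by move=> w Nw; apply: contrapT => Qw; apply: Nw; exact: QN.
Qed.

End probability_space.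

Theorem corollary4p3 (R : realType) (n : nat) (n_gt0 : (0 < n)%N)
    (p : R) (p1 : 1 < p)
    (d : measure_display) (Omega : measurableType d) (P : probability Omega R)
    (X : {mfun Omega >-> tempered R n})
    (alpha : nat -> R)
    (alpha01 : forall j, 0 < alpha j < 1)
    (alpha_noninc : {homo alpha : i j / (i <= j)%N >-> j <= i})
    (alpha_cvg0 : alpha j @[j --> \oo] --> 0)
    (X_neg_sobolev : forall j, {ae P, forall w, neg_sobolev (alpha j) p (X w)})
    (X_bounded : (ereal_sup (range (fun j =>
       \int[P]_w ((alpha j)%:E * neg_sobolev_norm (alpha j) p (X w) `^ p)))
       < +oo)%E)
    (X_heat : forall t : R, 0 < t ->
       exists Z : Omega -> Lp n p1, Lp_strongly_measurable Z /\
         {ae P, forall w,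
            {ae lebesgue_rV n, forall x, Z w x = convolution (X w) (heat n t) x}}) :
  exists Y : Omega -> Lp n p1,
    [/\ Lp_random_variable Y,
        {ae P, forall w, forall phi : schwartz R n,
           X w phi = Lp_to_distribution (Y w) phi}
      & (\int[P]_w (Lp_norm (Y w) `^ p) <=
         (p / 2)%:E * limn_einf (fun j =>
           \int[P]_w ((alpha j)%:E * neg_sobolev_norm (alpha j) p (X w) `^ p)))%E].
Proof.
have p0 : 0 < p := lt_trans ltr01 p1.
pose mu := @lebesgue_rV R n.
pose I j := (\int[P]_w ((alpha j)%:E * neg_sobolev_norm (alpha j) p (X w) `^ p))%E.
rewrite -/I in X_bounded *.
have Iw0 j w : (0 <= (alpha j)%:E * neg_sobolev_norm (alpha j) p (X w) `^ p)%E.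
  by rewrite mule_ge0 ?poweR_ge0// lee_fin ltW//; have /andP[] := alpha01 j.
have I0 j : (0 <= I j)%E by exact: integral_ge0.
have Iy j : (I j < +oo)%E.
  by apply: le_lt_trans X_bounded; apply: ereal_sup_ubound; exists j.
have t0 k : 0 < k.+1%:R^-1 :> R by rewrite invr_gt0.
have t1 k : 0 < (k.+1%:R^-1 : R) <= 1 by rewrite t0 invf_le1// ler1n.
have [Z hZ] := choice (fun k => X_heat _ (t0 k)).
have mZ k : Lp_open_measurable (Z k) by apply: Lp_strongly_open_measurable; case: (hZ k).
(* Only countably many almost sure properties are involved, one for each index of the sequence and
   one for each time 1 / (k + 1), so one measurable event carries them all. *)
have [A0 [mA0 PA0 hA0]] : exists A, [/\ measurable A, P (~` A) = 0%E &
    forall w, A w -> (forall j, neg_sobolev (alpha j) p (X w)) /\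
      (forall k, {ae mu, forall x, Z k w x = convolution (X w) (heat n k.+1%:R^-1) x})].
  apply: ae_measurable_subset.
  have h1 : {ae P, forall w, forall j, neg_sobolev (alpha j) p (X w)} by exact: ae_foralln.
  have h2 : {ae P, forall w, forall k,
      {ae mu, forall x, Z k w x = convolution (X w) (heat n k.+1%:R^-1) x}}.
    by apply: ae_foralln => k; have [_] := hZ k.
  by move: h1 h2; apply: filterS2.
pose N k w := (\int[mu]_x (`|convolution (X w) (heat n k.+1%:R^-1) x| `^ p)%:E)%E.
have mconv k w : A0 w -> measurable_fun setT (convolution (X w) (heat n k.+1%:R^-1)).
  move=> Aw; have [/(_ 0%N) hS _] := hA0 _ Aw.
  by have H := measurable_heat_flow n_gt0 p1 (alpha01 0%N) hS (t0 k); exact: H.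
have mpow (g : 'rV[R]_n -> R) : measurable_fun setT g -> measurable_fun setT (fun x => (`|g x| `^ p)%:E).
  move=> mg; apply/measurable_EFinP; apply: (measurableT_comp (measurable_powR _)).
  exact: measurableT_comp.
have ZN k w : A0 w -> (Lp_norm (Z k w) `^ p = N k w)%E.
  move=> Aw; rewrite Lp_norm_pow; apply: ae_eq_integral => //.
  - by apply: mpow; exact: Lp_measurable.
  - by apply: mpow; exact: mconv.
  by have [_ /(_ k)] := hA0 _ Aw; apply: filterS => x -> _.
(* A measurable substitute for [N k], computed from the strongly measurable version and set to 0 off
   the good event. *)
pose g k w := if w \in A0 then (Lp_norm (Z k w) `^ p)%E else 0%E.
have g0 k w : (0 <= g k w)%E by rewrite /g; case: ifP => // _; exact: poweR_ge0.
have mg k : measurable_fun setT (g k).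
  apply: measurable_fun_if => //.
  - apply: (measurable_fun_bool true); rewrite setTI (_ : _ @^-1` _ = A0)//.
    by apply/seteqP; split => w /=; [move/set_mem|move/mem_set].
  - apply: measurable_funTS.
    by apply: (measurableT_comp (measurable_poweR _)); exact: measurable_Lp_norm.
have gN k w : A0 w -> g k w = N k w by move=> Aw; rewrite /g mem_set//; exact: ZN.
have gn k w : ~ A0 w -> g k w = 0%E by move=> nA; rewrite /g memNset.
(* A larger index is an earlier time, so [N k] increases with k. One negative Sobolev space
   containing X w gives its heat flow, and index 0 is as good as any. *)
have N_nd k l w : A0 w -> (k <= l)%N -> (N k w <= N l w)%E.
  move=> Aw kl; have [/(_ 0%N) hS _] := hA0 _ Aw.
  apply: (heat_flow_noninc n_gt0 p1 (alpha01 0%N) hS (t0 l)).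
  by rewrite lef_pV2 ?posrE// ler_nat.
have g_nd k l w : (k <= l)%N -> (g k w <= g l w)%E.
  move=> kl; have [Aw|nA] := pselect (A0 w); last by rewrite (gn k w nA).
  by rewrite (gN k w Aw) (gN l w Aw); exact: N_nd.
have step1 j k : ((2 / p * k.+1%:R^-1 `^ (alpha j * p / 2))%:E * \int[P]_w g k w <= I j)%E.
  have c0 : 0 <= 2 / p * k.+1%:R^-1 `^ (alpha j * p / 2).
    by rewrite mulr_ge0 ?powR_ge0// divr_ge0// ltW.
  rewrite -ge0_integralZl_EFin//.
  apply: ge0_le_integralT => w; first by rewrite mule_ge0.
  have [Aw|nA] := pselect (A0 w); last by rewrite (gn k w nA) mule0.
  rewrite (gN k w Aw); have [/(_ j) hS _] := hA0 _ Aw.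
  exact: (neg_sobolev_norm_ge n_gt0 p1 (alpha01 j) hS (t1 k)).
have Ly : (limn_einf I < +oo)%E.
  apply: le_lt_trans X_bounded; apply: limn_einf_le => j.
  by apply: ereal_sup_ubound; exists j.
have step2 k : (\int[P]_w g k w <= (p / 2)%:E * limn_einf I)%E.
  apply: (@le_limn_einf_powR _ p k.+1%:R^-1 _ alpha) => //; exact: integral_ge0.
(* The increasing limit of the p-th powers: monotone convergence passes the bound on each [g k] to
   [G] without loss. *)
pose G w := limn (g ^~ w).
have g_ndw w : nondecreasing_seq (g ^~ w) by move=> k l; exact: g_nd.
have GE w : G w = ereal_sup (range (g ^~ w)).
  by apply/cvg_lim => //; exact: ereal_nondecreasing_cvgn.
have gG k w : (g k w <= G w)%E by rewrite GE; apply: ereal_sup_ubound; exists k.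
have G0 w : (0 <= G w)%E by exact: le_trans (g0 0%N w) (gG 0%N w).
have IG : (\int[P]_w G w <= (p / 2)%:E * limn_einf I)%E.
  rewrite /G monotone_convergence//.
  apply: lime_le; last exact: nearW.
  apply: ereal_nondecreasing_is_cvgn => k l kl.
  by apply: ge0_le_integralT => // w; exact: g_nd.
have mG : measurable_fun setT G.
  apply: (emeasurable_fun_cvg g) => // w _.
  exact: ereal_nondecreasing_is_cvgn.
have iG : P.-integrable setT G.
  apply/integrableP; split => //.
  under eq_integral do rewrite gee0_abs//.
  by apply: (le_lt_trans IG); rewrite lte_mul_pinfty// lee_fin divr_ge0// ltW.
(* Integrability of [G] makes it finite almost surely, which is what the pathwise limit requires. *)
have [A1 [mA1 PA1 hA1]] := ae_measurable_subset (integrable_ae measurableT iG).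
have mA : measurable (A0 `&` A1) by exact: measurableI.
(* The value of [Y] off the good event has norm 0, so the bound by [G] holds there trivially. *)
have [f0 f0E] := @Lp_zero_class R n p p1.
(* The choice of [Y] is made separately for each outcome. Its measurability comes from
   [Lp_random_limit_on], as the limit of the versions [Z k]. *)
have [Y hY] : exists Y : Omega -> Lp n p1, forall w,
    ((A0 `&` A1) w -> [/\ Lp_dist (Z k w) (Y w) @[k --> \oo] --> 0%E,
       (Lp_norm (Y w) `^ p <= G w)%E &
       forall phi : schwartz R n, X w phi = Lp_to_distribution (Y w) phi]) /\
    (~ (A0 `&` A1) w -> Y w = f0).
  suff /choice[Y hY] : forall w, exists y : Lp n p1,
      ((A0 `&` A1) w -> [/\ Lp_dist (Z k w) y @[k --> \oo] --> 0%E,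
       (Lp_norm y `^ p <= G w)%E &
       forall phi : schwartz R n, X w phi = Lp_to_distribution y phi]) /\
      (~ (A0 `&` A1) w -> y = f0) by exists Y.
  move=> w; have [[Aw A1w]|nA] := pselect ((A0 `&` A1) w); last by exists f0.
  have [/(_ 0%N) hS Zu] := hA0 _ Aw.
  have Gfin : G w \is a fin_num by exact: (hA1 w A1w Logic.I).
  have NG k : (N k w <= G w)%E by rewrite -(gN k w Aw); exact: gG.
  have [y hy] := heat_flow_Lp_limit n_gt0 (alpha01 0%N) hS Zu Gfin NG.
  by exists y; split => // nA; exfalso; exact: (nA (conj Aw A1w)).
exists Y; split.
- apply: (Lp_random_limit_on mA mZ) => w; have [h1 h2] := hY w; last exact: h2.
  by move=> /h1[].
- exists (~` (A0 `&` A1)); split; first exact: measurableC.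
    rewrite setCI; apply: null_set_setU => //; exact: measurableC.
  by move=> w /= h Aw; apply: h; have [/(_ Aw)[]] := hY w.
- apply: le_trans IG; apply: ge0_le_integralT => w; first exact: poweR_ge0.
  have [h1 h2] := hY w; have [Aw|nA] := pselect ((A0 `&` A1) w); first by have [] := h1 Aw.
  by rewrite h2// f0E poweR0r ?gt_eqF.
Qed.
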